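(* Let $F$ be a regularly varying function such that \[ \frac{F(x)}{\log x}\xrightarrow{x\to\infty}\infty \quad\text{and}\quad F(x)\le (1+o(1))\,\frac{1}{(h-1)!}\,\frac{x^{h-1}}{b_1\cdots b_h}. \] Then there exists $A\subseteq\mathbb{Z}_{\ge 0}$ such that $r_{A,h}(n)\sim F(n)$ as $n\to\infty$.
   Context: Fix an integer $h\ge 2$ and positive integers $b_1,\dots,b_h$, not necessarily distinct, with $\gcd(b_1,\dots,b_h)=1$. For $A\subseteq\mathbb{Z}_{\ge 0}$, $1\le\ell\le h$ and an integer $n\ge 0$, let $r_{A,\ell}(n)$ be the number of $\ell$-tuples $(k_1,\dots,k_\ell)\in A^\ell$ with $b_1k_1+\cdots+b_\ell k_\ell=n$. A function $F$ is regularly varying if it is a positive measurable function on $[1,\infty)$ such that for every real $\lambda>0$ the limit $\lim_{x\to\infty}F(\lambda x)/F(x)$ exists and is finite and positive. $X\sim Y$ means $X/Y\to1$. *)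

(* Defs.v *)
From HB Require Import structures.
From mathcomp Require Import all_boot all_order all_algebra.
From mathcomp Require Import all_classical all_reals all_analysis.
From mathcomp Require Import measurable_realfun.
Set Implicit Arguments. Unset Strict Implicit. Unset Printing Implicit Defensive.
Import Order.TTheory GRing.Theory Num.Theory numFieldNormedType.Exports.
Local Open Scope classical_set_scope.
Local Open Scope ring_scope.

(* r_{A,h}(n): number of h-tuples (k_1,..,k_h) in A^h with
   b_1 k_1 + ... + b_h k_h = n.  Since every b_i >= 1 (standing assumption),
   any such k_i satisfies k_i <= n, so tuples are enumerated in 'I_(n+1)^h. *)
Definition rep_count (h : nat) (b : 'I_h -> nat) (A : pred nat) (n : nat) : nat :=
  #|[set k : {ffun 'I_h -> 'I_n.+1} |
     [forall i, A (k i)] && ((\sum_(i < h) b i * k i)%N == n)]|.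

(* Lebesgue measurable subsets of R: the completed (Lebesgue) sigma-algebra,
   i.e. the sigma-algebra generated by sets (Borel set) U (Lebesgue-null set). *)
Definition lebesgue_measurable_set (R : realType) (E : set R) : Prop :=
  (completed_algebra_gen (@lebesgue_measure R)).-sigma.-measurable E.

Definition measurable_on_ge1 (R : realType) (F : R -> R) : Prop :=
  forall B : set R, measurable B ->
    lebesgue_measurable_set ([set x | 1 <= x] `&` F @^-1` B).

Definition regularly_varying (R : realType) (F : R -> R) : Prop :=
  (forall x : R, 1 <= x -> 0 < F x) /\
  measurable_on_ge1 F /\
  (forall lam : R, 0 < lam ->
     exists2 L : R, 0 < L & (F (lam * x) / F x) @[x --> +oo%R] --> (L : R)).

(* Main.v *)
(* Take A random, each x lying in A independently with probability p(x), where p is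
   regularly varying and normalised so that the expected number of representations s(n)
   of n is asymptotic to F(n): writing p(n)^h = F(n) / (C n^(h-1)), the growth of F makes
   the index of p larger than -1, the upper bound on F makes p <= 1 possible, and s(n) is
   an iterated convolution whose asymptotics are a Riemann sum for a Beta integral
   (gcd(b) = 1 removes the arithmetic obstruction).

   Concentration: representations with fewer than h distinct entries, or through
   prescribed elements, number at most n^theta with n^theta log n = o(F(n)).  The lower
   tail is then Janson's inequality; for the upper tail, a surplus of representations
   forces many pairwise disjoint ones, and the expected number of disjoint M-tuples is at
   most s(n)^M.  Both tails are summable in n, so some finite A works up to any N, and
   compactness gives A. *)

Require Import Defs.
From mathcomp Require Import all_boot all_order all_algebra.
From mathcomp Require Import all_classical all_reals all_analysis.
From mathcomp Require Import measurable_realfun lra ring zify.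
Set Implicit Arguments. Unset Strict Implicit. Unset Printing Implicit Defensive.
Import Order.TTheory GRing.Theory Num.Theory numFieldNormedType.Exports.
Local Open Scope ring_scope.

(** * Independent random sets *)

Section bernoulli.
Variables (R : realType) (p : nat -> R).
Hypothesis p01 : forall x, 0 <= p x <= 1.
Implicit Types (A : pred nat) (P Q : pred nat -> Prop) (f g : pred nat -> R).

Definition adjoin (s : seq nat) A : pred nat := fun y => (y \in s) || A y.

Lemma adjoinC s t A : adjoin s (adjoin t A) = adjoin t (adjoin s A).
Proof. by apply/funext => y; rewrite /adjoin orbCA. Qed.

Lemma adjoin_cons x s A : adjoin s (adjoin [:: x] A) = adjoin (x :: s) A.
Proof. by apply/funext => y; rewrite /adjoin !inE orbA [(y \in s) || _]orbC. Qed.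

Lemma adjoin_id x A : A x -> adjoin [:: x] A = A.
Proof. by move=> Ax; apply/funext => y; rewrite /adjoin inE; case: eqP => // ->. Qed.

Lemma adjoin_self x A : adjoin [:: x] A x.
Proof. by rewrite /adjoin mem_head. Qed.

(* Expectation of f A when each x < N lies in A independently with probability p x,
   and no x >= N does. *)
Fixpoint mean (N : nat) f : R :=
  if N is N'.+1 then
    p N' * mean N' (fun A => f (adjoin [:: N'] A)) + (1 - p N') * mean N' f
  else f xpred0.

Lemma mean_le_supp N f g :
  (forall A, (forall x, (N <= x)%N -> A x = false) -> f A <= g A) ->
  mean N f <= mean N g.
Proof.
elim: N f g => [|N IH] f g fg /=; first exact: fg.
have /andP[p0 p1] := p01 N.
apply: lerD; apply: ler_wpM2l; rewrite ?subr_ge0//; apply: IH => A A_off; apply: fg => x Nx.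
  by rewrite /adjoin inE A_off ?(ltnW Nx)// orbF gtn_eqF.
by rewrite A_off// ltnW.
Qed.

Lemma mean_eq_supp N f g :
  (forall A, (forall x, (N <= x)%N -> A x = false) -> f A = g A) ->
  mean N f = mean N g.
Proof. by move=> fg; apply: le_anti; rewrite !mean_le_supp// => A A_off; rewrite fg. Qed.

Lemma mean_le N f g : (forall A, f A <= g A) -> mean N f <= mean N g.
Proof. by move=> fg; apply: mean_le_supp. Qed.

Lemma mean_cst N a : mean N (fun=> a) = a.
Proof. by elim: N => //= N ->; ring. Qed.

Lemma meanD N f g : mean N (fun A => f A + g A) = mean N f + mean N g.
Proof. by elim: N f g => //= N IH f g; rewrite !IH; ring. Qed.

Lemma meanZ N a f : mean N (fun A => a * f A) = a * mean N f.
Proof. by elim: N f => //= N IH f; rewrite !IH; ring. Qed.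

Lemma mean_ge0 N f : (forall A, 0 <= f A) -> 0 <= mean N f.
Proof. by move=> f0; rewrite -[leLHS](mean_cst N); exact: mean_le. Qed.

Lemma mean_sum (I : Type) (r : seq I) (C : pred I) N (f : I -> pred nat -> R) :
  mean N (fun A => \sum_(i <- r | C i) f i A) = \sum_(i <- r | C i) mean N (f i).
Proof.
elim: r => [|i r IH].
  by rewrite big_nil -[RHS](mean_cst N); congr mean; apply/funext => A; rewrite big_nil.
rewrite big_cons -IH; case: ifPn => Ci.
  by rewrite -meanD; congr mean; apply/funext => A; rewrite big_cons Ci.
by congr mean; apply/funext => A; rewrite big_cons (negbTE Ci).
Qed.

Lemma mean_cond1 N x f : (x < N)%N ->
  mean N (fun A => (A x)%:R * f A) = p x * mean N (fun A => f (adjoin [:: x] A)).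
Proof.
elim: N f => // N IH f /=; rewrite ltnS leq_eqVlt => /orP[/eqP <-{IH}|xN].
  have -> : mean x (fun A => (A x)%:R * f A) = 0.
    by rewrite -(mean_cst x 0); apply: mean_eq_supp => A ->; rewrite // mul0r.
  have -> : (fun A => (adjoin [:: x] A x)%:R * f (adjoin [:: x] A)) =
      (fun A => f (adjoin [:: x] A)).
    by apply/funext => A; rewrite adjoin_self mul1r.
  have -> : (fun A => f (adjoin [:: x] (adjoin [:: x] A))) =
      (fun A => f (adjoin [:: x] A)).
    by apply/funext => A; rewrite adjoin_id ?adjoin_self.
  ring.
have -> : (fun A => (adjoin [:: N] A x)%:R * f (adjoin [:: N] A)) =
    (fun A => (A x)%:R * f (adjoin [:: N] A)).
  by apply/funext => A; rewrite {1}/adjoin inE ltn_eqF.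
rewrite !(IH _ xN).
have -> : (fun A => f (adjoin [:: N] (adjoin [:: x] A))) =
    (fun A => f (adjoin [:: x] (adjoin [:: N] A))).
  by apply/funext => A; rewrite adjoinC.
ring.
Qed.

Definition below N (s : seq nat) := uniq s && all (gtn N) s.

Lemma mean_cond N s f : below N s ->
  mean N (fun A => (all A s)%:R * f A) =
  \prod_(x <- s) p x * mean N (fun A => f (adjoin s A)).
Proof.
elim: s f => [|x s IH] f /=.
  by move=> _; rewrite big_nil mul1r; congr mean; apply/funext => A; rewrite mul1r.
move=> /andP[/= /andP[xs us] /andP[xN sN]]; rewrite big_cons.
have -> : (fun A => (A x && all A s)%:R * f A) = (fun A => (A x)%:R * ((all A s)%:R * f A)).
  by apply/funext => A; case: (A x) => /=; rewrite ?mul1r ?mul0r.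
rewrite (mean_cond1 _ xN) -mulrA; congr (_ * _).
have -> : (fun A => (all (adjoin [:: x] A) s)%:R * f (adjoin [:: x] A)) =
    (fun A => (all A s)%:R * f (adjoin [:: x] A)).
  apply/funext => A; congr (_%:R * _); congr nat_of_bool; apply: eq_in_all => y ys.
  by rewrite /adjoin inE; case: eqP => // yx; move: xs; rewrite -yx ys.
rewrite IH; last exact/andP.
by congr (_ * mean _ _); apply/funext => A; rewrite adjoinC adjoin_cons.
Qed.

Lemma mean_all N s : below N s -> mean N (fun A => (all A s)%:R) = \prod_(x <- s) p x.
Proof.
move=> sN; have := mean_cond (fun=> 1) sN; rewrite mean_cst mulr1 => <-.
by congr mean; apply/funext => A; rewrite mulr1.
Qed.

Definition prob N P : R := mean N (fun A => `[< P A >]%:R).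

Lemma prob_le_mean N P f : (forall A, 0 <= f A) -> (forall A, P A -> 1 <= f A) ->
  prob N P <= mean N f.
Proof. by move=> f0 f1; apply: mean_le => A; case: asboolP => // /f1. Qed.

Lemma prob_le N P Q : (forall A, P A -> Q A) -> prob N P <= prob N Q.
Proof. by move=> PQ; apply: prob_le_mean => // A /PQ QA; rewrite asboolT. Qed.

Lemma prob_or N P Q : prob N (fun A => P A \/ Q A) <= prob N P + prob N Q.
Proof.
rewrite -meanD; apply: prob_le_mean => A; first exact: addr_ge0.
by case=> /asboolT ->; rewrite ?lerDl ?lerDr.
Qed.

Lemma prob_exists (I : eqType) (r : seq I) N (P : I -> pred nat -> Prop) :
  prob N (fun A => exists2 i, i \in r & P i A) <= \sum_(i <- r) prob N (P i).
Proof.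
rewrite -mean_sum; apply: prob_le_mean => A; first exact: sumr_ge0.
move=> [i ir PiA]; rewrite (big_rem i ir)/= asboolT// lerDl.
exact: sumr_ge0.
Qed.

Lemma prob_lt1_exists N P : prob N P < 1 -> exists A, ~ P A.
Proof.
move=> P1; apply: contrapT => /forallNP PA; move: P1; apply/negP; rewrite -leNgt.
rewrite -[leLHS](mean_cst N); apply: mean_le => A; rewrite asboolT//.
exact: contrapT (PA A).
Qed.

Definition decreasing f := forall A x, f (adjoin [:: x] A) <= f A.

Lemma decreasing_adjoin f s : decreasing f -> decreasing (fun A => f (adjoin s A)).
Proof. by move=> df A x; rewrite adjoinC. Qed.

Lemma mean_harris N f g : decreasing f -> decreasing g ->
  mean N f * mean N g <= mean N (fun A => f A * g A).
Proof.
elim: N f g => [|N IH] f g df dg /=; first by [].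
have /andP[p0 p1] := p01 N.
have fg1 := IH _ _ (decreasing_adjoin [:: N] df) (decreasing_adjoin [:: N] dg).
have fg0 := IH _ _ df dg.
have lf : mean N (fun A => f (adjoin [:: N] A)) <= mean N f by apply: mean_le => A; exact: df.
have lg : mean N (fun A => g (adjoin [:: N] A)) <= mean N g by apply: mean_le => A; exact: dg.
set f1 := mean N (fun A => f (adjoin _ A)) in fg1 lf *.
set g1 := mean N (fun A => g (adjoin _ A)) in fg1 lg *.
set f0 := mean N f in lf fg0 *; set g0 := mean N g in lg fg0 *.
apply: (@le_trans _ _ (p N * (f1 * g1) + (1 - p N) * (f0 * g0))).
  rewrite -subr_ge0 [leRHS](_ : _ = p N * (1 - p N) * ((f0 - f1) * (g0 - g1))); last ring.
  by rewrite !mulr_ge0// subr_ge0.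
by apply: lerD; apply: ler_wpM2l; rewrite ?subr_ge0.
Qed.

End bernoulli.

(** * Janson's inequality *)

Lemma prod_1B_ge (R : numDomainType) (I : Type) (r : seq I) (P : pred I) (x : I -> R) :
  (forall i, 0 <= x i <= 1) ->
  1 - \sum_(i <- r | P i) x i <= \prod_(i <- r | P i) (1 - x i).
Proof.
move=> x01; elim: r => [|i r IH]; first by rewrite !big_nil subr0.
rewrite !big_cons; case: ifPn => // Pi; have /andP[x0 x1] := x01 i.
set s := \sum_(j <- r | P j) x j in IH *.
have s0 : 0 <= s by apply: sumr_ge0 => j _; case/andP: (x01 j).
apply: (@le_trans _ _ ((1 - x i) * (1 - s))); last by rewrite ler_wpM2l ?subr_ge0.
rewrite -subr_ge0 [leRHS](_ : _ = x i * s); first exact: mulr_ge0.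
ring.
Qed.

Section janson.
Variables (R : realType) (p : nat -> R).
Hypothesis p01 : forall x, 0 <= p x <= 1.
Variables (N : nat) (t : R).
Hypothesis t01 : 0 <= t <= 1.
Implicit Types (A : pred nat) (U V : seq nat) (Us Vs : seq (seq nat)).

Definition damping Us A : R := \prod_(U <- Us) (1 - t * (all A U)%:R).

Let t_bool01 (b : bool) : 0 <= t * b%:R <= 1.
Proof. by case: b; rewrite ?mulr1 ?mulr0 ?lexx ?ler01. Qed.

Lemma damping_ge0 Us A : 0 <= damping Us A.
Proof. by apply: prodr_ge0 => U _; rewrite subr_ge0; case/andP: (t_bool01 (all A U)). Qed.

Lemma damping_le1 Us A : damping Us A <= 1.
Proof.
apply: prodr_ile1 => U _; have /andP[? ?] := t_bool01 (all A U).
by rewrite subr_ge0 gerBl; exact/andP.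
Qed.

Lemma damping_ge Us A : 1 - t * (count (all A) Us)%:R <= damping Us A.
Proof.
rewrite -sum1_count big_mkcond natr_sum mulr_sumr.
exact: (prod_1B_ge Us xpredT (fun U => t_bool01 (all A U))).
Qed.

Lemma damping_bigID (a : pred (seq nat)) Us A :
  damping Us A = damping [seq U <- Us | a U] A * damping [seq U <- Us | ~~ a U] A.
Proof. by rewrite /damping !big_filter; exact: bigID. Qed.

Lemma damping_decreasing Us : decreasing (damping Us).
Proof.
move=> A x; apply: ler_prod => U _; rewrite subr_ge0.
have /andP[_ ->] /= := t_bool01 (all (adjoin [:: x] A) U).
rewrite lerD2l lerN2 ler_wpM2l//; first by case/andP: t01.
rewrite ler_nat; case: allP => //= AU; rewrite lt0b; apply/allP => y /AU yA.
by rewrite /adjoin yA orbT.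
Qed.

Lemma damping_adjoin_off U Us A : {in Us, forall V, ~~ has (mem U) V} ->
  damping Us (adjoin U A) = damping Us A.
Proof.
move=> offU; rewrite /damping big_seq [RHS]big_seq; apply: eq_bigr => V /offU /hasPn UV.
congr (1 - t * (nat_of_bool _)%:R); apply: eq_in_all => x /UV /=.
by rewrite /adjoin => /negbTE ->.
Qed.

Lemma mean_count_adjoin U Us : {in Us, forall V, below N V} ->
  mean p N (fun A => (count (all (adjoin U A)) Us)%:R) =
  \sum_(V <- Us) \prod_(x <- V | x \notin U) p x.
Proof.
move=> UsN; transitivity (\sum_(V <- Us) mean p N (fun A => (all (adjoin U A) V)%:R)).
  rewrite -mean_sum; congr mean; apply/funext => A.
  by rewrite -sum1_count natr_sum big_mkcond; apply: eq_bigr => V _; case: all.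
rewrite big_seq [RHS]big_seq; apply: eq_bigr => V /UsN /andP[uV VN].
rewrite -big_filter -(mean_all (N := N) p01); last first.
  by rewrite /below filter_uniq// all_filter; apply: sub_all VN => x /= ->; exact: implybT.
congr mean; apply/funext => A; rewrite all_filter; congr (nat_of_bool _)%:R.
by apply: eq_all => x /=; rewrite /adjoin implyNb.
Qed.

Lemma mean_damping_adjoin (d : R) U Us : {in Us, forall V, below N V} ->
  \sum_(V <- Us | has (mem U) V) \prod_(x <- V | x \notin U) p x <= d ->
  (1 - t * d) * mean p N (damping Us) <= mean p N (fun A => damping Us (adjoin U A)).
Proof.
move=> UsN Ud; have /andP[t0 _] := t01.
pose hit := [seq V <- Us | has (mem U) V]; pose miss := [seq V <- Us | ~~ has (mem U) V].
have dampingE A : damping Us A = damping hit A * damping miss A by exact: damping_bigID.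
have -> : (fun A => damping Us (adjoin U A)) =
    (fun A => damping hit (adjoin U A) * damping miss (adjoin U A)).
  by apply/funext => A; rewrite dampingE.
apply: le_trans (mean_harris p01 N (decreasing_adjoin U (@damping_decreasing hit))
  (decreasing_adjoin U (@damping_decreasing miss))).
have hit_ge : 1 - t * d <= mean p N (fun A => damping hit (adjoin U A)).
  apply: le_trans (mean_le p01 N (fun A => damping_ge hit (adjoin U A))).
  rewrite meanD mean_cst; under [X in mean p N X]eq_fun do rewrite -mulNr.
  rewrite meanZ mean_count_adjoin => [|V]; last by rewrite mem_filter => /andP[_ /UsN].
  by rewrite big_filter mulNr lerD2l lerN2 ler_wpM2l.
have miss_ge : mean p N (damping Us) <= mean p N (fun A => damping miss (adjoin U A)).
  apply: mean_le => // A; rewrite damping_adjoin_off => [|V]; last by rewrite mem_filter => /andP[].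
  by rewrite dampingE ler_piMl ?damping_ge0 ?damping_le1.
apply: (le_trans (ler_wpM2r _ hit_ge)); first by apply: mean_ge0 => // A; exact: damping_ge0.
by apply: ler_wpM2l miss_ge; apply: mean_ge0 => // A; exact: damping_ge0.
Qed.

(* The Boppana-Spencer product form of Janson's inequality. *)
Lemma mean_damping_le (d : R) Us : {in Us, forall U, below N U} ->
  {in Us, forall U, \sum_(V <- Us | has (mem U) V) \prod_(x <- V | x \notin U) p x <= d} ->
  mean p N (damping Us) <= expR (- t * (1 - t * d) * \sum_(U <- Us) \prod_(x <- U) p x).
Proof.
have /andP[t0 _] := t01; have p0 x : 0 <= p x by case/andP: (p01 x).
elim: Us => [|U Vs IH] UsN Usd.
  by rewrite big_nil mulr0 expR0 -[leRHS](mean_cst p N); apply: mean_le => // A; exact: damping_le1.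
have VsN : {in Vs, forall V, below N V} by move=> V VV; apply: UsN; rewrite inE VV orbT.
have Vsd V : V \in U :: Vs ->
    \sum_(V' <- Vs | has (mem V) V') \prod_(x <- V' | x \notin V) p x <= d.
  move=> VV; apply: le_trans (Usd V VV); rewrite big_cons; case: ifP => // _.
  by rewrite lerDr prodr_ge0.
have {}IH := IH VsN (fun V VV => Vsd V (@mem_behead _ (U :: Vs) V VV)).
rewrite big_cons; set q := \prod_(x <- U) p x.
have -> : mean p N (damping (U :: Vs)) =
    mean p N (damping Vs) - t * q * mean p N (fun A => damping Vs (adjoin U A)).
  have UN := UsN U (mem_head _ _).
  rewrite -mulrA -(mean_cond p01 (damping Vs) UN) -mulNr -meanZ -meanD; congr mean.
  by apply/funext => A; rewrite [LHS]big_cons -/(damping Vs A); ring.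
have Eq := mean_damping_adjoin VsN (Vsd U (mem_head _ _)).
set E := mean _ _ (damping Vs) in IH Eq *; set E' := mean _ _ _ in Eq *.
have E0 : 0 <= E by apply: mean_ge0 => // A; exact: damping_ge0.
apply: (@le_trans _ _ (expR (- t * (1 - t * d) * q) * E)); last first.
  by rewrite (mulrDr (- t * _)) expRD ler_wpM2l ?expR_ge0.
apply: le_trans (ler_wpM2r E0 (expR_ge1Dx _)).
have tq0 : 0 <= t * q by rewrite mulr_ge0// prodr_ge0.
have := ler_wpM2l tq0 Eq; lra.
Qed.

Lemma prob_count_le (d x : R) Us : t < 1 -> {in Us, forall U, below N U} ->
  {in Us, forall U, \sum_(V <- Us | has (mem U) V) \prod_(x <- V | x \notin U) p x <= d} ->
  prob p N (fun A => (count (all A) Us)%:R <= x) <=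
    expR (t / (1 - t) * x - t * (1 - t * d) * \sum_(U <- Us) \prod_(x <- U) p x).
Proof.
move=> t1 UsN Usd; have /andP[t0 _] := t01.
have t1' : 0 < 1 - t by rewrite subr_gt0.
set s := t / (1 - t).
have s0 : 0 <= s by rewrite divr_ge0// ltW.
have expNs : expR (- s) <= 1 - t.
  rewrite expRN -[leRHS]invrK lef_pV2 ?posrE ?invr_gt0 ?expR_gt0//.
  rewrite [leLHS](_ : _ = 1 + s) ?expR_ge1Dx// /s; field; exact: lt0r_neq0.
have damping_exp A : expR (- (s * (count (all A) Us)%:R)) <= damping Us A.
  rewrite -sum1_count big_mkcond natr_sum mulr_sumr -sumrN expR_sum.
  apply: ler_prod => U _; rewrite expR_ge0/=.
  by case: all; rewrite /= ?mulr1 ?mulr0 ?subr0 ?oppr0 ?expR0.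
rewrite expRD -mulNr -mulNr; apply: le_trans (ler_wpM2l (expR_ge0 _) (mean_damping_le UsN Usd)).
rewrite -meanZ; apply: prob_le_mean => // A; first by rewrite mulr_ge0 ?expR_ge0 ?damping_ge0.
move=> cx; apply: le_trans (ler_wpM2l (expR_ge0 _) (damping_exp A)).
by rewrite -expRD -[leLHS]expR0 ler_expR subr_ge0 ler_wpM2l.
Qed.

End janson.

(** * The uniform convergence theorem for regularly varying functions *)

Section lebesgue_measurability.
Variable R : realType.
Local Notation mu := (@lebesgue_measure R).
Local Open Scope classical_set_scope.
Local Open Scope ring_scope.

Lemma lebesgue_measure_dilation (l : R) (A : set R) : 0 < l -> measurable A ->
  mu ((fun x => l * x) @^-1` A) = (l^-1%:E * mu A)%E.
Proof.
move=> l0 mA; have l0' : 0 <= l by exact: ltW.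
have l_neq0 : l != 0 by exact: lt0r_neq0.
pose dil := (fun x => l * x) : measurableTypeR R -> measurableTypeR R.
have mdil : measurable_fun [set: measurableTypeR R] dil by exact: measurable_funM.
have := @lebesgue_measure_unique R (mscale (NngNum l0') (pushforward mu dil)).
move=> /(_ mdil _ A mA) -> => [|_ [[a b]] _ <-].
  by rewrite /mscale /= /pushforward muleA -EFinM mulVf// mul1e.
change (mu `]a, b]%classic = (l%:E * mu ((fun x => (l * x)%R) @^-1` `]a, b]%classic))%E).
have -> : (fun x => l * x) @^-1` `]a, b] = `](a / l), (b / l)]%classic.
  by apply/seteqP; split => x /=; rewrite !in_itv/= ltr_pdivrMr// ler_pdivlMr// (mulrC x).
rewrite !lebesgue_measure_itv/= !lte_fin ltr_pM2r ?invr_gt0//.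
case: ifPn => _; last by rewrite mule0.
by rewrite -!EFinD -EFinM; congr (_%:E); field.
Qed.

Lemma lebesgue_measurable_set_borel (E : set R) : lebesgue_measurable_set E ->
  exists A Z : set R, [/\ measurable A, measurable Z, mu Z = 0%E & E `\` Z = A `\` Z].
Proof.
rewrite /lebesgue_measurable_set g_sigma_completed_algebra_genE.
move=> [A mA [N [Z [mZ Z0 NZ]]] <-]; exists A, Z; split => //.
apply/seteqP; split => x /=; last by move=> [Ax Zx]; split => //; left.
by move=> [[//|/NZ //]].
Qed.

Lemma lebesgue_measurable_fun_borel (D : set R) (F : R -> R) : measurable D ->
  (forall B, measurable B -> lebesgue_measurable_set (D `&` F @^-1` B)) ->
  exists Z : set R, [/\ measurable Z, mu Z = 0%E & measurable_fun (D `\` Z) F].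
Proof.
move=> mD mF.
have /choice[AZ AZP] (q : rat) : exists AZ : set R * set R, [/\ measurable AZ.1,
    measurable AZ.2, mu AZ.2 = 0%E &
    (D `&` F @^-1` `]-oo, ratr q[%classic) `\` AZ.2 = AZ.1 `\` AZ.2].
  have [A [Z AZ]] := lebesgue_measurable_set_borel (mF _ (measurable_itv `]-oo, ratr q[)).
  by exists (A, Z).
pose Z := \bigcup_(q : rat) (AZ q).2.
have mZ : measurable Z by apply: bigcupT_measurable_rat => q; case: (AZP q).
exists Z; split => //.
  apply/negligibleP => //; have -> : Z = \bigcup_n (AZ (odflt 0 (unpickle n))).2.
    apply/seteqP; split => x [i _ ix]; last by exists (odflt 0 (unpickle i)).
    by exists (pickle i); rewrite //= pickleK.
  by apply: negligible_bigcup => n; apply/negligibleP; case: (AZP (odflt 0 (unpickle n))).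
move=> mDZ; apply: (measurability _ (RGenInftyO.measurableE R)) => //.
move=> _ [_ [r ->] <-].
suff -> : (D `\` Z) `&` F @^-1` `]-oo, r[%classic =
    \bigcup_(q : rat) (if ratr q < r then D `&` (AZ q).1 `\` Z else set0).
  apply: bigcupT_measurable_rat => q; case: ifPn => // _.
  by apply: measurableD => //; apply: measurableI => //; case: (AZP q).
apply/seteqP; split => x /=.
  move=> [[Dx Zx]]; rewrite in_itv/= => Fr; have [q] := rat_in_itvoo Fr.
  rewrite in_itv/= => /andP[Fq qr]; exists q => //; rewrite qr.
  have [_ _ _ /seteqP[/(_ x) + _]] := AZP q => /= -[]; last by [].
  by split; [rewrite in_itv|move=> Zqx; apply: Zx; exists q].
move=> [q _]; case: ifPn => // qr [[Dx Ax] Zx]; split => //.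
have Zqx : ~ (AZ q).2 x by move=> ?; apply: Zx; exists q.
have [_ _ _ /seteqP[_ /(_ x)]] := AZP q => /(_ (conj Ax Zqx))[[_ /=]].
by rewrite !in_itv/= => Fq _; exact: lt_trans qr.
Qed.

Lemma uniform_cvg_near (f : nat -> R -> R) (g : R -> R) (A : set R) (e : R) : 0 < e ->
  {uniform A, f @ \oo --> g} -> \forall n \near \oo, forall u, A u -> `|f n u - g u| < e.
Proof.
move=> e0 fg.
have : nbhs (g : {uniform` A -> R}) [set h | forall u, A u -> `|h u - g u| < e].
  apply/uniform_nbhs; exists [set xy | `|xy.1 - xy.2| < e]; split.
    by rewrite -entourage_ballE; exists e.
  by move=> d /= sub u /sub /=; rewrite distrC.
by move=> /fg.
Qed.

Lemma almost_bounded (g : R -> R) (A : set R) (d : R) : measurable A -> (mu A < +oo)%E ->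
  measurable_fun A g -> 0 < d ->
  exists B, [/\ measurable B, (mu B < d%:E)%E & exists K, forall u, A u -> ~ B u -> `|g u| <= K].
Proof.
move=> mA Afin mg d0.
pose gn n u := n.+1%:R^-1 * g u.
have mgn n : measurable_fun A (gn n) by exact: measurable_funM.
have gn0 u : A u -> gn n u @[n --> \oo] --> cst 0 u.
  by move=> _; rewrite -(mul0r (g u)); apply: cvgMr_tmp; exact: cvg_harmonic.
have [B [mB Bd gnB]] := @pointwise_almost_uniform _ R _ mu gn (cst 0) A d mgn mA Afin gn0 d0.
exists B; split => //; have [N _ /(_ N (leqnn N))gN] := uniform_cvg_near ltr01 gnB.
exists N.+1%:R => u Au nB; have := gN u (conj Au nB).
by rewrite subr0 /gn normrM normfV normr_nat mulrC ltr_pdivrMr// mul1r => /ltW.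
Qed.

Lemma dilation_off_small_sets (l eta : R) (B1 B2 : set R) : 0 < eta -> eta <= l <= 1 ->
  measurable B1 -> measurable B2 -> (mu B1 < (eta / 4)%:E)%E -> (mu B2 < (eta / 4)%:E)%E ->
  exists v : R, [/\ 1 <= v <= 2 / eta, 1 <= l * v <= 2 / eta, ~ B2 v & ~ B1 (l * v)].
Proof.
move=> eta0 /andP[el l1] mB1 mB2 B1e B2e; have l0 : 0 < l by exact: lt_le_trans el.
pose B := B2 `|` (fun v => l * v) @^-1` B1.
have mdB1 : measurable ((fun v => l * v) @^-1` B1).
  by rewrite -[X in measurable X]setTI; apply: (@measurable_funM _ _ R setT (cst l) id).
have mB : measurable B by exact: measurableU.
have muB : (mu B < (2^-1)%:E)%E.
  apply: (@le_lt_trans _ _ (mu B2 + mu ((fun v => (l * v)%R) @^-1` B1))%E); first exact: measureU2.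
  rewrite lebesgue_measure_dilation//.
  apply: (@lt_le_trans _ _ ((eta / 4)%:E + l^-1%:E * (eta / 4)%:E)%E).
    by rewrite lteD// lte_pmul2l ?lte_fin ?invr_gt0.
  rewrite -EFinM -!EFinD lee_fin.
  have : l^-1 * eta <= 1 by rewrite mulrC ler_pdivrMr// mul1r.
  lra.
have [v vI vB] : exists2 v, v \in `[l^-1, 2 / eta] & ~ B v.
  apply: contrapT => nB; have sub : `[l^-1, 2 / eta]%classic `<=` B.
    by move=> v /= vI; apply: contrapT => nv; apply: nB; exists v.
  have li : l^-1 <= eta^-1 by rewrite lef_pV2.
  have ei : 1 <= eta^-1 by rewrite invf_ge1// (le_trans el).
  have : (mu `[(l^-1)%R, (2 / eta)%R]%classic <= mu B)%E.
    by apply: le_measure => //; rewrite inE//; exact: measurable_itv.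
  rewrite lebesgue_measure_itv/= lte_fin ifT; last first.
    by rewrite (le_lt_trans li)// ltr_pMl ?invr_gt0// ltr1n.
  by move=> /le_lt_trans/(_ muB); rewrite -EFinB lte_fin; lra.
have {vB} [nB2 nB1] : ~ B2 v /\ ~ B1 (l * v) by split => ?; apply: vB; [left|right].
move: vI; rewrite in_itv/= => /andP[lv ve].
have v1 : 1 <= v by rewrite (le_trans _ lv)// invf_ge1.
exists v; split => //; first by rewrite v1.
by rewrite -ler_pdivrMl// mulr1 lv (le_trans _ ve)// ler_piMl// (le_trans _ v1).
Qed.

End lebesgue_measurability.

Lemma additive_bounded_linear (R : realType) (D : R -> R) (K : R) :
  {morph D : s t / s + t} -> (forall t, 0 <= t <= 1 -> `|D t| <= K) ->
  forall t, D t = t * D 1.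
Proof.
move=> DD DK; pose E t := D t - t * D 1.
have ED s t : E (s + t) = E s + E t by rewrite /E DD; ring.
have E1 : E 1 = 0 by rewrite /E mul1r subrr.
have E0 : E 0 = 0 by have := ED 0 0; rewrite addr0 => ?; lra.
have En n t : E (n%:R * t) = n%:R * E t.
  elim: n => [|n IH]; first by rewrite !mul0r.
  by rewrite -natr1 mulrDl mul1r ED IH; ring.
have Ez (z : int) : E z%:~R = 0.
  case: z => n; first by have := En n 1; rewrite mulr1 E1 mulr0.
  have := ED n.+1%:R (- n.+1%:R); have := En n.+1 1; rewrite NegzE mulrNz mulr1 subrr E0 E1; lra.
have Ebnd t : `|E t| <= K + `|D 1|.
  have -> : E t = E (t - (Num.floor t)%:~R).
    by have := ED (t - (Num.floor t)%:~R) (Num.floor t)%:~R; rewrite subrK Ez addr0.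
  set s := t - _; have s01 : 0 <= s <= 1.
    have /andP[] := floor_itv t; rewrite intrD => ? ?; rewrite /s; apply/andP; split; lra.
  apply: (le_trans (ler_normB _ _)); apply: lerD; first exact: DK.
  by rewrite normrM ler_piMl// ger0_norm; case/andP: s01.
move=> t; apply/eqP; rewrite -subr_eq0 -/(E t) -normr_le0 leNgt; apply/negP => Et.
have := Ebnd ((Num.truncn ((K + `|D 1|) / `|E t|)).+1%:R * t).
rewrite En normrM normr_nat leNgt => /negP; apply.
by rewrite -ltr_pdivrMr// truncnS_gt.
Qed.

Lemma multiplicative_bounded_ln (R : realType) (g : R -> R) (K : R) :
  (forall x y : R, 0 < x -> 0 < y -> g (x * y) = g x + g y) ->
  (forall l, 2^-1 <= l <= 1 -> `|g l| <= K) ->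
  exists rho : R, forall l : R, 0 < l -> g l = rho * ln l.
Proof.
move=> gM gK; have ln2 : 0 < ln 2 :> R by rewrite ln_gt0// ltr1n.
pose D t := g (expR (- (t * ln 2))).
have DD : {morph D : s t / s + t} by move=> s t; rewrite /D mulrDl opprD expRD gM ?expR_gt0.
have DK t : 0 <= t <= 1 -> `|D t| <= K.
  move=> /andP[t0 t1]; apply: gK; rewrite expR_le1 oppr_le0 mulr_ge0 ?(ltW ln2)// andbT.
  by rewrite -[leLHS]lnK ?posrE// ler_expR lnV ?posrE// lerN2 ler_piMl// ltW.
exists (- D 1 / ln 2) => l l0; have := additive_bounded_linear DD DK (- ln l / ln 2).
rewrite /D !mulNr divfK ?lt0r_neq0// opprK lnK ?posrE// => ->.
by field; exact: lt0r_neq0.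
Qed.

Section regular_variation.
Variables (R : realType) (F : R -> R).
Hypothesis Freg : regularly_varying F.
Local Notation mu := (@lebesgue_measure R).
Local Open Scope classical_set_scope.
Local Open Scope ring_scope.

Definition ln_ratio l x := ln (F (l * x)) - ln (F x).

Lemma ln_ratioM l v x : ln_ratio (l * v) x = ln_ratio l (v * x) + ln_ratio v x.
Proof. by rewrite /ln_ratio mulrA addrA subrK. Qed.

Lemma ln_ratio_cvg : exists g : R -> R, forall l, 0 < l -> ln_ratio l x @[x --> +oo] --> g l.
Proof.
have [Fpos [_ Flim]] := Freg.
have /choice[L Lcvg] (l : R) : exists y : R, 0 < l -> 0 < y /\ F (l * x) / F x @[x --> +oo] --> y.
  have [l0|] := boolP (0 < l); last by exists 0.
  by have [y y0 ?] := Flim l l0; exists y.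
exists (fun l => ln (L l)) => l l0; have [Ll cvgL] := Lcvg l l0.
have cvgln : ln (F (l * x) / F x) @[x --> +oo] --> ln (L l).
  apply: (@cvg_comp _ _ _ (fun x => F (l * x) / F x) (@ln R) _ _ _ cvgL).
  exact: continuous_ln.
apply: cvg_trans cvgln; apply: near_eq_cvg; near=> x.
have x1 : 1 <= x by near: x; apply: nbhs_pinfty_ge; rewrite num_real.
have lx1 : 1 <= l * x.
  by rewrite -ler_pdivrMl// mulr1; near: x; apply: nbhs_pinfty_ge; rewrite num_real.
by rewrite ln_div// posrE Fpos.
Unshelve. all: by end_near. Qed.

Lemma ln_ratio_limM (g : R -> R) : (forall l, 0 < l -> ln_ratio l x @[x --> +oo] --> g l) ->
  forall l v, 0 < l -> 0 < v -> g (l * v) = g l + g v.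
Proof.
move=> gcvg l v l0 v0; have /cvg_lim <- // := gcvg _ (mulr_gt0 l0 v0).
apply: cvg_lim => //.
have vx : v * x @[x --> +oo] --> +oo.
  by apply/cvgryPge => C; near=> x; rewrite -ler_pdivrMl.
have -> : ln_ratio (l * v) = (fun x => ln_ratio l (v * x) + ln_ratio v x).
  by apply/funext => x; exact: ln_ratioM.
exact: cvgD (@cvg_comp _ _ _ (fun x => v * x) (ln_ratio l) _ _ _ vx (gcvg l l0)) (gcvg v v0).
Unshelve. all: by end_near. Qed.

Lemma ln_ratio_measurable (x : nat -> R) : (forall n, 1 <= x n) ->
  exists Z, [/\ measurable Z, mu Z = 0%E &
    forall n, measurable_fun (`[1, +oo[%classic `\` Z) (fun u => ln_ratio u (x n))].
Proof.
move=> x1; have [_ [mF _]] := Freg.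
have D1 : [set t : R | 1 <= t] = `[1, +oo[%classic.
  by apply/seteqP; split => t /=; rewrite in_itv/= andbT.
have mD : measurable [set t : R | 1 <= t] by rewrite D1.
have [Z [mZ Z0 mFZ]] := lebesgue_measurable_fun_borel mD mF.
have mdil n : measurable_fun setT (fun u : R => x n * u) by exact: measurable_funM.
have mZn n : measurable ((fun u => x n * u) @^-1` Z).
  by rewrite -[X in measurable X]setTI; exact: mdil.
exists (\bigcup_n ((fun u => x n * u) @^-1` Z)); split.
- exact: bigcupT_measurable.
- apply/negligibleP; first exact: bigcupT_measurable.
  apply: negligible_bigcup => n; apply/negligibleP; first exact: mZn.
  by rewrite [LHS](lebesgue_measure_dilation (lt_le_trans ltr01 (x1 n)) mZ) Z0 mule0.
- move=> n; apply: measurable_funB => //; apply: measurableT_comp; first exact: measurable_ln.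
  have -> : (fun u => F (u * x n)) = F \o *%R (x n) by apply/funext => u /=; rewrite mulrC.
  apply: measurable_comp mFZ _; [exact: measurableD| |by apply: measurable_funTS; exact: mdil].
  move=> _ [u [u1 nZ] <-]; rewrite /= in_itv/= andbT in u1; split => /=.
    by rewrite -[1]mulr1 ler_pM.
  by move=> ?; apply: nZ; exists n.
Qed.

Lemma ln_ratio_almost_uniform (g : R -> R) (x : nat -> R) (M d : R) :
  (forall n, 1 <= x n) -> 0 < d ->
  (forall u : R, 1 <= u -> ln_ratio u (x n) @[n --> \oo] --> g u) ->
  exists B, [/\ measurable B, (mu B < d%:E)%E,
    exists K : R, forall u : R, 1 <= u <= M -> ~ B u -> `|g u| <= K &
    forall e : R, 0 < e -> \forall n \near \oo, forall u : R, 1 <= u <= M -> ~ B u ->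
      `|ln_ratio u (x n) - g u| < e].
Proof.
move=> x1 d0 gcvg; have [Z [mZ Z0 mratio]] := ln_ratio_measurable x1.
pose A := `[1, M]%classic `\` Z; have mA : measurable A by exact: measurableD.
have A1 : A `<=` `[1, +oo[%classic `\` Z.
  by move=> u [/=]; rewrite !in_itv/= => /andP[-> _].
have mf n : measurable_fun A (fun u => ln_ratio u (x n)).
  by apply: measurable_funS A1 (mratio n); exact: measurableD.
have Afin : (mu A < +oo)%E.
  apply: (@le_lt_trans _ _ (mu `[1, M]%classic)).
    by apply: le_measure; rewrite ?inE//; exact: subDsetl.
  by rewrite lebesgue_measure_itv/=; case: ifPn; rewrite ?ltry// -EFinD ltry.
have fg u : A u -> ln_ratio u (x n) @[n --> \oo] --> g u.
  by move=> /A1[/=]; rewrite in_itv/= andbT => u1 _; exact: gcvg.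
have d20 : 0 < d / 2 by rewrite divr_gt0.
have [B [mB Bd unifB]] :=
  @pointwise_almost_uniform _ R _ mu (fun n u => ln_ratio u (x n)) g A _ mf mA Afin fg d20.
have [B' [mB' Bd' [K gK]]] := almost_bounded mA Afin (measurable_fun_cvg mf fg) d20.
have A_BBZ u : 1 <= u <= M -> ~ (B `|` B' `|` Z) u -> [/\ A u, ~ B u & ~ B' u].
  move=> uM nB; split; first by split; [rewrite /= in_itv|move=> ?; apply: nB; right].
    by move=> ?; apply: nB; left; left.
  by move=> ?; apply: nB; left; right.
exists (B `|` B' `|` Z); split.
- by do !apply: measurableU.
- rewrite measureU0//; last exact: measurableU.
  apply: (@le_lt_trans _ _ (mu B + mu B')%E); first exact: measureU2.
  by rewrite [d]splitr EFinD lteD.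
- by exists K => u uM /(A_BBZ _ uM)[Au _ nB']; exact: gK.
- move=> e e0; have := uniform_cvg_near e0 unifB.
  apply: filterS => n fgn u uM /(A_BBZ _ uM)[Au nB _].
  exact: fgn.
Qed.

Lemma ge_succn_cvgy (x : nat -> R) : (forall n, n.+1%:R <= x n) ->
  (forall n, 1 <= x n) /\ x @ \oo --> +oo.
Proof.
move=> xn; split; first by move=> n; apply: le_trans (xn n); rewrite ler1n.
apply: (@ger_cvgy _ _ _ _ (fun n : nat => n%:R)); last exact: cvgr_idn.
by near=> n; apply: le_trans (xn n); rewrite ler_nat.
Unshelve. all: by end_near. Qed.

Lemma ln_ratio_cvg_seq (g : R -> R) (x : nat -> R) :
  (forall l, 0 < l -> ln_ratio l t @[t --> +oo] --> g l) -> x @ \oo --> +oo ->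
  forall u, 1 <= u -> ln_ratio u (x n) @[n --> \oo] --> g u.
Proof.
move=> gcvg xoo u u1.
by apply: (@cvg_comp _ _ _ x (ln_ratio u) _ _ _ xoo (gcvg u _)); rewrite (lt_le_trans _ u1).
Qed.

Lemma regular_variation_index :
  exists rho : R, forall l, 0 < l -> ln_ratio l x @[x --> +oo] --> rho * ln l.
Proof.
have [g gcvg] := ln_ratio_cvg; have gM := ln_ratio_limM gcvg.
suff [K gK] : exists K, forall l, 2^-1 <= l <= 1 -> `|g l| <= K.
  have [rho grho] := multiplicative_bounded_ln gM gK.
  by exists rho => l l0; rewrite -grho//; exact: gcvg.
have [x1 xoo] := ge_succn_cvgy (fun n => lexx n.+1%:R).
have half0 : 0 < 2^-1 :> R by rewrite invr_gt0.
have [|B [mB Bd [K gK] _]] := @ln_ratio_almost_uniform g _ (2 / 2^-1) (2^-1 / 4) x1 _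
  (ln_ratio_cvg_seq gcvg xoo); first by rewrite divr_gt0.
exists (K + K) => l lI; have l0 : 0 < l by move/andP: lI => [+ _]; exact: lt_le_trans.
have [v [vI lvI nv nlv]] := dilation_off_small_sets half0 lI mB mB Bd Bd.
have v0 : 0 < v by case/andP: vI => + _; exact: lt_le_trans.
have -> : g l = g (l * v) - g v by rewrite gM// addrK.
by apply: (le_trans (ler_normB _ _)); apply: lerD; exact: gK.
Qed.

Lemma regular_variation_uniform_seq (rho eta e : R) (x l : nat -> R) :
  (forall l, 0 < l -> ln_ratio l t @[t --> +oo] --> rho * ln l) -> 0 < eta -> 0 < e ->
  (forall n, n.+1%:R <= x n) -> (forall n, n.+1%:R <= l n * x n) ->
  (forall n, eta <= l n <= 1) ->
  exists n, `|ln_ratio (l n) (x n) - rho * ln (l n)| < e.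
Proof.
move=> cvg_ratio eta0 e0 /ge_succn_cvgy[x1 xoo] /ge_succn_cvgy[y1 yoo] lI.
have eta40 : 0 < eta / 4 by rewrite divr_gt0.
have e20 : 0 < e / 2 by rewrite divr_gt0.
have [B1 [mB1 B1d _ /(_ _ e20) unif1]] :=
  ln_ratio_almost_uniform (2 / eta) x1 eta40 (ln_ratio_cvg_seq cvg_ratio xoo).
have [B2 [mB2 B2d _ /(_ _ e20) unif2]] :=
  ln_ratio_almost_uniform (2 / eta) y1 eta40 (ln_ratio_cvg_seq cvg_ratio yoo).
near \oo => n; exists n.
have [v [vI lvI nv nlv]] := dilation_off_small_sets eta0 (lI n) mB1 mB2 B1d B2d.
have l0 : 0 < l n by have /andP[+ _] := lI n; exact: lt_le_trans.
have v0 : 0 < v by case/andP: vI => + _; exact: lt_le_trans.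
have : `|ln_ratio (l n * v) (x n) - rho * ln (l n * v)| < e / 2.
  by move: (l n * v) lvI nlv; near: n.
have : `|ln_ratio v (l n * x n) - rho * ln v| < e / 2.
  by move: v vI nv {lvI nlv v0}; near: n.
have := ln_ratioM (l n) v (x n); have := ln_ratioM v (l n) (x n).
rewrite (mulrC v (l n)) lnM ?posrE//.
set a := ln_ratio _ _; set b := ln_ratio _ _; set c := ln_ratio _ _; set d := ln_ratio _ _.
move: a b c d (ln (l n)) (ln v) => a b c d L V -> _; rewrite !ltr_norml.
move=> /andP[? ?] /andP[? ?]; apply/andP; split; lra.
Unshelve. all: by end_near. Qed.

Theorem regular_variation_uniform : exists rho : R, forall eta e : R, 0 < eta -> 0 < e ->
  \forall x \near +oo, forall l : R, eta <= l <= 1 -> `|ln_ratio l x - rho * ln l| < e.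
Proof.
have [rho cvg_ratio] := regular_variation_index; exists rho => eta e eta0 e0.
apply: contrapT => notunif.
have fails_beyond (M : R) : exists x l, [/\ M < x, eta <= l <= 1 &
    ~ `|ln_ratio l x - rho * ln l| < e].
  apply: contrapT => nfail; apply: notunif; exists M; split; first exact: num_real.
  by move=> x Mx l lI; apply: contrapT => nl; apply: nfail; exists x, l.
have /choice[xl xlP] (n : nat) : exists xl : R * R, [/\ n.+1%:R / eta <= xl.1,
    n.+1%:R <= xl.1, eta <= xl.2 <= 1 &
    ~ `|ln_ratio xl.2 xl.1 - rho * ln xl.2| < e].
  have [x [l [+ lI nl]]] := fails_beyond (Num.max (n.+1%:R / eta) n.+1%:R).
  by rewrite gt_max => /andP[/ltW ? /ltW ?]; exists (x, l).
pose x n := (xl n).1; pose l n := (xl n).2.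
have [n] : exists n, `|ln_ratio (l n) (x n) - rho * ln (l n)| < e.
  apply: (regular_variation_uniform_seq cvg_ratio eta0 e0) => n; have [xn1 xn lI _] := xlP n => //.
  have /andP[etal _] := lI; rewrite ler_pdivrMr// in xn1.
  by rewrite (le_trans xn1)// mulrC ler_wpM2r// (le_trans _ xn).
by have [_ _ _] := xlP n.
Qed.

End regular_variation.

(** * Regularly varying sequences *)

Section ln_regvar.
Variable R : realType.
Implicit Types (v w : nat -> R) (rho eta e c K : R).
Local Open Scope classical_set_scope.
Local Open Scope ring_scope.

Lemma ln_lipschitz (x y d : R) : 0 < d -> d <= x -> d <= y ->
  `|ln x - ln y| <= `|x - y| / d.
Proof.
move=> d0 dx dy; wlog yx : x y dx dy / y <= x => [le_case|].
  case: (leP y x) => [|/ltW] xy; first exact: le_case.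
  by rewrite distrC (distrC x); exact: le_case.
have y0 : 0 < y by exact: lt_le_trans dy.
have x0 : 0 < x by exact: lt_le_trans dx.
rewrite [X in _ <= X / _]ger0_norm ?subr_ge0// ger0_norm; last by rewrite subr_ge0 ler_ln.
rewrite -ln_div ?posrE// (_ : x / y = 1 + (x - y) / y); last by field; exact: lt0r_neq0.
apply: (@le_trans _ _ ((x - y) / y)); last by rewrite ler_wpM2l ?subr_ge0// lef_pV2.
by apply: le_ln1Dx; rewrite (lt_le_trans (ltrN10 _))// divr_ge0 ?subr_ge0// ltW.
Qed.

(* The shift by one avoids the junk value of ln at 0. *)
Definition lnS n : R := ln n.+1%:R.

Lemma expR_lnS n : expR (lnS n) = n.+1%:R.
Proof. by rewrite lnK// posrE. Qed.

Lemma lnS0 : lnS 0 = 0. Proof. exact: ln1. Qed.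

Lemma le_lnS k n : (k <= n)%N -> lnS k <= lnS n.
Proof. by move=> kn; rewrite ler_ln ?posrE// ler_nat. Qed.

Lemma lnS_ge0 n : 0 <= lnS n. Proof. by rewrite -lnS0 le_lnS. Qed.

Lemma cvg_lnS : lnS n @[n --> \oo] --> +oo.
Proof.
apply/cvgryPge => K; near=> n; rewrite -ler_expR expR_lnS (@le_trans _ _ n%:R) ?ler_nat//.
by near: n; exact: nbhs_infty_ger.
Unshelve. all: by end_near. Qed.

Lemma lnS_dist_ln n : (0 < n)%N -> `|lnS n - ln n%:R| <= n%:R^-1.
Proof.
move=> n0; have nR : 0 < n%:R :> R by rewrite ltr0n.
apply: (le_trans (ln_lipschitz nR _ (lexx _))); first by rewrite ler_nat.
by rewrite -natr1 addrAC subrr add0r normr1 mul1r.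
Qed.

Lemma lnS_half n : (0 < n)%N -> ln (4 / 3) <= lnS n - lnS n./2.
Proof.
move=> n0; rewrite /lnS -ln_div ?posrE// ler_ln ?posrE ?divr_gt0//.
rewrite ler_pdivlMr// mulrAC ler_pdivrMr// -!natrM ler_nat.
have := odd_double_half n; move: n./2; clear -n0; lia.
Qed.

Lemma near_ge_proportion (P : nat -> Prop) eta : 0 < eta -> (\forall k \near \oo, P k) ->
  \forall n \near \oo, forall k, eta * n.+1%:R <= k.+1%:R -> P k.
Proof.
move=> eta0 [N _ NP]; near=> n => k ek; apply: NP; rewrite /= -ltnS -(ltr_nat R).
apply: lt_le_trans ek; rewrite mulrC -ltr_pdivrMr// (@le_lt_trans _ _ n%:R) ?ltr_nat//.
by near: n; exact: nbhs_infty_ger.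
Unshelve. all: by end_near. Qed.

(* The sequence expR \o v is regularly varying of index rho, in the uniform sense. *)
Definition ln_regvar rho v := forall eta e, 0 < eta -> 0 < e ->
  \forall n \near \oo, forall k, (k <= n)%N -> eta * n.+1%:R <= k.+1%:R ->
    `|v k - v n - rho * (lnS k - lnS n)| <= e.

Lemma ln_regvarD rho sigma v w : ln_regvar rho v -> ln_regvar sigma w ->
  ln_regvar (rho + sigma) (fun n => v n + w n).
Proof.
move=> v_regvar w_regvar eta e eta0 e0; have e20 : 0 < e / 2 by rewrite divr_gt0.
near=> n => k kn ek.
rewrite [X in `|X|](_ : _ = (v k - v n - rho * (lnS k - lnS n)) +
  (w k - w n - sigma * (lnS k - lnS n))); last ring.
apply: (le_trans (ler_normD _ _)); rewrite [e]splitr; apply: lerD.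
  by move: k kn ek; near: n; exact: v_regvar.
by move: k kn ek; near: n; exact: w_regvar.
Unshelve. all: by end_near. Qed.

Lemma ln_regvarZ rho c v : ln_regvar rho v -> ln_regvar (c * rho) (fun n => c * v n).
Proof.
move=> v_regvar eta e eta0 e0; have c0 : 0 < `|c| + 1 by rewrite ltr_wpDl.
apply: filterS (v_regvar eta (e / (`|c| + 1)) eta0 (divr_gt0 e0 c0)) => n vn k kn ek.
rewrite [X in `|X|](_ : _ = c * (v k - v n - rho * (lnS k - lnS n))); last ring.
rewrite normrM; have := vn k kn ek; rewrite ler_pdivlMr//; apply: le_trans.
by rewrite mulrC ler_wpM2l// lerDl.
Qed.

Lemma ln_regvar_lnS : ln_regvar 1 lnS.
Proof. by move=> eta e eta0 e0; near=> n => k _ _; rewrite mul1r subrr normr0 ltW.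
Unshelve. all: by end_near. Qed.

Lemma ln_regvar_cvg v (l : R) : v n @[n --> \oo] --> l -> ln_regvar 0 v.
Proof.
move=> vl eta e eta0 e0; have e20 : 0 < e / 2 by rewrite divr_gt0.
have near_l : \forall k \near \oo, `|l - v k| <= e / 2 by move/cvgrPdist_le : vl; exact.
apply: filterS2 near_l (near_ge_proportion eta0 near_l) => n ln lk k _ ek.
rewrite mul0r subr0 [e]splitr (le_trans (ler_distD l _ _))// lerD//.
by rewrite distrC lk.
Qed.

Lemma eq_ln_regvar rho v w : w n - v n @[n --> \oo] --> 0 -> ln_regvar rho v -> ln_regvar rho w.
Proof.
move=> /ln_regvar_cvg wv /ln_regvarD /(_ wv).
by under eq_fun do rewrite addrC subrK; rewrite addr0.
Qed.

(** ** Potter's bounds *)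

Lemma quasi_nondecreasing_halving (d : nat -> R) (e : R) (N : nat) : 0 <= e ->
  (forall n k, (N < n)%N -> (n./2 <= k <= n)%N -> d k <= d n + e) ->
  (forall n, (N < n)%N -> d n./2 <= d n) ->
  exists K, forall k n, (k <= n)%N -> d k <= d n + K.
Proof.
move=> e0 d_near d_half.
pose K := \sum_(n < N.+1) \sum_(k < N.+1) `|d k - d n| + e.
have eK : e <= K by rewrite lerDr; do 2!apply: sumr_ge0 => ? _.
exists K => k n; have [m] := ubnP n; elim: m n => // m IH n; rewrite ltnS => nm kn.
have [nN|Nn] := leqP n N.
  rewrite -lerBlDl (le_trans (ler_norm _))//.
  have kN : (k < N.+1)%N by rewrite ltnS (leq_trans kn).
  rewrite /K (bigD1 (Ordinal (nN : (n < N.+1)%N)))//= (bigD1 (Ordinal kN))//= -!addrA lerDl.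
  by rewrite !addr_ge0//; do ?apply: sumr_ge0 => ? _.
have [nk|kn2] := leqP n./2 k.
  by apply: (le_trans (d_near n k Nn _)); rewrite ?nk// lerD2l.
have n2m : (n./2 < m)%N by apply: leq_trans nm; rewrite ltn_half_double -addnn; lia.
by apply: (le_trans (IH _ n2m (ltnW kn2))); rewrite lerD2r d_half.
Qed.

Lemma potter rho c v : ln_regvar rho v -> c < rho ->
  exists K, forall k n, (k <= n)%N -> v k <= v n + K + c * (lnS k - lnS n).
Proof.
move=> v_regvar c_rho; have rc : 0 <= rho - c by rewrite subr_ge0 ltW.
pose e := (rho - c) * ln (4 / 3).
have e0 : 0 < e by rewrite mulr_gt0 ?subr_gt0// ln_gt0//; lra.
have half0 : 0 < 2^-1 :> R by rewrite invr_gt0.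
have [N _ NP] := v_regvar _ _ half0 e0.
have vP n k : (N < n)%N -> (n./2 <= k <= n)%N ->
    `|v k - v n - rho * (lnS k - lnS n)| <= e.
  move=> Nn /andP[nk kn]; apply: NP => //; first exact: ltnW.
  rewrite mulrC ler_pdivrMr// -natrM ler_nat; have := odd_double_half n.
  by move: n./2 nk; clear; lia.
have [||K v_potter] := @quasi_nondecreasing_halving (fun n => v n - c * lnS n) e N (ltW e0).
- move=> n k Nn nk; have := vP n k Nn nk; case/andP: nk => _ /le_lnS kn.
  rewrite ler_norml => /andP[_].
  have := ler_wpM2l rc kn; lra.
- move=> n Nn; have nn : (n./2 <= n./2 <= n)%N.
    by rewrite leqnn leq_half_double leqW// -addnn leq_addr.
  have := vP n n./2 Nn nn; rewrite ler_norml => /andP[_].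
  have := ler_wpM2l rc (lnS_half (leq_ltn_trans (leq0n N) Nn)); rewrite -/e; lra.
by exists K => k n kn; have := v_potter k n kn; lra.
Qed.

Lemma ln_regvar_ge rho c v : ln_regvar rho v -> c < rho ->
  exists K, forall n, K + c * lnS n <= v n.
Proof.
move=> v_regvar crho; have [K v_potter] := potter v_regvar crho; exists (v 0%N - K) => n.
by have := v_potter 0%N n isT; rewrite lnS0; lra.
Qed.

Lemma ln_regvar_le rho c v : ln_regvar rho v -> rho < c ->
  exists K, forall n, v n <= K + c * lnS n.
Proof.
move=> v_regvar; rewrite -ltrN2 -[in - rho]mulN1r.
move=> /(ln_regvar_ge (ln_regvarZ _ v_regvar))[K v_potter].
by exists (- K) => n; have := v_potter n; lra.
Qed.

Lemma ln_regvar_proportion_bound rho v eta : ln_regvar rho v -> 0 < eta ->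
  exists2 K, 0 < K & forall k n, (k <= n)%N -> eta * n.+1%:R <= k.+1%:R ->
    expR (v k) <= K * expR (v n).
Proof.
move=> v_regvar eta0; pose c := - `|rho| - 1.
have crho : c < rho by rewrite /c; have := ler_norm (- rho); rewrite normrN; lra.
have [K v_potter] := potter v_regvar crho; exists (expR (K + c * ln eta)); first exact: expR_gt0.
move=> k n kn ek; rewrite -expRD ler_expR (le_trans (v_potter k n kn))//.
suff : c * (lnS k - lnS n) <= c * ln eta by lra.
rewrite ler_wnM2l//; first by rewrite /c; have := normr_ge0 rho; lra.
by rewrite lerBrDr -lnM ?posrE// ler_ln ?posrE// mulr_gt0.
Qed.

Lemma expR_le_affine (s t : R) : 0 <= s <= 1 -> expR (s * t) <= 1 - s + s * expR t.
Proof.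
move=> /andP[s0 s1]; have := convex_expR (Itv01 s0 s1) t 0.
by rewrite !convRE /= expR0 mulr0 addr0 mulr1 addrC.
Qed.

Lemma sum_power_le (tau : R) (m : nat) : 0 <= tau < 1 ->
  \sum_(k < m.+1) expR (- tau * lnS k) <= (1 - tau)^-1 * expR ((1 - tau) * lnS m).
Proof.
move=> /andP[t0 t1]; have s0 : 0 < 1 - tau by lra.
elim: m => [|m IH].
  rewrite big_ord_recr big_ord0 /= add0r lnS0 !mulr0 expR0 mulr1 invf_ge1//; lra.
rewrite big_ord_recr/= (le_trans (lerD IH (lexx _)))//.
have s01 : 0 <= 1 - tau <= 1 by apply/andP; split; lra.
set E := expR ((1 - tau) * lnS m.+1).
have EV : expR (- tau * lnS m.+1) = E * m.+2%:R^-1.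
  by rewrite -(expR_lnS m.+1) -expRN -expRD; congr expR; ring.
have Em : expR ((1 - tau) * lnS m) = E * expR ((1 - tau) * (lnS m - lnS m.+1)).
  by rewrite -expRD; congr expR; ring.
have ratio : expR (lnS m - lnS m.+1) = 1 - m.+2%:R^-1.
  rewrite expRB !expR_lnS -[m.+1%:R](addrK 1) natr1 mulrBl mul1r divff// ?pnatr_eq0.
have := ler_wpM2l (expR_ge0 _ : 0 <= E) (expR_le_affine (lnS m - lnS m.+1) s01).
rewrite ratio -Em EV => Em_le; rewrite -(ler_pM2l s0) mulrDr !mulVKf ?lt0r_neq0//.
move: (expR (_ * lnS m)) (E) m.+2%:R^-1 Em_le => X Y i; lra.
Qed.

Lemma potter_expR rho v : ln_regvar rho v -> -1 < rho -> exists tau K, [/\ 0 <= tau < 1, 0 < K &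
  forall k n, (k <= n)%N -> expR (v k) <= K * expR (v n) * expR (- tau * (lnS k - lnS n))].
Proof.
move=> v_regvar rho1; pose r := Num.min rho 0; pose c := (r - 1) / 2.
have r0 : r <= 0 by rewrite ge_min lexx orbT.
have rrho : r <= rho by rewrite ge_min lexx.
have r1 : -1 < r by rewrite lt_min rho1; lra.
have crho : c < rho by rewrite /c; lra.
have [K v_potter] := potter v_regvar crho.
exists (- c), (expR K); split; [by rewrite /c; apply/andP; split; lra|exact: expR_gt0|].
by move=> k n kn; rewrite opprK -!expRD ler_expR; have := v_potter k n kn; lra.
Qed.

(* Karamata's bound. *)
Lemma ln_regvar_sum_bound rho v : ln_regvar rho v -> -1 < rho -> exists s K, [/\ 0 < s, 0 < K &
  forall k n, (k <= n)%N -> \sum_(j < k.+1) expR (v j) <=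
    K * (n.+1%:R * expR (v n)) * expR (s * (lnS k - lnS n))].
Proof.
move=> v_regvar rho1; have [tau [K [t01 K0 v_potter]]] := potter_expR v_regvar rho1.
have s0 : 0 < 1 - tau by case/andP: t01; lra.
exists (1 - tau), (K * (1 - tau)^-1); split => //; first by rewrite mulr_gt0// invr_gt0.
move=> k n kn; apply: (@le_trans _ _
    (K * (expR (v n) * expR (tau * lnS n)) * \sum_(j < k.+1) expR (- tau * lnS j))).
  rewrite mulr_sumr; apply: ler_sum => j _.
  have jn : (j <= n)%N by apply: leq_trans kn; rewrite -ltnS.
  apply: (le_trans (v_potter j n jn)); rewrite -!mulrA ler_wpM2l ?(ltW K0)// -!expRD ler_expR; lra.
have C0 : 0 <= K * (expR (v n) * expR (tau * lnS n)) by rewrite !mulr_ge0 ?expR_ge0// ltW.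
apply: (le_trans (ler_wpM2l C0 (sum_power_le k t01))).
rewrite -(expR_lnS n) -!expRD -!mulrA ler_wpM2l ?(ltW K0)// mulrCA ler_wpM2l ?invr_ge0 ?(ltW s0)//.
by rewrite -!expRD ler_expR; lra.
Qed.

Lemma near_affine_le_expR (E g K : R) : 0 < E -> 0 < g ->
  \forall x \near +oo, K * (x + 1) <= E * expR (g * x).
Proof.
move=> E0 g0; pose c := E * (g ^+ 2 / 2).
have c0 : 0 < c by rewrite mulr_gt0// divr_gt0// exprn_gt0.
near=> x; have x1 : 1 <= x by near: x; apply: nbhs_pinfty_ge; rewrite num_real.
have x0 : 0 <= x by exact: le_trans x1.
have Kx : 2 * `|K| <= c * x.
  by rewrite [leRHS]mulrC -ler_pdivrMr//; near: x; apply: nbhs_pinfty_ge; rewrite num_real.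
apply: (@le_trans _ _ (c * x * x)); last first.
  apply: le_trans (ler_wpM2l (ltW E0) (expR_ge1Dxn 1 (mulr_ge0 (ltW g0) x0))).
  by rewrite /c -!(mulrA E) ler_wpM2l ?(ltW E0)// exprMn (_ : 2`! = 2)%N//; lra.
apply: le_trans (ler_wpM2r x0 Kx).
have x10 : 0 <= x + 1 by rewrite addr_ge0.
apply: le_trans (ler_wpM2r x10 (ler_norm K)) _.
have := ler_wpM2l (normr_ge0 K) x1; lra.
Unshelve. all: by end_near. Qed.

Lemma ln_regvar_regularly_varying (F : R -> R) : regularly_varying F ->
  exists rho, ln_regvar rho (fun n => ln (F n%:R)).
Proof.
move=> /regular_variation_uniform[rho F_uniform]; exists rho => eta e eta0 e0.
have eta20 : 0 < eta / 2 by rewrite divr_gt0.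
have e20 : 0 < e / 2 by rewrite divr_gt0.
have unif : \forall n \near \oo, forall l : R, eta / 2 <= l <= 1 ->
    `|ln_ratio F l n%:R - rho * ln l| < e / 2 by exact: cvgr_idn (F_uniform _ _ eta20 e20).
have shift : \forall k \near \oo, (0 < k)%N /\ `|rho * (lnS k - ln k%:R)| <= e / 2 / 2.
  near=> k; have k0 : (0 < k)%N by near: k; exact: nbhs_infty_gt.
  split => //; rewrite normrM (le_trans (ler_wpM2l (normr_ge0 _) (lnS_dist_ln k0)))//.
  rewrite ler_pdivrMr ?ltr0n// mulrC -ler_pdivrMr ?divr_gt0//.
  by near: k; exact: nbhs_infty_ger.
near=> n => k kn ek.
have [k0 kshift] : (0 < k)%N /\ `|rho * (lnS k - ln k%:R)| <= e / 2 / 2.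
  by move: k ek {kn}; near: n; exact: near_ge_proportion.
have [n0 nshift] : (0 < n)%N /\ `|rho * (lnS n - ln n%:R)| <= e / 2 / 2 by near: n.
have nR : 0 < n%:R :> R by rewrite ltr0n.
have knI : eta / 2 <= (k%:R / n%:R : R) <= 1.
  apply/andP; split; last by rewrite ler_pdivrMr// mul1r ler_nat.
  have : 1 <= eta / 2 * n%:R.
    by rewrite mulrC -ler_pdivrMr//; near: n; exact: nbhs_infty_ger.
  rewrite ler_pdivlMr//; move: ek; rewrite -[n.+1%:R]natr1 -[k.+1%:R]natr1; lra.
have : `|ln_ratio F (k%:R / n%:R) n%:R - rho * ln (k%:R / n%:R)| < e / 2.
  by move: (_ / _) knI; near: n.
rewrite /ln_ratio divfK ?lt0r_neq0// ln_div ?posrE ?ltr0n//.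
move: kshift nshift; rewrite !ler_norml ltr_norml => /andP[? ?] /andP[? ?] /andP[? ?].
by apply/andP; split; lra.
Unshelve. all: by end_near. Qed.

End ln_regvar.

Arguments lnS {R} n.

(** * Representations by linear forms *)

Section finite_sums.
Import boot.fintype boot.finset.
Variables (R : numDomainType) (T1 T2 : finType) (A : {set T1}) (B : {set T2}) (f : T1 -> R).

Lemma ler_sum_inj (phi : T1 -> T2) (g : T2 -> R) :
  {in A &, injective phi} -> {in A, forall x, phi x \in B} ->
  {in A, forall x, f x <= g (phi x)} -> {in B, forall y, 0 <= g y} ->
  \sum_(x in A) f x <= \sum_(y in B) g y.
Proof.
move=> inj AB fg g0; apply: (@le_trans _ _ (\sum_(x in A) g (phi x))); first exact: ler_sum.
rewrite -(big_imset g inj) [leRHS](big_setID (phi @: A))/=.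
have /setIidPr -> : phi @: A \subset B by apply/subsetP => _ /imsetP[x xA ->]; exact: AB.
by rewrite lerDl; apply: sumr_ge0 => y; rewrite in_setD => /andP[_]; exact: g0.
Qed.

Lemma ler_sum_cover (Q : pred T1) (P : T2 -> pred T1) (D : R) :
  {in A, forall x, 0 <= f x} -> {in A, forall x, Q x -> exists2 y, y \in B & P y x} ->
  {in B, forall y, \sum_(x in A | P y x) f x <= D} ->
  \sum_(x in A | Q x) f x <= #|B|%:R * D.
Proof.
move=> f0 cover fD; apply: (@le_trans _ _ (\sum_(y in B) \sum_(x in A | P y x) f x)); last first.
  by rewrite mulr_natl -sumr_const; exact: ler_sum.
rewrite (exchange_big_dep (mem A))/= => [|y x _ /andP[]//].
rewrite big_mkcondr; apply: ler_sum => x xA; have fx0 := f0 x xA.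
case: ifPn => [/(cover x xA)[y yB Pyx]|_]; last exact: sumr_ge0.
by rewrite (bigD1 y)/= ?xA ?yB ?Pyx// lerDl sumr_ge0.
Qed.

End finite_sums.

Section representations.
Import boot.fintype boot.finset.
Variables (J : finType) (N : nat).
Local Notation T := 'I_N.+1.
Implicit Types (I : {set J}) (c : J -> nat) (k : {ffun J -> T}) (S U : {set T}).

(* Tuples vanish off I, so that all index sets I share one type of tuples. *)
Definition reps I c (m : nat) : {set {ffun J -> T}} :=
  [set k : {ffun J -> T} | [forall i, (i \notin I) ==> (k i == ord0)] &&
    (\sum_(i in I) c i * k i == m)%N].

Lemma repsP I c m k : reflect ((forall i, i \notin I -> k i = ord0) /\
  (\sum_(i in I) c i * k i)%N = m) (k \in reps I c m).
Proof.
rewrite inE; apply: (iffP andP) => -[off_I /eqP sum_m]; split => //; try exact/eqP.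
  by move=> i iI; have /forallP/(_ i)/implyP/(_ iI)/eqP := off_I.
by apply/forallP => i; apply/implyP => iI; apply/eqP/off_I.
Qed.

Lemma eq_reps I c c' m : {in I, c =1 c'} -> reps I c m = reps I c' m.
Proof.
move=> cc'; apply/setP => k; rewrite !inE; congr (_ && (_ == _)).
by apply: eq_bigr => i iI; rewrite cc'.
Qed.

Lemma card_reps_set0 c m : (#|reps set0 c m| <= 1)%N.
Proof.
rewrite -(cards1 ([ffun=> ord0] : {ffun J -> T})); apply: subset_leq_card.
apply/subsetP => k /repsP[k0 _]; rewrite inE; apply/eqP/ffunP => i.
by rewrite ffunE k0// inE.
Qed.

Definition update k i x : {ffun J -> T} := [ffun j => if j == i then x else k j].

Lemma update_inj i k k' x : update k i x = update k' i x -> k i = k' i -> k = k'.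
Proof.
move=> /ffunP E ki; apply/ffunP => j; have := E j; rewrite !ffunE.
by case: (eqVneq j i) => [->|].
Qed.

Lemma imset_update i I k x : i \in I -> k @: I = k i |: update k i x @: (I :\ i).
Proof.
move=> iI; rewrite -{1}(setD1K iI) imsetU1; congr (_ |: _).
by apply: eq_in_imset => j; rewrite in_setD1 ffunE => /andP[/negbTE ->].
Qed.

Lemma update_reps I c m i k : i \in I -> k \in reps I c m ->
  (c i * k i <= m)%N /\ update k i ord0 \in reps (I :\ i) c (m - c i * k i).
Proof.
move=> iI /repsP[k0 <-]; rewrite (big_setD1 i)//=; split; first exact: leq_addr.
apply/repsP; split.
  by move=> j; rewrite in_setD1 negb_and negbK ffunE; case: eqP => //= _; exact: k0.
rewrite addKn; apply: eq_bigr => j; rewrite in_setD1 => /andP[ji _].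
by rewrite ffunE (negbTE ji).
Qed.

(* The weights once the coordinates i and j are identified and j is dropped. *)
Definition merge c i j : J -> nat := fun t => if t == i then (c i + c j)%N else c t.

Lemma merge_reps I c m i j k : i \in I -> j \in I :\ i -> k i = k j ->
  k \in reps I c m -> update k j ord0 \in reps (I :\ j) (merge c i j) m.
Proof.
move=> iI; rewrite in_setD1 => /andP[ji jI] kij /repsP[k0 <-].
have iIj : i \in I :\ j by rewrite in_setD1 eq_sym ji.
apply/repsP; split.
  by move=> t; rewrite in_setD1 negb_and negbK ffunE; case: eqP => //= _; exact: k0.
rewrite [RHS](big_setD1 j)//= [in RHS](big_setD1 i)//= (big_setD1 i)//= addnA.
rewrite /merge eqxx ffunE eq_sym (negbTE ji) mulnDl -kij [in RHS](addnC (c j * _)%N).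
congr (_ + _)%N; apply: eq_bigr => t; rewrite !in_setD1 => /and3P[ti tj _].
by rewrite (negbTE ti) ffunE (negbTE tj).
Qed.

Definition inj_on I k := #|k @: I| == #|I|.

Definition fresh S I k := inj_on I k && [disjoint k @: I & S].

Definition admissible B I c :=
  [forall (i | i \in I), 0 < c i]%N && (\sum_(i in I) c i <= B)%N.

Lemma admissible_rem B I c i : admissible B I c -> admissible B (I :\ i) c.
Proof.
move=> /andP[/forall_inP c0 cB]; apply/andP; split.
  by apply/forall_inP => j; rewrite in_setD1 => /andP[_]; exact: c0.
by apply: leq_trans cB; rewrite [leqRHS](big_setID [set i])/= leq_addl.
Qed.

Lemma admissible_merge B I c i j : i \in I -> j \in I :\ i ->
  admissible B I c -> admissible B (I :\ j) (merge c i j).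
Proof.
move=> iI; rewrite in_setD1 => /andP[ji jI] /andP[/forall_inP c0 cB].
have iIj : i \in I :\ j by rewrite in_setD1 eq_sym ji.
apply/andP; split.
  apply/forall_inP => t; rewrite in_setD1 /merge => /andP[_ tI].
  by case: eqP => _; rewrite ?addn_gt0 c0.
apply: leq_trans cB; rewrite [leqRHS](big_setD1 j)//= [leqRHS]addnC.
rewrite (big_setD1 i iIj)/= [in leqRHS](big_setD1 i iIj)/= /merge eqxx -addnA [leqRHS]addnAC.
rewrite addnA leq_add2l leq_eqVlt; apply/orP; left; apply/eqP.
by apply: eq_bigr => t; rewrite in_setD1 => /andP[/negbTE -> _].
Qed.

Lemma admissible_ffun B I c : admissible B I c -> exists2 c' : {ffun J -> 'I_B.+1},
  {in I, c =1 (fun i => c' i)} & admissible B I (fun i => c' i).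
Proof.
move=> /andP[/forall_inP c_gt0 c_sum]; have c_le i : i \in I -> (c i < B.+1)%N.
  by move=> iI; rewrite ltnS (leq_trans _ c_sum)// (bigD1 i)//= leq_addr.
pose c' : {ffun J -> 'I_B.+1} := [ffun i => inord (c i)].
have cc' : {in I, c =1 (fun i => c' i)} by move=> i iI; rewrite ffunE inordK// c_le.
exists c' => //; rewrite /admissible -(eq_bigr _ cc') c_sum andbT.
by apply/forall_inP => i iI; rewrite -cc'// c_gt0.
Qed.

Section weighted_count.
Variables (R : realFieldType) (w : {set T} -> R).
Hypothesis w_ge0 : forall U, 0 <= w U.
Hypothesis w_antitone : forall x U, w (x |: U) <= w U.

Definition wcount I c m : R := \sum_(k in reps I c m) w (k @: I).

Lemma wcount_ge0 I c m : 0 <= wcount I c m.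
Proof. exact: sumr_ge0. Qed.

Lemma wcount_coord_le I c m i x : i \in I ->
  \sum_(k in reps I c m | k i == x) w (k @: I) <= wcount (I :\ i) c (m - c i * x).
Proof.
move=> iI; rewrite (eq_bigl (fun k => k \in [set k in reps I c m | k i == x])) => [|k]; last first.
  by rewrite [RHS]inE.
apply: (ler_sum_inj (phi := fun k => update k i ord0)) => //.
- move=> k k'; rewrite !inE => /andP[_ /eqP kx] /andP[_ /eqP kx'] /update_inj; apply.
  by rewrite kx.
- by move=> k; rewrite inE => /andP[/(update_reps iI)[_ +] /eqP <-].
- by move=> k _; rewrite (imset_update _ ord0 iI).
Qed.

Lemma wcount_eq_coord_le I c m i j : i \in I -> j \in I :\ i ->
  \sum_(k in reps I c m | k i == k j) w (k @: I) <= wcount (I :\ j) (merge c i j) m.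
Proof.
move=> iI jIi; have [ji jI] : j != i /\ j \in I by move: jIi; rewrite in_setD1 => /andP[].
rewrite (eq_bigl (fun k => k \in [set k in reps I c m | k i == k j])) => [|k]; last first.
  by rewrite [RHS]inE.
apply: (ler_sum_inj (phi := fun k => update k j ord0)) => //.
- move=> k k'; rewrite !inE => /andP[_ /eqP kij] /andP[_ /eqP kij'] E.
  apply: (update_inj E); rewrite -kij -kij'; move/ffunP: E => /(_ i).
  by rewrite !ffunE eq_sym (negbTE ji).
- by move=> k; rewrite inE => /andP[kr /eqP kij]; exact: merge_reps.
- by move=> k _; rewrite (imset_update _ ord0 jI).
Qed.

Section nonfresh.
Variables (I : {set J}) (c : J -> nat) (m : nat) (D : R).
Hypothesis remD : forall i m', i \in I -> (m' <= m)%N -> wcount (I :\ i) c m' <= D.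
Hypothesis mergeD : forall i j, i \in I -> j \in I :\ i -> wcount (I :\ j) (merge c i j) m <= D.

Lemma wcount_hit_le S :
  \sum_(k in reps I c m | ~~ [disjoint k @: I & S]) w (k @: I) <= (#|I| * #|S|)%:R * D.
Proof.
rewrite -cardsX; apply: (ler_sum_cover (P := fun e k => k e.1 == e.2)) => //.
- move=> k _ /pred0Pn[_ /= /andP[/imsetP[i iI ->] kS]].
  by exists (i, k i); rewrite ?inE ?iI.
- move=> e; rewrite inE => /andP[eI _]; apply: le_trans (wcount_coord_le c m e.2 eI) _.
  by apply: remD => //; exact: leq_subr.
Qed.

Lemma wcount_ninj_le :
  \sum_(k in reps I c m | ~~ inj_on I k) w (k @: I) <= (#|I| ^ 2)%:R * D.
Proof.
rewrite -mulnn -cardsX.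
apply: (ler_sum_cover (P := fun e k => (e.1 != e.2) && (k e.1 == k e.2))) => //.
- move=> k _ ninj; apply: contrapT => nocol; move/imset_injP: ninj; apply => i j iI jI kij.
  apply/eqP; apply: contraT => ij; case: nocol; exists (i, j); rewrite ?inE/= ?iI//.
  by rewrite ij kij/=.
- move=> [i j]; rewrite inE /= => /andP[iI jI].
  case: (eqVneq i j) => [_|ij] /=.
    rewrite big_pred0 => [|k]; last exact: andbF.
    exact: le_trans (wcount_ge0 _ _ _) (remD iI (leq0n m)).
  apply: le_trans (wcount_eq_coord_le c m iI _) (mergeD iI _); by rewrite in_setD1 eq_sym ij.
Qed.

Lemma wcount_nonfresh_le S :
  \sum_(k in reps I c m | ~~ fresh S I k) w (k @: I) <= (#|I| * #|S| + #|I| ^ 2)%:R * D.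
Proof.
rewrite natrD mulrDl; apply: le_trans (lerD (wcount_hit_le S) wcount_ninj_le).
rewrite big_mkcondr [X in _ <= X + _]big_mkcondr [X in _ <= _ + X]big_mkcondr -big_split/=.
apply: ler_sum => k _; rewrite /fresh.
by case: inj_on; case: [disjoint _ & _] => /=; rewrite ?addr0 ?add0r// lerDl.
Qed.

End nonfresh.

Definition wcount_factor (K : R) (L s : nat) : R := (K + 1) * (L * s + L ^ 2).+1%:R ^+ L.

Lemma wcount_le (B L s : nat) (W : nat -> R) (K : R) : 0 <= K -> w set0 <= 1 ->
  (forall m, 1 <= W m) -> {homo W : m n / (m <= n)%N >-> m <= n} ->
  (forall I c m, (0 < #|I| <= L)%N -> admissible B I c -> (m <= N)%N ->
    exists2 S : {set T}, (#|S| <= s)%N &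
      \sum_(k in reps I c m | fresh S I k) w (k @: I) <= K * W m) ->
  forall I c m, (#|I| <= L)%N -> admissible B I c -> (m <= N)%N ->
    wcount I c m <= wcount_factor K L s * W m.
Proof.
move=> K0 w1 W1 Wmono freshK I c m; rewrite /wcount_factor; set q : R := _.+1%:R.
have W0 n : 0 <= W n by exact: le_trans (W1 n).
have q1 : 1 <= q by rewrite ler1n.
have qW l n : 0 <= (K + 1) * q ^+ l * W n.
  by rewrite !mulr_ge0 ?exprn_ge0 ?addr_ge0// (le_trans _ q1).
move=> IL ac mN; apply: (@le_trans _ _ ((K + 1) * q ^+ #|I| * W m)); last first.
  by rewrite ler_wpM2r// ler_wpM2l ?addr_ge0// ler_weXn2l.
move: {2}#|I| (erefl #|I|) => l; elim: l I c m IL ac mN => [|l IH] I c m IL ac mN Il.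
  rewrite Il mulr1; apply: (@le_trans _ _ 1).
    move/eqP: Il; rewrite cards_eq0 => /eqP ->; rewrite /wcount.
    under eq_bigr do rewrite imset0; rewrite sumr_const.
    by rewrite -mulr_natl mulr_ile1 ?lern1 ?card_reps_set0.
  by rewrite -[leLHS]mulr1 ler_pM// lerDr.
have removal i : i \in I -> #|I :\ i| = l by move=> iI; have := cardsD1 i I; rewrite iI Il => -[].
have IHl I' c' m' : #|I'| = l -> admissible B I' c' -> (m' <= m)%N ->
    wcount I' c' m' <= (K + 1) * q ^+ l * W m.
  move=> I'l ac' m'm; rewrite -I'l (le_trans (IH I' c' m' _ ac' _ _))//.
  - by rewrite I'l ltnW// -Il.
  - exact: leq_trans mN.
  - by rewrite ler_wpM2l ?Wmono// mulr_ge0 ?exprn_ge0 ?addr_ge0// (le_trans _ q1).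
have [|S Ss freshS] := freshK I c m _ ac mN; first by rewrite Il in IL *.
rewrite /wcount (bigID (fresh S I))/=; apply: (le_trans (lerD freshS _)).
  apply: wcount_nonfresh_le => [i m' iI m'm|i j iI jI].
    by apply: IHl => //; [exact: removal|exact: admissible_rem].
  apply: IHl => //; last exact: admissible_merge.
  by apply: removal; move: jI; rewrite in_setD1 => /andP[].
rewrite Il; set X := (K + 1) * q ^+ l * W m.
have KX : K * W m <= X.
  by rewrite ler_wpM2r// -[leLHS]mulr1 ler_pM ?lerDl// exprn_ege1.
have coef_q : 1 + (l.+1 * #|S| + l.+1 ^ 2)%:R <= q.
  rewrite nat1r ler_nat ltnS leq_add//; first by rewrite leq_mul// -Il.
  by rewrite leq_exp2r// -Il.
apply: (le_trans (lerD KX (lexx _))); rewrite -[X in X + _]mul1r -mulrDl.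
have -> : (K + 1) * q ^+ l.+1 * W m = q * X by rewrite /X exprS; ring.
by rewrite ler_wpM2r// qW.
Qed.

End weighted_count.
End representations.

(** * Representations in a random set *)

Section random_representations.
Import boot.fintype boot.finset.
Variables (R : realType) (p : nat -> R).
Hypothesis p01 : forall x, 0 <= p x <= 1.
Variables (J : finType) (N : nat).
Local Notation T := 'I_N.+1.
Implicit Types (I : {set J}) (c : J -> nat) (k : {ffun J -> T}) (S U V : {set T}) (A : pred nat).

Let p_ge0 x : 0 <= p x. Proof. by case/andP: (p01 x). Qed.
Let p_le1 x : p x <= 1. Proof. by case/andP: (p01 x). Qed.

Definition elts U : seq nat := [seq val x | x <- enum U].

Lemma mem_elts U (x : T) : ((x : nat) \in elts U) = (x \in U).
Proof. by rewrite mem_map ?mem_enum//; exact: val_inj. Qed.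

Lemma below_elts U : below N.+1 (elts U).
Proof.
rewrite /below map_inj_uniq ?enum_uniq/=; last exact: val_inj.
by apply/allP => _ /mapP[x _ ->]; exact: ltn_ord.
Qed.

Lemma prod_elts U (P : pred nat) :
  \prod_(x <- elts U | P x) p x = \prod_(x in U | P x) p x.
Proof. by rewrite big_map big_enum_cond. Qed.

Definition contains A U := all A (elts U).

Lemma containsP A U : reflect (forall x : T, x \in U -> A x) (contains A U).
Proof.
apply: (iffP allP) => [AU x xU|AU _ /mapP[x xU ->]]; first by apply: AU; rewrite mem_elts.
by apply: AU; rewrite -mem_enum.
Qed.

Lemma contains_antitone A x U : (contains A (x |: U))%:R <= (contains A U)%:R :> R.
Proof.
rewrite ler_nat; case: containsP => // AxU.
by rewrite lt0b; apply/containsP => y yU; apply: AxU; rewrite in_setU1 yU orbT.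
Qed.

Definition weight U : R := \prod_(x in U) p x.

Lemma weight_ge0 U : 0 <= weight U. Proof. exact: prodr_ge0. Qed.

Lemma weight_setD_antitone S x U : weight ((x |: U) :\: S) <= weight (U :\: S).
Proof.
have sub : U :\: S \subset (x |: U) :\: S by rewrite setSD// subsetUr.
rewrite /weight [leLHS](big_setID (U :\: S))/= (setIidPr sub) ler_piMr ?weight_ge0//.
by apply: prodr_ile1 => y _; rewrite p_ge0 p_le1.
Qed.

Lemma mean_contains U f : mean p N.+1 (fun A => (contains A U)%:R * f A) =
  weight U * mean p N.+1 (fun A => f (adjoin (elts U) A)).
Proof.
rewrite (mean_cond p01 f (below_elts U)) prod_elts; congr (_ * _).
by apply: eq_bigl => x; rewrite andbT.
Qed.

Lemma prod_le_weight I k : \prod_(i in I) p (k i) <= weight (k @: I).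
Proof.
rewrite (partition_big_imset k)/=; apply: ler_prod => y /imsetP[i iI ->].
rewrite prodr_ge0//= (bigD1 i)/= ?iI ?eqxx// ler_piMr//.
by apply: prodr_ile1 => j _; rewrite p_ge0 p_le1.
Qed.

Lemma weight_inj_on I k : inj_on I k -> weight (k @: I) = \prod_(i in I) p (k i).
Proof. by move=> /imset_injP inj; rewrite /weight big_imset. Qed.

Definition rep_mass I c m : R := \sum_(k in reps N I c m) \prod_(i in I) p (k i).

Lemma rep_mass_ge0 I c m : 0 <= rep_mass I c m.
Proof. by apply: sumr_ge0 => k _; exact: prodr_ge0. Qed.

Lemma sum_fresh_weight_le S I c m :
  \sum_(k in reps N I c m | fresh S I k) weight (k @: I) <= rep_mass I c m.
Proof.
rewrite /rep_mass [leRHS](bigID (fresh S I))/= -[leLHS]addr0; apply: lerD.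
  by apply: ler_sum => k /andP[_ /andP[/weight_inj_on -> _]].
by apply: sumr_ge0 => k _; exact: prodr_ge0.
Qed.

Lemma wcount_weight_setD_le (B L s : nat) (W : nat -> R) (K : R) S : 0 <= K ->
  (forall m, 1 <= W m) -> {homo W : m n / (m <= n)%N >-> m <= n} ->
  (forall I c m, (0 < #|I| <= L)%N -> admissible B I c -> (m <= N)%N ->
    rep_mass I c m <= K * W m) -> (#|S| <= s)%N ->
  forall I c m, (#|I| <= L)%N -> admissible B I c -> (m <= N)%N ->
    wcount (fun U => weight (U :\: S)) I c m <= wcount_factor K L s * W m.
Proof.
move=> K0 W1 Wmono massK Ss; apply: (@wcount_le _ _ _ _ _ _ B) => //.
- by move=> U; exact: weight_ge0.
- by move=> x U; exact: weight_setD_antitone.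
- by rewrite set0D /weight big_set0.
move=> I c m IL ac mN; exists S => //; apply: le_trans (massK I c m IL ac mN).
apply: le_trans (sum_fresh_weight_le S I c m); apply: ler_sum => k /andP[_ /andP[_ kS]].
by rewrite (setDidPl kS).
Qed.

Section disjoint_tuples.
Variables (I : {set J}) (c : J -> nat) (m : nat).

(* Number of ordered M-tuples of pairwise disjoint injective representations of m
   with entries in A and off S. *)
Fixpoint disjoint_tuples (M : nat) S A : R :=
  if M is M'.+1 then
    \sum_(k in reps N I c m | fresh S I k)
      (contains A (k @: I))%:R * disjoint_tuples M' (S :|: k @: I) A
  else 1.

Lemma disjoint_tuplesS M S : disjoint_tuples M.+1 S =
  (fun A => \sum_(k in reps N I c m | fresh S I k)
    (contains A (k @: I))%:R * disjoint_tuples M (S :|: k @: I) A).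
Proof. by []. Qed.

Lemma disjoint_tuples_ge0 M S A : 0 <= disjoint_tuples M S A.
Proof. by elim: M S => //= M IH S; apply: sumr_ge0 => k _; exact: mulr_ge0. Qed.

Lemma disjoint_tuples_adjoin M S U A : U \subset S ->
  disjoint_tuples M S (adjoin (elts U) A) = disjoint_tuples M S A.
Proof.
elim: M S => //= M IH S US; apply: eq_bigr => k /andP[_ /andP[_ kS]].
rewrite IH; last exact: subset_trans US (subsetUl _ _).
congr (_ * _); congr (nat_of_bool _)%:R; apply: eq_in_all => _ /mapP[x xk ->].
rewrite /adjoin mem_elts (negbTE (_ : x \notin U))//; apply/negP => /(subsetP US) xS.
by move/pred0P: kS => /(_ x) /=; rewrite -mem_enum xk xS.
Qed.

Lemma mean_disjoint_tuples_le M S : mean p N.+1 (disjoint_tuples M S) <= rep_mass I c m ^+ M.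
Proof.
elim: M S => [|M IH] S; first by rewrite mean_cst expr0.
rewrite disjoint_tuplesS mean_sum exprS.
apply: (@le_trans _ _ (\sum_(k in reps N I c m | fresh S I k)
    weight (k @: I) * rep_mass I c m ^+ M)).
  apply: ler_sum => k _; rewrite mean_contains ler_wpM2l ?weight_ge0//.
  apply: le_trans (IH (S :|: k @: I)); apply: mean_le => // A.
  by rewrite disjoint_tuples_adjoin// subsetUr.
by rewrite -mulr_suml ler_wpM2r ?sum_fresh_weight_le ?exprn_ge0 ?rep_mass_ge0.
Qed.

(* Greedy choice of the representations one after the other. *)
Lemma disjoint_tuples_ge M S A (y : R) : 0 <= y ->
  (forall S', (#|S'| <= #|S| + #|I| * M)%N ->
    y <= \sum_(k in reps N I c m | fresh S' I k) (contains A (k @: I))%:R) ->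
  y ^+ M <= disjoint_tuples M S A.
Proof.
move=> y0; elim: M S => [|M IH] S freshy; first by rewrite expr0.
rewrite /= exprSr; have := freshy S (leq_addr _ _).
move=> /(ler_wpM2l (exprn_ge0 M y0))/le_trans; apply.
rewrite mulr_sumr; apply: ler_sum => k /andP[_ /andP[/eqP kI _]].
rewrite mulrC ler_wpM2l//; apply: IH => S' S'S; apply: freshy.
apply: (leq_trans S'S); rewrite mulnS addnA leq_add2r -kI.
exact: leq_card_setU.
Qed.

Lemma disjoint_tuples_lt_blocked M A (y : R) : 0 <= y -> disjoint_tuples M set0 A < y ^+ M ->
  exists2 S : {set T}, (#|S| <= #|I| * M)%N &
    \sum_(k in reps N I c m | fresh S I k) (contains A (k @: I))%:R < y.
Proof.
move=> y0; rewrite ltNge => /negP few; apply: contrapT => nblocked; apply: few.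
apply: disjoint_tuples_ge => // S; rewrite cards0 add0n => SM.
by rewrite leNgt; apply/negP => Sy; apply: nblocked; exists S.
Qed.

End disjoint_tuples.

Lemma eq_disjoint_tuples M I c c' m S A : {in I, c =1 c'} ->
  disjoint_tuples I c m M S A = disjoint_tuples I c' m M S A.
Proof.
move=> cc'; elim: M S => //= M IH S; rewrite (eq_reps _ _ cc').
by apply: eq_bigr => k _; rewrite IH.
Qed.

End random_representations.

Lemma rep_count_wcount (R : realFieldType) (h : nat) (b : 'I_h -> nat) (A : pred nat) (n N : nat) :
  (forall i, (0 < b i)%N) -> (n <= N)%N ->
  (rep_count b A n)%:R = wcount (fun U : {set 'I_N.+1} => (contains A U)%:R : R) [set: 'I_h] b n.
Proof.
move=> b0 nN; pose B := [set k in reps N [set: 'I_h] b n | contains A (k @: [set: 'I_h])].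
transitivity (#|B|%:R : R); last first.
  rewrite /wcount -sum1_card natr_sum [LHS]big_mkcond [RHS]big_mkcond/=; apply: eq_bigr => k _.
  by rewrite [k \in B]inE; case: (k \in reps _ _ _ _) => //=; case: contains.
have nN1 : (n.+1 <= N.+1)%N by [].
pose widen (k : {ffun 'I_h -> 'I_n.+1}) := [ffun i => widen_ord nN1 (k i)].
have widen_inj : injective widen.
  move=> k k' /ffunP E; apply/ffunP => i; apply: val_inj.
  by have := E i; rewrite !ffunE => /(congr1 val).
congr (_%:R); rewrite /rep_count -(card_imset _ widen_inj); apply: eq_card => k'.
apply/imsetP/idP => [[k]|].
  rewrite inE => /andP[/forallP kA /eqP kn] ->; rewrite inE; apply/andP; split.
    apply/repsP; split; first by move=> i; rewrite inE.
    by rewrite -[RHS]kn; apply: eq_big => [i|i _]; rewrite ?inE ?ffunE.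
  by apply/containsP => _ /imsetP[i _ ->]; rewrite ffunE /=; exact: kA.
rewrite inE => /andP[/repsP[_ kn] /containsP kA].
have k'n i : (k' i < n.+1)%N.
  rewrite ltnS -kn (bigD1 i) ?inE//=; apply: leq_trans (leq_addr _ _).
  by rewrite leq_pmull.
exists [ffun i => Ordinal (k'n i)]; last by apply/ffunP => i; rewrite !ffunE; exact: val_inj.
rewrite inE; apply/andP; split.
  by apply/forallP => i; rewrite ffunE /=; apply: kA; exact: imset_f.
by apply/eqP; rewrite -[RHS]kn; apply: eq_big => [i|i _]; rewrite ?inE ?ffunE.
Qed.

(** * Bounds for convolutions of regularly varying sequences *)

Lemma sum_eq_mod_period (b q y t : nat) : (0 < q)%N -> coprime b q ->
  (\sum_(y <= x < y + q) (b * x == t %[mod q]) = 1)%N.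
Proof.
move=> q0 bq; rewrite -{1}[y]add0n big_addn addKn big_mkord.
pose f (i : 'I_q) : 'I_q := Ordinal (ltn_pmod (b * (i + y)) q0).
have f_inj : injective f.
  move=> i j /(congr1 val) /= /eqP; wlog ij : i j / (i <= j)%N.
    by move=> le_case; case: (leqP i j) => [|/ltnW] ij E; [|apply/esym];
      apply: le_case; rewrite // eq_sym.
  rewrite eq_sym eqn_mod_dvd; last by rewrite leq_mul2l leq_add2r ij orbT.
  rewrite -mulnBr subnDr Gauss_dvdr 1?coprime_sym// => qd.
  apply/val_inj/eqP; rewrite eqn_leq ij -subn_eq0; apply: contraLR qd; rewrite -lt0n => ji.
  by rewrite gtnNdvd// (leq_ltn_trans (leq_subr _ _)).
pose j : 'I_q := Ordinal (ltn_pmod t q0).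
transitivity (\sum_(i < q) (i == j))%N; first by rewrite [RHS](reindex_inj f_inj).
by rewrite (bigD1 j)//= eqxx big1 ?addn0// => i /negbTE ->.
Qed.

Lemma sum_dvdn_window (a g n y : nat) : (0 < a)%N -> (0 < g)%N ->
  (a * (y + g %/ gcdn a g) <= n + a)%N ->
  (\sum_(y <= x < y + g %/ gcdn a g) (g %| n - a * x) = (gcdn a g %| n))%N.
Proof.
set d := gcdn a g; set q := (g %/ d)%N => a0 g0 aq.
have d0 : (0 < d)%N by rewrite gcdn_gt0 a0.
have gE : g = (d * q)%N by rewrite mulnC divnK// dvdn_gcdr.
have aE : a = (d * (a %/ d))%N by rewrite mulnC divnK// dvdn_gcdl.
have q0 : (0 < q)%N by move: g0; rewrite gE muln_gt0 => /andP[].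
have axn x : (y <= x < y + q)%N -> (a * x <= n)%N.
  move=> /andP[_ xq]; rewrite -(leq_add2r a); apply: leq_trans aq.
  by rewrite -mulnSr leq_mul2l xq orbT.
have [dn|dn] := boolP (d %| n)%N; last first.
  rewrite big_nat_cond big1// => x /andP[/axn ax _]; apply/eqP; rewrite eqb0.
  apply: contra dn => gd; rewrite -(subnK ax) dvdn_add//; last by rewrite dvdn_mulr// dvdn_gcdl.
  by apply: dvdn_trans gd; exact: dvdn_gcdr.
have coprime_aq : coprime (a %/ d) q.
  by rewrite /coprime -(eqn_pmul2l d0) muln_gcdr -aE -gE muln1.
have nE : n = (d * (n %/ d))%N by rewrite mulnC divnK.
rewrite -[RHS](sum_eq_mod_period y (n %/ d) q0 coprime_aq) big_nat_cond [RHS]big_nat_cond.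
apply: eq_bigr => x /andP[/axn ax _]; congr nat_of_bool.
rewrite {1}gE {1}nE {1}aE -mulnA -mulnBr dvdn_pmul2l// eq_sym eqn_mod_dvd//.
by rewrite -(leq_pmul2l d0) mulnA -aE -nE.
Qed.

Section convolution_bounds.
Variable R : realType.
Implicit Types (v w : nat -> R) (a n : nat).

Definition dilated_conv a (P u : nat -> R) n : R :=
  \sum_(x < n.+1 | (a * x <= n)%N) P x * u (n - a * x)%N.

Definition conv_scale v w n : R := n.+1%:R * expR (v n) * expR (w n).

Lemma conv_scale_gt0 v w n : 0 < conv_scale v w n.
Proof. by rewrite !mulr_gt0 ?expR_gt0. Qed.

Variables (sg bt : R) (v w : nat -> R) (a : nat).
Hypotheses (v_regvar : ln_regvar sg v) (w_regvar : ln_regvar bt w).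
Hypotheses (sg1 : -1 < sg) (bt1 : -1 < bt) (a0 : (0 < a)%N).

Lemma conv_head_bound : exists s K : R, [/\ 0 < s, 0 < K & forall n k, (2 * a * k <= n)%N ->
  \sum_(x < k.+1) expR (v x) * expR (w (n - a * x)%N) <=
    K * conv_scale v w n * expR (s * (lnS k - lnS n))].
Proof.
have [s [K [s0 K0 v_sum_le]]] := ln_regvar_sum_bound v_regvar sg1.
have half0 : 0 < 2^-1 :> R by rewrite invr_gt0.
have [K' K'0 w_le] := ln_regvar_proportion_bound w_regvar half0.
exists s, (K * K'); split => //; first exact: mulr_gt0.
move=> n k kn; have kn' : (k <= n)%N by apply: leq_trans kn; rewrite leq_pmull// muln_gt0.
apply: (@le_trans _ _ (\sum_(x < k.+1) expR (v x) * (K' * expR (w n)))).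
  apply: ler_sum => x _; rewrite ler_wpM2l ?expR_ge0// w_le ?leq_subr//.
  rewrite mulrC ler_pdivrMr// -natrM ler_nat.
  have : (2 * (a * x) <= n)%N by rewrite mulnA (leq_trans _ kn)// leq_mul2l -ltnS ltn_ord orbT.
  by move: (a * x)%N => ax; clear; lia.
have C0 : 0 <= K' * expR (w n) by rewrite mulr_ge0 ?expR_ge0// ltW.
rewrite -mulr_suml (le_trans (ler_wpM2r C0 (v_sum_le k n kn')))//.
by rewrite le_eqVlt /conv_scale; apply/orP; left; apply/eqP; ring.
Qed.

Lemma conv_tail_bound : exists s K : R, [/\ 0 < s, 0 < K & forall n j, (j <= n)%N ->
  \sum_(x < n.+1 | [&& a * x <= n, n <= 2 * a * x & n - a * x <= j]%N)
      expR (v x) * expR (w (n - a * x)%N) <=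
    K * conv_scale v w n * expR (s * (lnS j - lnS n))].
Proof.
have [s [K [s0 K0 w_sum_le]]] := ln_regvar_sum_bound w_regvar bt1.
have a20 : 0 < (2 * a)%:R^-1 :> R by rewrite invr_gt0 ltr0n muln_gt0.
have [K' K'0 v_le] := ln_regvar_proportion_bound v_regvar a20.
exists s, (K * K'); split => //; first exact: mulr_gt0.
move=> n j jn; pose C (x : 'I_n.+1) := [&& a * x <= n, n <= 2 * a * x & n - a * x <= j]%N.
apply: (@le_trans _ _ (\sum_(x < n.+1 | C x) K' * expR (v n) * expR (w (n - a * x)%N))).
  apply: ler_sum => x /and3P[ax nx _]; rewrite ler_wpM2r ?expR_ge0// v_le -1?ltnS//.
  by rewrite mulrC ler_pdivrMr ?ltr0n ?muln_gt0// -natrM ler_nat; move: nx a0; clear; nia.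
have tail_le : \sum_(x < n.+1 | C x) expR (w (n - a * x)%N) <= \sum_(i < j.+1) expR (w i).
  rewrite (eq_bigl (fun x => x \in [set x | C x])) => [|x]; last by rewrite inE.
  rewrite [leRHS](eq_bigl (fun i => i \in [set: 'I_j.+1])) => [|i]; last by rewrite inE.
  apply: (ler_sum_inj (phi := fun x : 'I_n.+1 => inord (n - a * x) : 'I_j.+1)) => //.
  - move=> x y; rewrite !inE => /and3P[ax _ xj] /and3P[ay _ yj] /(congr1 val) /=.
    rewrite !inordK ?ltnS// => E; apply/val_inj/eqP; rewrite -(eqn_pmul2l a0).
    by move: E ax ay; move: (a * x)%N (a * y)%N => ? ?; clear; lia.
  - by move=> x; rewrite inE => /and3P[_ _ xj]; rewrite inordK.
have C0 : 0 <= K' * expR (v n) by rewrite mulr_ge0 ?expR_ge0// ltW.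
rewrite -mulr_sumr (le_trans (ler_wpM2l C0 (le_trans tail_le (w_sum_le j n jn))))//.
by rewrite le_eqVlt /conv_scale; apply/orP; left; apply/eqP; ring.
Qed.

Lemma dilated_conv_bound : exists2 K : R, 0 < K &
  forall n, dilated_conv a (expR \o v) (expR \o w) n <= K * conv_scale v w n.
Proof.
have [s [K [s0 K0 head_le]]] := conv_head_bound; have [s' [K' [_ K'0 tail_le]]] := conv_tail_bound.
have e0 x y : 0 <= expR (v x) * expR (w y) by rewrite mulr_ge0 ?expR_ge0.
exists (K + K'); first exact: addr_gt0.
move=> n; rewrite /dilated_conv (bigID (fun x : 'I_n.+1 => 2 * a * x <= n)%N)/= mulrDl.
apply: lerD; last first.
  have := tail_le n n (leqnn _); rewrite subrr mulr0 expR0 mulr1; apply: le_trans.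
  rewrite [leLHS]big_mkcond [leRHS]big_mkcond/=; apply: ler_sum => x _.
  case: ifPn => [/andP[-> xn]|_]; last by case: ifP.
  by rewrite leq_subr andbT ltnW // ltnNge.
pose k := (n %/ (2 * a))%N.
have kn : (2 * a * k <= n)%N by rewrite mulnC leq_divM.
have kn' : (k <= n)%N by exact: leq_div.
apply: (@le_trans _ _ (K * conv_scale v w n * expR (s * (lnS k - lnS n)))); last first.
  rewrite ler_piMr ?mulr_ge0 ?(ltW K0) ?(ltW (conv_scale_gt0 _ _ _))// expR_le1.
  by rewrite pmulr_rle0// subr_le0 le_lnS.
apply: le_trans (head_le n k kn).
rewrite (big_ord_widen n.+1 (fun x => expR (v x) * expR (w (n - a * x)%N)))//.
rewrite [leLHS]big_mkcond [leRHS]big_mkcond/=; apply: ler_sum => x _.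
case: ifPn => [/andP[_ xn]|_]; last by case: ifP.
by rewrite ltnS leq_divRL ?muln_gt0// [(x * _)%N]mulnC xn.
Qed.

End convolution_bounds.

(** * The Beta integral *)

Section beta_integral.
Variables (R : realType) (sg bt : R).
Local Notation mu := (@lebesgue_measure R).
Implicit Types s e t z m M : R.
Local Open Scope classical_set_scope.
Local Open Scope ring_scope.

Definition beta_kernel z : R := z `^ sg * (1 - z) `^ bt.

Definition beta_mass s e : R := \int[mu]_(z in `[s, e]) beta_kernel z.

Definition beta_integral : R := \int[mu]_(z in `]0, 1[) beta_kernel z.

Lemma beta_kernelE z : 0 < z < 1 -> beta_kernel z = expR (sg * ln z + bt * ln (1 - z)).
Proof.
move=> /andP[z0 z1]; rewrite /beta_kernel /powR !gt_eqF ?subr_gt0//.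
by rewrite expRD.
Qed.

Lemma beta_kernel_ge0 z : 0 <= beta_kernel z.
Proof. by rewrite mulr_ge0 ?powR_ge0. Qed.

Lemma measurable_beta_kernel : measurable_fun setT beta_kernel.
Proof.
apply: measurable_funM; first exact: measurable_powR.
apply: (@measurableT_comp _ _ _ _ _ _ (fun z : R => z `^ bt)); first exact: measurable_powR.
exact: measurable_funB.
Qed.

Lemma within_continuous_beta_kernel s e : 0 < s -> e < 1 ->
  {within `[s, e], continuous beta_kernel}.
Proof.
move=> s0 e1; apply: continuous_in_subspaceT => z; rewrite inE/= in_itv/= => /andP[sz ze].
have z0 : 0 < z by exact: lt_le_trans sz.
have z1 : z < 1 by exact: le_lt_trans e1.
have kE : {near z, (fun z => expR (sg * ln z + bt * ln (1 - z))) =1 beta_kernel}.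
  near=> y; rewrite beta_kernelE//; apply/andP; split; near: y.
    exact: lt_nbhsr.
  exact: lt_nbhsl.
rewrite /prop_for /continuous_at beta_kernelE ?z0//; apply: cvg_trans (near_eq_cvg kE) _.
apply: (@continuous_comp _ _ _ (fun z => sg * ln z + bt * ln (1 - z)) (@expR R)); last first.
  exact: continuous_expR.
apply: cvgD; apply: cvgM; [exact: cvg_cst|exact: continuous_ln|exact: cvg_cst|].
apply: (@cvg_comp _ _ _ (fun z : R => 1 - z) (@ln R) _ (nbhs (1 - z))).
  by apply: cvgB; [exact: cvg_cst|exact: cvg_id].
by apply: continuous_ln; rewrite subr_gt0.
Unshelve. all: by end_near. Qed.

Lemma integrable_beta_kernel s e : 0 < s -> e < 1 ->
  mu.-integrable `[s, e] (EFin \o beta_kernel).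
Proof.
move=> s0 e1; apply: continuous_compact_integrable; first exact: segment_compact.
exact: within_continuous_beta_kernel.
Qed.

Lemma beta_mass_bounds s e m M : 0 < s -> s <= e -> e < 1 ->
  (forall z, s <= z <= e -> m <= beta_kernel z <= M) ->
  m * (e - s) <= beta_mass s e <= M * (e - s).
Proof.
move=> s0 se e1 mM.
have cst_int (r : R) : mu.-integrable `[s, e] (EFin \o cst r).
  apply: continuous_compact_integrable; first exact: segment_compact.
  by apply: continuous_subspaceT => z; exact: cvg_cst.
have cstE (r : R) : \int[mu]_(z in `[s, e]) cst r z = r * (e - s).
  rewrite Rintegral_cst//= lebesgue_measure_itv/= lte_fin.
  move: se; rewrite le_eqVlt => /predU1P[->|se]; first by rewrite ltxx subrr.
  by rewrite se -EFinB.
have kint := integrable_beta_kernel s0 e1.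
rewrite -!cstE; apply/andP; split; apply: le_Rintegral => //.
  by move=> z /=; rewrite in_itv/= => /mM /andP[].
by move=> z /=; rewrite in_itv/= => /mM /andP[].
Qed.

Lemma beta_massD s t e : 0 < s -> s <= t -> t <= e -> e < 1 ->
  beta_mass s e = beta_mass s t + beta_mass t e.
Proof.
move=> s0 st te e1.
have := @Rintegral_itvB R beta_kernel (BLeft s) (BRight e) t (integrable_beta_kernel s0 e1).
rewrite !bnd_simp => /(_ st te) /eqP; rewrite subr_eq => /eqP massE.
rewrite [LHS]massE addrC; congr (_ + _); apply: (Rintegral_itv_obnd_cbnd (b := BRight e)).
apply: integrableS (integrable_beta_kernel (lt_le_trans s0 st) e1) => //.
by apply: subset_itvr; rewrite bnd_simp.
Qed.

Lemma beta_mass_ge0 s e : 0 <= beta_mass s e.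
Proof. by apply: Rintegral_ge0 => z _; exact: beta_kernel_ge0. Qed.

Lemma beta_mass_le s s' e e' : 0 < s' -> s' <= s -> s <= e -> e <= e' -> e' < 1 ->
  beta_mass s e <= beta_mass s' e'.
Proof.
move=> s'0 ss se ee e1.
rewrite (beta_massD s'0 ss (le_trans se ee) e1) (beta_massD (lt_le_trans s'0 ss) se ee e1).
by rewrite addrCA lerDl addr_ge0 ?beta_mass_ge0.
Qed.

Lemma beta_mass_diag s : 0 < s -> s < 1 -> beta_mass s s = 0.
Proof. by move=> s0 s1; have := beta_massD s0 (lexx s) (lexx s) s1; lra. Qed.

Lemma beta_mass_gt0 s e : 0 < s -> s < e -> e < 1 -> 0 < beta_mass s e.
Proof.
move=> s0 se e1.
have [z zI zmin] := EVT_min (ltW se) (within_continuous_beta_kernel s0 e1).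
have [M _ Mmax] := EVT_max (ltW se) (within_continuous_beta_kernel s0 e1).
have /andP[+ _] : beta_kernel z * (e - s) <= beta_mass s e <= beta_kernel M * (e - s).
  apply: beta_mass_bounds => //; first exact: ltW.
  by move=> t tI; rewrite zmin ?Mmax// in_itv.
apply: lt_le_trans; rewrite mulr_gt0 ?subr_gt0// beta_kernelE ?expR_gt0//.
move: zI; rewrite in_itv/= => /andP[sz ze].
by rewrite (lt_le_trans s0)// (le_lt_trans ze).
Qed.

Section bounded_mass.
Variable K : R.
Hypothesis mass_le : forall s e, 0 < s -> s <= e -> e < 1 -> beta_mass s e <= K.

Let eps n : R := n.+2%:R^-1.

Let eps_gt0 n : 0 < eps n. Proof. by rewrite invr_gt0. Qed.

Let eps_le n : eps n <= 1 - eps n.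
Proof.
have : eps n <= 2^-1 by rewrite lef_pV2 ?posrE// ler_nat.
lra.
Qed.

Let eps_small (e : R) : 0 < e -> \forall n \near \oo, eps n <= e.
Proof.
move=> e0; apply: filterS (near_infty_natSinv_lt (PosNum e0)) => n /ltW; apply: le_trans.
by rewrite lef_pV2 ?posrE// ler_nat.
Qed.

Lemma cvg_beta_mass : beta_mass (eps n) (1 - eps n) @[n --> \oo] --> beta_integral.
Proof.
pose F n : set R := `[eps n, 1 - eps n]%classic.
have ndF : nondecreasing_seq F.
  move=> n m nm; apply/subsetPset => z; rewrite /F /= !in_itv/= => /andP[nz zn].
  have mn : eps m <= eps n by rewrite lef_pV2 ?posrE// ler_nat ltnS.
  by apply/andP; split; lra.
have UF : \bigcup_n F n = `]0, 1[%classic.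
  apply/seteqP; split => [z [n _]|z]; rewrite /F /= !in_itv/=.
    move=> /andP[nz zn]; rewrite (lt_le_trans (eps_gt0 n) nz) (le_lt_trans zn)//.
    by rewrite ltrBlDr ltrDl.
  move=> /andP[z0 z1]; near \oo => n; exists n => //=; rewrite in_itv/=.
  have zn : eps n <= z by near: n; apply: eps_small; rewrite ?subr_gt0.
  have zn1 : eps n <= 1 - z by near: n; apply: eps_small; rewrite ?subr_gt0.
  by rewrite zn lerBrDr addrC -lerBrDr.
have intF n : (\int[mu]_(z in F n) (beta_kernel z)%:E)%E = (beta_mass (eps n) (1 - eps n))%:E.
  rewrite /beta_mass /Rintegral fineK//; apply: integrable_fin_num => //.
  by apply: integrable_beta_kernel; rewrite ?eps_gt0// ltrBlDr ltrDl.
have cvgF : (beta_mass (eps n) (1 - eps n))%:E @[n --> \oo] -->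
    (\int[mu]_(z in `]0%R, 1%R[) (beta_kernel z)%:E)%E.
  rewrite -UF; under eq_fun do rewrite -intF.
  apply: ge0_nondecreasing_set_cvg_integral => //.
  - by move=> n; exact: measurable_itv.
  - move=> n; apply/measurable_EFinP; apply: measurable_funTS; exact: measurable_beta_kernel.
  - by move=> n z _; rewrite lee_fin beta_kernel_ge0.
have limK : (\int[mu]_(z in `]0%R, 1%R[) (beta_kernel z)%:E <= K%:E)%E.
  rewrite -(cvg_lim _ cvgF)//; apply: lime_le; first exact: cvgP cvgF.
  near=> n; rewrite lee_fin mass_le//.
  by rewrite ltrBlDr ltrDl.
have limfin : (\int[mu]_(z in `]0%R, 1%R[) (beta_kernel z)%:E)%E \is a fin_num.
  rewrite ge0_fin_numE ?(le_lt_trans limK) ?ltry//.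
  by apply: integral_ge0 => z _; rewrite lee_fin beta_kernel_ge0.
by move: cvgF; rewrite -(fineK limfin) => /fine_cvg.
Unshelve. all: by end_near. Qed.

Lemma beta_mass_le_integral s e : 0 < s -> s <= e -> e < 1 -> beta_mass s e <= beta_integral.
Proof.
move=> s0 se e1; rewrite -(cvg_lim _ cvg_beta_mass)//.
apply: limr_ge; first exact: cvgP cvg_beta_mass.
near=> n; apply: beta_mass_le => //.
- by near: n; exact: eps_small.
- by rewrite lerBrDr addrC -lerBrDr; near: n; apply: eps_small; rewrite subr_gt0.
- by rewrite ltrBlDr ltrDl.
Unshelve. all: by end_near. Qed.

Lemma beta_mass_ge_integral (d : R) : 0 < d -> exists2 eta : R, 0 < eta &
  forall s e, 0 < s <= eta -> 1 - eta <= e < 1 -> beta_integral - d <= beta_mass s e.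
Proof.
move=> d0; have /cvgrPdist_le/(_ d d0)[N _ mass_near] := cvg_beta_mass.
exists (eps N) => // s e /andP[s0 sN] /andP[Ne e1].
have := mass_near N (leqnn N); have := beta_mass_le s0 sN (eps_le N) Ne e1.
by rewrite /= ler_norml => ? /andP[_ ?]; lra.
Qed.

Lemma beta_integral_gt0 : 0 < beta_integral.
Proof.
have [q0 q1] : 0 < 4^-1 :> R /\ 4^-1 < 2^-1 :> R by lra.
apply: lt_le_trans (beta_mass_le_integral q0 (ltW q1) _); last lra.
by apply: beta_mass_gt0; lra.
Qed.

End bounded_mass.

End beta_integral.

Lemma beta_integral_onem (R : realType) (l : nat) : beta_integral 0 (l%:R : R) = l.+1%:R^-1.
Proof.
rewrite -Rintegral_onemXn /beta_integral /Rintegral [in RHS]integral_itv_bndoo.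
  congr fine; apply: eq_integral => z; rewrite inE/= in_itv/= => /andP[z0 z1].
  by rewrite /beta_kernel powRr0 mul1r powR_mulrn// subr_ge0 ltW.
apply/measurable_EFinP; apply: measurable_funTS; apply: continuous_measurable_fun => z.
exact: continuous_onemXn.
Qed.

(** * Riemann sums *)

Lemma expR_le1D2x (R : realType) (x : R) : 0 <= x <= 2^-1 -> expR x <= 1 + 2 * x.
Proof.
move=> /andP[x0 x2]; have x1 : 0 < 1 - x by lra.
apply: (@le_trans _ _ (1 - x)^-1).
  by rewrite -[leLHS]invrK lef_pV2 ?posrE ?invr_gt0 ?expR_gt0// -expRN expR_ge1Dx.
rewrite -[leLHS]mul1r ler_pdivrMr//.
have : 0 <= x * (1 - 2 * x) by rewrite mulr_ge0//; lra.
lra.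
Qed.

Lemma approx_mul_le (R : realFieldType) (c x D r chi e : R) : 0 <= c -> 0 <= chi <= 1 ->
  0 <= D -> 0 <= e <= 2^-1 -> `|x - D| <= 2 * e * D -> `|r - c * chi| <= e ->
  `|x * r - c * chi * D| <= 2 * (1 + c) * e * D.
Proof.
move=> c0 /andP[chi0 chi1] D0 /andP[e0 e2] xD rc.
have -> : x * r - c * chi * D = x * (r - c * chi) + c * chi * (x - D) by ring.
have x2D : `|x| <= 2 * D.
  rewrite -[x](subrK D); apply: (le_trans (ler_normD _ _)); rewrite (ger0_norm D0).
  by have := ler_wpM2r D0 e2; lra.
apply: (le_trans (ler_normD _ _)); rewrite !normrM (ger0_norm c0) (ger0_norm chi0).
have := ler_pM (normr_ge0 _) (normr_ge0 _) x2D rc.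
have cchi : c * chi <= c by rewrite ler_piMr.
have := ler_pM (mulr_ge0 c0 chi0) (normr_ge0 _) cchi xD; lra.
Qed.

Section riemann_sums.
Variables (R : realType) (sg bt : R) (v w : nat -> R) (a : nat).
Hypotheses (v_regvar : ln_regvar sg v) (w_regvar : ln_regvar bt w) (a0 : (0 < a)%N).
Local Open Scope classical_set_scope.
Local Open Scope ring_scope.

Implicit Types e eta eps z E : R.

Let aR : 0 < a%:R :> R. Proof. by rewrite ltr0n. Qed.

Definition grid n x : R := a%:R * x.+1%:R / n.+1%:R.

Lemma grid_gt0 n x : 0 < grid n x.
Proof. by rewrite divr_gt0// mulr_gt0. Qed.

Lemma le_grid n x y : (x <= y)%N -> grid n x <= grid n y.
Proof. by move=> xy; rewrite ler_wpM2r// ler_wpM2l ?ler_nat// ltW. Qed.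

Lemma gridD n x q : grid n (x + q) = grid n x + a%:R * q%:R / n.+1%:R.
Proof. by rewrite /grid -addSn natrD mulrDr mulrDl. Qed.

Lemma grid_window eta n x : 0 < eta -> grid n x <= 1 - eta ->
  (a * x <= n)%N /\ eta * n.+1%:R <= (n - a * x).+1%:R.
Proof.
move=> eta0; rewrite ler_pdivrMr// -[x.+1%:R]natr1 => axn.
have etan : 0 < eta * n.+1%:R by rewrite mulr_gt0.
have ax : (a * x <= n)%N by rewrite -ltnS -(ltr_nat R) natrM; have := aR; lra.
by split => //; rewrite -subSn// natrB ?natrM ?leqW//; have := aR; lra.
Qed.

Lemma grid_floor q n X E : (0 < q)%N -> grid n X <= E ->
  exists J, E - a%:R * q%:R / n.+1%:R <= grid n (X + q * J) <= E.
Proof.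
move=> q0 XE; set l := a%:R * q%:R / n.+1%:R.
have l0 : 0 < l by rewrite divr_gt0// mulr_gt0// ltr0n.
have t0 : 0 <= (E - grid n X) / l by rewrite divr_ge0 ?subr_ge0// ltW.
exists (Num.truncn ((E - grid n X) / l)); have /andP[] := truncn_itv t0.
rewrite gridD natrM mulrA mulrAC -/l ler_pdivlMr// ltr_pdivrMr// -natr1 => ? ?.
by apply/andP; split; lra.
Qed.

Lemma grid_cover q eta : (0 < q)%N -> 0 < eta <= 4^-1 -> \forall n \near \oo, exists X J,
  eta <= grid n X <= 2 * eta /\ 1 - 2 * eta <= grid n (X + q * J) <= 1 - eta.
Proof.
move=> q0 /andP[eta0 eta4]; near=> n.
have step_le : a%:R * q%:R / n.+1%:R <= eta.
  rewrite ler_pdivrMr// [leRHS]mulrC -ler_pdivrMr// (@le_trans _ _ n%:R) ?ler_nat//.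
  by near: n; exact: nbhs_infty_ger.
have step1_le : a%:R * 1%:R / n.+1%:R <= eta.
  by apply: le_trans step_le; rewrite ler_wpM2r// ler_wpM2l ?(ltW aR)// ler_nat.
have [|X] := @grid_floor 1 n 0 (2 * eta) isT.
  by apply: (le_trans step1_le); rewrite mulr_natl mulr2n lerDl ltW.
rewrite mul1n add0n => /andP[Xlo Xhi]; have [|J /andP[Jlo Jhi]] := @grid_floor q n X (1 - eta) q0.
  by apply: (le_trans Xhi); lra.
exists X, J; rewrite Xhi Jhi !andbT; move: Xlo Jlo step_le step1_le.
by move: (_ / _) (_ / _) => x y ? ? ? ?; split; lra.
Unshelve. all: by end_near. Qed.

(* Logarithm of a^sg e^(v x) e^(w (n - a x)) relative to e^(v n) e^(w n). *)
Definition conv_exponent n x : R := v x - v n + (w (n - a * x)%N - w n) + sg * ln a%:R.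

Lemma conv_exponent_approx eta eps : 0 < eta -> 0 < eps ->
  \forall n \near \oo, forall x, eta <= grid n x <= 1 - eta ->
    `|sg * ln (grid n x) + bt * ln (1 - grid n x + a%:R / n.+1%:R) - conv_exponent n x| <= eps.
Proof.
move=> eta0 eps0; have eps20 : 0 < eps / 2 by rewrite divr_gt0.
have etaa0 : 0 < eta / a%:R by rewrite divr_gt0.
apply: filterS2 (v_regvar etaa0 eps20) (w_regvar eta0 eps20) => n vn wn x /andP[xeta xeta'].
have nR : 0 < n.+1%:R :> R by [].
have [axn naxn] := grid_window eta0 xeta'.
have xn : (x <= n)%N by rewrite (leq_trans _ axn)// leq_pmull.
have := vn x xn; have := wn (n - a * x)%N (leq_subr _ _) naxn.
have -> : lnS (n - a * x) - lnS n = ln (1 - grid n x + a%:R / n.+1%:R).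
  rewrite /lnS -ln_div ?posrE//; congr ln; rewrite -subSn// natrB ?natrM ?leqW// /grid.
  by rewrite -[x.+1%:R]natr1; field.
have -> : lnS x - lnS n = ln (grid n x) - ln a%:R.
  by rewrite /lnS /grid -mulrA lnM ?posrE ?divr_gt0// addrAC subrr add0r ln_div ?posrE.
have xe : eta / a%:R * n.+1%:R <= x.+1%:R.
  by move: xeta; rewrite ler_pdivlMr// mulrAC ler_pdivrMr// (mulrC x.+1%:R).
move=> wx /(_ xe); move: wx; rewrite /conv_exponent; set t := ln (1 - _ + _); rewrite !ler_norml.
by move=> /andP[? ?] /andP[? ?]; apply/andP; split; lra.
Qed.

Lemma ln_kernel_approx q eta eps : 0 < eta -> 0 < eps ->
  \forall n \near \oo, forall x z, eta <= grid n x <= 1 - eta -> eta <= z <= 1 - eta ->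
    `|z - grid n x| <= a%:R * q%:R / n.+1%:R ->
    `|sg * ln z + bt * ln (1 - z) - conv_exponent n x| <= eps.
Proof.
move=> eta0 eps0; have eps20 : 0 < eps / 2 by rewrite divr_gt0.
pose C := (`|sg| * (a%:R * q%:R) + `|bt| * (a%:R * q%:R + a%:R)) / eta.
near=> n => x z xI /andP[zeta zeta'] zx; have /andP[xeta xeta'] := xI.
have Cn : C / n.+1%:R <= eps / 2.
  rewrite ler_pdivrMr// mulrC -ler_pdivrMr// (@le_trans _ _ n%:R) ?ler_nat//.
  by near: n; exact: nbhs_infty_ger.
have an0 : 0 <= a%:R / n.+1%:R :> R by rewrite divr_ge0// ltW.
set t := 1 - grid n x + a%:R / n.+1%:R.
have sgz : `|sg * ln z - sg * ln (grid n x)| <= `|sg| * (a%:R * q%:R / n.+1%:R / eta).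
  rewrite -mulrBr normrM ler_wpM2l// (le_trans (ln_lipschitz eta0 zeta xeta))//.
  by rewrite ler_wpM2r// invr_ge0 ltW.
have btz : `|bt * ln (1 - z) - bt * ln t| <= `|bt| * ((a%:R * q%:R + a%:R) / n.+1%:R / eta).
  rewrite -mulrBr normrM ler_wpM2l//.
  apply: (le_trans (ln_lipschitz eta0 _ _)); [lra|by rewrite /t -[eta]addr0 lerD//; lra|].
  rewrite ler_wpM2r ?invr_ge0 ?(ltW eta0)// mulrDl.
  have -> : 1 - z - t = - ((z - grid n x) + a%:R / n.+1%:R) by rewrite /t; ring.
  by rewrite normrN (le_trans (ler_normD _ _))// (ger0_norm an0) lerD2r.
have psi : `|sg * ln (grid n x) + bt * ln t - conv_exponent n x| <= eps / 2.
  by rewrite /t; move: x xI {zx xeta xeta' t sgz btz}; near: n; exact: conv_exponent_approx.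
have sum_le : `|sg| * (a%:R * q%:R / n.+1%:R / eta) +
    `|bt| * ((a%:R * q%:R + a%:R) / n.+1%:R / eta) <= eps / 2.
  apply: le_trans Cn; rewrite le_eqVlt; apply/orP; left; apply/eqP.
  by rewrite /C; field; rewrite !lt0r_neq0.
move: sgz btz psi sum_le; set A := _ * (_ / eta); set B := _ * (_ / eta).
rewrite !ler_norml => /andP[? ?] /andP[? ?] /andP[? ?] ?; apply/andP; split; lra.
Unshelve. all: by end_near. Qed.

Definition block_mass n y x : R := beta_mass sg bt (grid n y) (grid n x).

Definition block_mean q n y : R := block_mass n y (y + q) / (a%:R * q%:R / n.+1%:R).

Lemma block_mean_approx q eta eps : (0 < q)%N -> 0 < eta -> 0 < eps ->
  \forall n \near \oo, forall y x, (y <= x < y + q)%N ->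
    eta <= grid n y -> grid n (y + q) <= 1 - eta ->
    expR (- eps) * block_mean q n y <= expR (conv_exponent n x) <= expR eps * block_mean q n y.
Proof.
move=> q0 eta0 eps0; apply: filterS (ln_kernel_approx q eta0 eps0) => n psi y x /andP[yx xq] ey yqe.
have yx' := le_grid n yx; have xq' := le_grid n (ltnW xq).
have l0 : 0 < a%:R * q%:R / n.+1%:R :> R by rewrite divr_gt0// mulr_gt0// ltr0n.
have lE : grid n (y + q) - grid n y = a%:R * q%:R / n.+1%:R by rewrite gridD addrAC subrr add0r.
have xI : eta <= grid n x <= 1 - eta by rewrite (le_trans ey)// (le_trans xq').
have kernel_approx z : grid n y <= z <= grid n (y + q) ->
    expR (conv_exponent n x - eps) <= beta_kernel sg bt z <= expR (conv_exponent n x + eps).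
  move=> /andP[yz zq]; have zI : eta <= z <= 1 - eta by rewrite (le_trans ey)// (le_trans zq).
  have z01 : 0 < z < 1 by case/andP: zI => ? ?; apply/andP; split; lra.
  have zx : `|z - grid n x| <= a%:R * q%:R / n.+1%:R.
    by rewrite -lE ler_norml; apply/andP; split; lra.
  have := psi x z xI zI zx; rewrite beta_kernelE// !ler_expR ler_norml => /andP[? ?].
  by apply/andP; split; lra.
have y0 : 0 < grid n y by exact: lt_le_trans ey.
have yq1 : grid n (y + q) < 1 by rewrite (le_lt_trans yqe)// ltrBlDr ltrDl.
have := beta_mass_bounds y0 (le_trans yx' xq') yq1 kernel_approx.
rewrite lE => /andP[]; rewrite -ler_pdivlMr// -/(block_mean q n y) expRD => lo.
rewrite -ler_pdivrMr// -/(block_mean q n y) expRD => up.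
apply/andP; split; first by rewrite mulrC expRN ler_pdivrMr ?expR_gt0.
by rewrite mulrC -ler_pdivrMr ?expR_gt0// -expRN.
Qed.

Variables (u : nat -> R) (g : nat) (c : R).
Hypotheses (g0 : (0 < g)%N) (c0 : 0 <= c).
Hypothesis u_asymp : u m / expR (w m) - c * (g %| m)%N%:R @[m --> \oo] --> 0.

Local Notation q := (g %/ gcdn a g)%N.
Local Notation chi n := ((gcdn a g %| n)%N%:R : R).

Let q0 : (0 < q)%N.
Proof. by rewrite divn_gt0 ?gcdn_gt0 ?a0// dvdn_leq// dvdn_gcdr. Qed.

Definition riemann_term n x : R :=
  expR (conv_exponent n x) * (u (n - a * x)%N / expR (w (n - a * x)%N)).

Lemma riemann_block eta eps : 0 < eta -> 0 < eps ->
  \forall n \near \oo, forall y, eta <= grid n y -> grid n (y + q) <= 1 - eta ->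
    `|\sum_(y <= x < y + q) riemann_term n x - chi n * c * block_mean q n y| <=
      eps * q%:R * block_mean q n y.
Proof.
move=> eta0 eps0; have c1 : 0 < 2 * (1 + c) by have := c0; lra.
pose e := Num.min 2^-1 (eps / (2 * (1 + c))).
have e0 : 0 < e by rewrite lt_min invr_gt0 ltr0n divr_gt0.
have e_half : 0 <= e <= 2^-1 by rewrite ltW//= ge_min lexx.
have e_eps : 2 * (1 + c) * e <= eps by rewrite mulrC -ler_pdivlMr// ge_min lexx orbT.
have u_near : \forall m \near \oo, `|u m / expR (w m) - c * (g %| m)%N%:R| <= e.
  by move/cvgr0Pnorm_le : u_asymp; exact.
apply: filterS2 (block_mean_approx q0 eta0 e0) (near_ge_proportion eta0 u_near).
move=> n mean_approx u_approx y ey yqe.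
have D0 : 0 <= block_mean q n y.
  by rewrite divr_ge0 ?beta_mass_ge0// divr_ge0// mulr_ge0.
have axw x : (y <= x < y + q)%N -> (a * x <= n)%N /\ eta * n.+1%:R <= (n - a * x).+1%:R.
  move=> /andP[_ xq]; apply: grid_window eta0 (le_trans _ yqe).
  by apply: le_grid; exact: ltnW.
have -> : chi n * c * block_mean q n y =
    \sum_(y <= x < y + q) c * (g %| n - a * x)%N%:R * block_mean q n y.
  rewrite -mulr_suml -mulr_sumr -natr_sum sum_dvdn_window ?[chi n * c]mulrC//.
  have last_window : (y <= (y + q).-1 < y + q)%N.
    by rewrite -(ltnS y) !prednK ?addn_gt0 ?q0 ?orbT//= leqnn andbT -addn1 leq_add2l.
  have [ax _] := axw _ last_window.
  by rewrite -(leq_add2r a) -mulnSr prednK// addn_gt0 q0 orbT in ax.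
rewrite -sumrB (le_trans (ler_norm_sum _ _ _))//.
have -> : eps * q%:R * block_mean q n y = \sum_(y <= x < y + q) eps * block_mean q n y.
  by rewrite sumr_const_nat addKn -mulr_natl; ring.
rewrite big_nat_cond [leRHS]big_nat_cond; apply: ler_sum => x /andP[yxq _].
have [_ naxn] := axw x yxq.
apply: le_trans (ler_wpM2r D0 e_eps); apply: approx_mul_le => //; last exact: u_approx.
  by case: (_ %| _)%N; rewrite ?lexx ?ler01.
have /andP[lo up] := mean_approx y x yxq ey yqe.
have up' := ler_wpM2r D0 (expR_le1D2x e_half).
have lo' := ler_wpM2r D0 (expR_ge1Dx (- e)).
have eD : 0 <= e * block_mean q n y by rewrite mulr_ge0// ltW.
rewrite ler_norml; apply/andP; split; lra.
Qed.

Lemma riemann_sum_approx eta eps : 0 < eta -> 0 < eps ->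
  \forall n \near \oo, forall X J, eta <= grid n X -> grid n (X + q * J) <= 1 - eta ->
    `|\sum_(X <= x < X + q * J) riemann_term n x -
      chi n * c / q%:R * (n.+1%:R / a%:R * block_mass n X (X + q * J))| <=
    eps * (n.+1%:R / a%:R * block_mass n X (X + q * J)).
Proof.
move=> eta0 eps0; apply: filterS (riemann_block eta0 eps0) => n block X J eX.
have X0 : 0 < grid n X by exact: lt_le_trans eX.
elim: J => [|J IH]; rewrite ?muln0 ?addn0.
  move=> Xe; rewrite big_geq// /block_mass beta_mass_diag ?mulr0 ?subrr ?normr0//.
  by rewrite (le_lt_trans Xe)// ltrBlDr ltrDl.
rewrite mulnSr addnA; set Y := (X + q * J)%N in IH * => Yqe.
have XY : (X <= Y)%N by exact: leq_addr.
have YYq : (Y <= Y + q)%N by exact: leq_addr.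
have Ye : grid n Y <= 1 - eta by exact: le_trans (le_grid n YYq) Yqe.
have Yq1 : grid n (Y + q) < 1 by rewrite (le_lt_trans Yqe)// ltrBlDr ltrDl.
have blockE : n.+1%:R / a%:R * block_mass n Y (Y + q) = q%:R * block_mean q n Y.
  by rewrite /block_mean; field; rewrite !lt0r_neq0 ?ltr0n.
have -> : n.+1%:R / a%:R * block_mass n X (Y + q) =
    n.+1%:R / a%:R * block_mass n X Y + q%:R * block_mean q n Y.
  by rewrite -blockE -mulrDr -(beta_massD _ _ X0 (le_grid n XY) (le_grid n YYq) Yq1).
have qR : q%:R != 0 :> R by rewrite pnatr_eq0 -lt0n.
rewrite (big_cat_nat _ (n := Y))//= !mulrDr [_ / q%:R * (q%:R * _)]mulrA divfK//.
rewrite opprD addrACA (le_trans (ler_normD _ _))// lerD ?IH// mulrA.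
by apply: block => //; exact: le_trans (le_grid n XY).
Qed.

End riemann_sums.

(** * Asymptotics of convolutions *)

Section convolution_pieces.
Variables (R : realType) (sg bt : R) (v w : nat -> R) (a : nat).
Hypotheses (v_regvar : ln_regvar sg v) (w_regvar : ln_regvar bt w) (a0 : (0 < a)%N).
Hypotheses (sg1 : -1 < sg) (bt1 : -1 < bt).
Implicit Types e eta : R.
Local Open Scope classical_set_scope.
Local Open Scope ring_scope.

Let aR : 0 < a%:R :> R. Proof. by rewrite ltr0n. Qed.

Lemma dilated_conv_split (P u : nat -> R) n X Y : (X <= Y)%N -> (a * Y <= n)%N ->
  dilated_conv a P u n = \sum_(0 <= x < X) P x * u (n - a * x)%N +
    \sum_(X <= x < Y) P x * u (n - a * x)%N +
    \sum_(Y <= x < n.+1 | (a * x <= n)%N) P x * u (n - a * x)%N.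
Proof.
move=> XY aYn; have Yn : (Y <= n.+1)%N by rewrite leqW// (leq_trans _ aYn)// leq_pmull.
have below_Y l m : (m <= Y)%N -> \sum_(l <= x < m | (a * x <= n)%N) P x * u (n - a * x)%N =
    \sum_(l <= x < m) P x * u (n - a * x)%N.
  move=> mY; rewrite big_nat_cond [RHS]big_nat_cond; apply: eq_bigl => x; rewrite andbT.
  case: (boolP (l <= x < m)%N) => //= /andP[_ xm].
  by rewrite (leq_trans _ aYn)// leq_mul2l ltnW ?orbT// (leq_trans xm).
rewrite /dilated_conv -(big_mkord (fun x => a * x <= n)%N (fun x => P x * u (n - a * x)%N)).
rewrite (big_cat_nat _ (n := Y))//= (big_cat_nat _ (n := X) (p := Y))//=.
by rewrite (below_Y 0%N X)// (below_Y X Y).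
Qed.

Lemma expR_ln_small (s K e : R) : 0 < s -> 0 < K -> 0 < e ->
  exists2 d : R, 0 < d & forall x : R, 0 < x <= d -> K * expR (s * ln x) <= e.
Proof.
move=> s0 K0 e0; exists (expR (ln (e / K) / s)); first exact: expR_gt0.
move=> x /andP[x0 xd]; have eK : 0 < e / K by rewrite divr_gt0.
rewrite mulrC -ler_pdivlMr// -[leRHS]lnK ?posrE// ler_expR mulrC -ler_pdivlMr//.
by rewrite -[leRHS]expRK ler_ln ?posrE ?expR_gt0.
Qed.

Lemma sum_riemann_term (u : nat -> R) n X Y :
  \sum_(X <= x < Y) riemann_term sg v w a u n x =
  a%:R `^ sg / (expR (v n) * expR (w n)) * \sum_(X <= x < Y) expR (v x) * u (n - a * x)%N.
Proof.
rewrite mulr_sumr; apply: eq_bigr => x _.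
rewrite /riemann_term /conv_exponent /powR gt_eqF// !expRD !expRN.
by field; rewrite !lt0r_neq0 ?expR_gt0.
Qed.

Variables (u : nat -> R) (Ku : R).
Hypothesis u_bound : forall m, `|u m| <= Ku * expR (w m).

Let Ku0 : 0 <= Ku.
Proof. by rewrite -(pmulr_lge0 _ (expR_gt0 (w 0%N))); exact: le_trans (u_bound 0). Qed.

Let term_bound n x : `|expR (v x) * u (n - a * x)%N| <= Ku * (expR (v x) * expR (w (n - a * x)%N)).
Proof. by rewrite normrM ger0_norm ?expR_ge0// mulrCA ler_wpM2l ?expR_ge0. Qed.

Let scaled_le (K e t : R) n : 0 <= K -> (Ku + 1) * K * expR t <= e ->
  Ku * (K * conv_scale v w n * expR t) <= e * conv_scale v w n.
Proof.
move=> K0 small; have S0 := conv_scale_gt0 v w n.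
rewrite (_ : Ku * _ = Ku * K * expR t * conv_scale v w n); last ring.
rewrite ler_pM2r//; apply: le_trans small; rewrite ler_pM2r ?expR_gt0//.
by rewrite ler_wpM2r// lerDl.
Qed.

Lemma conv_head_small e : 0 < e -> exists2 eta, 0 < eta & forall n X, grid R a n X <= eta ->
  `|\sum_(0 <= x < X) expR (v x) * u (n - a * x)%N| <= e * conv_scale v w n.
Proof.
move=> e0; have [s [K [s0 K0 head_le]]] := conv_head_bound v_regvar w_regvar sg1 a0.
have KuK0 : 0 < (Ku + 1) * K by rewrite mulr_gt0// ltr_wpDl.
have [d d0 small_le] := expR_ln_small s0 KuK0 e0.
exists (Num.min d 2^-1); first by rewrite lt_min d0 invr_gt0 ltr0n.
move=> n X; rewrite le_min => /andP[Xd X2].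
have [->|X0] := posnP X.
  by rewrite big_geq// normr0 mulr_ge0 ?ltW ?conv_scale_gt0.
rewrite -(prednK X0); set k := X.-1.
have kn : (2 * a * k <= n)%N.
  move: X2; rewrite /grid ler_pdivrMr// [leRHS]mulrC ler_pdivlMr// -!natrM ler_nat.
  by rewrite -(prednK X0) -/k; move: a0; clear; nia.
have kd : 0 < (k.+1%:R / n.+1%:R : R) <= d.
  rewrite divr_gt0//= (le_trans _ Xd)// ler_wpM2r// -natrM ler_nat prednK//.
  by rewrite (leq_trans (leqnSn _))// leq_pmull.
rewrite (le_trans (ler_norm_sum _ _ _))//.
apply: (@le_trans _ _ (Ku * \sum_(x < k.+1) expR (v x) * expR (w (n - a * x)%N))).
  by rewrite big_mkord mulr_sumr; apply: ler_sum => x _; exact: term_bound.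
apply: (le_trans (ler_wpM2l Ku0 (head_le n k kn))); apply: scaled_le => //; first exact: ltW.
by have := small_le _ kd; rewrite ln_div ?posrE.
Qed.

Lemma conv_tail_small e : 0 < e -> exists2 eta, 0 < eta &
  \forall n \near \oo, forall Y, 1 - eta <= grid R a n Y -> (a * Y <= n)%N ->
    `|\sum_(Y <= x < n.+1 | (a * x <= n)%N) expR (v x) * u (n - a * x)%N| <=
      e * conv_scale v w n.
Proof.
move=> e0; have [s [K [s0 K0 tail_le]]] := conv_tail_bound v_regvar w_regvar bt1 a0.
have KuK0 : 0 < (Ku + 1) * K by rewrite mulr_gt0// ltr_wpDl.
have [d d0 small_le] := expR_ln_small s0 KuK0 e0.
have [eta [eta0 etad eta4]] : exists eta, [/\ 0 < eta, eta <= d / 2 & eta <= 4^-1].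
  exists (Num.min (d / 2) 4^-1); split; rewrite ?ge_min ?lexx ?orbT//.
  by rewrite lt_min divr_gt0//= invr_gt0.
exists eta => //; near=> n => Y Yeta aYn.
have an : a%:R / n.+1%:R <= eta.
  rewrite ler_pdivrMr// mulrC -ler_pdivrMr// (@le_trans _ _ n%:R) ?ler_nat//.
  by near: n; exact: nbhs_infty_ger.
have gridE : grid R a n Y = a%:R * Y%:R / n.+1%:R + a%:R / n.+1%:R.
  by rewrite /grid -[Y.+1%:R]natr1 mulrDr mulr1 mulrDl.
have aY : 1 - 2 * eta <= a%:R * Y%:R / n.+1%:R.
  move: Yeta; rewrite gridE; move: (_ / _) (_ / _) an => x y; lra.
have half_n : (n <= 2 * a * Y)%N.
  have : 2^-1 <= a%:R * Y%:R / n.+1%:R :> R by apply: le_trans aY; lra.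
  rewrite ler_pdivlMr// mulrC ler_pdivrMr// -!natrM ler_nat.
  by rewrite -mulnA; move: (a * Y)%N; clear; lia.
set j := (n - a * Y)%N.
have jd : 0 < (j.+1%:R / n.+1%:R : R) <= d.
  rewrite divr_gt0//= /j -subSn// natrB ?leqW// natrM mulrBl divff ?pnatr_eq0//.
  by rewrite lerBlDr -lerBlDl; apply: le_trans aY; lra.
rewrite (le_trans (ler_norm_sum _ _ _))//.
apply: (@le_trans _ _ (Ku * (K * conv_scale v w n * expR (s * (lnS j - lnS n))))).
  apply: le_trans (ler_wpM2l Ku0 (tail_le n j (leq_subr _ _))).
  rewrite -(big_mkord (fun x => [&& a * x <= n, n <= 2 * a * x & n - a * x <= j]%N)
    (fun x => expR (v x) * expR (w (n - a * x)%N))).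
  have Yn1 : (Y <= n.+1)%N by rewrite leqW// (leq_trans _ aYn)// leq_pmull.
  rewrite [X in _ <= _ * X](big_cat_nat _ (n := Y))//= mulrDr -[leLHS]add0r lerD//.
    by rewrite mulr_ge0 ?sumr_ge0// => x _; rewrite mulr_ge0 ?expR_ge0.
  rewrite mulr_sumr big_nat_cond [leRHS]big_nat_cond.
  rewrite [leRHS](eq_bigl (fun x => (Y <= x < n.+1) && (a * x <= n)))%N.
    by apply: ler_sum => x _; exact: term_bound.
  move=> x; case: (boolP (Y <= x < n.+1)%N) => //= /andP[Yx _]; case: (_ <= n)%N => //=.
  by rewrite (leq_trans half_n) ?leq_sub2l ?leq_mul2l ?Yx ?orbT.
by apply: scaled_le => //; [exact: ltW|have := small_le _ jd; rewrite ln_div ?posrE].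
Unshelve. all: by end_near. Qed.

Variables (g : nat) (c : R).
Hypotheses (g0 : (0 < g)%N) (c0 : 0 <= c).
Hypothesis u_asymp : u m / expR (w m) - c * (g %| m)%N%:R @[m --> \oo] --> 0.

Local Notation q := (g %/ gcdn a g)%N.
Local Notation chi n := ((gcdn a g %| n)%N%:R : R).
Local Notation kappa := (a%:R `^ (- (sg + 1)) : R).

Let q0 : (0 < q)%N.
Proof. by rewrite divn_gt0 ?gcdn_gt0 ?a0// dvdn_leq// dvdn_gcdr. Qed.

Let kappa0 : 0 < kappa. Proof. exact: powR_gt0. Qed.

Lemma conv_middle_approx eta eps : 0 < eta -> 0 < eps ->
  \forall n \near \oo, forall X J, eta <= grid R a n X -> grid R a n (X + q * J) <= 1 - eta ->
    `|\sum_(X <= x < X + q * J) expR (v x) * u (n - a * x)%N / conv_scale v w n -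
      chi n * c / q%:R * kappa * block_mass sg bt a n X (X + q * J)| <=
    eps * kappa * block_mass sg bt a n X (X + q * J).
Proof.
move=> eta0 eps0.
have := riemann_sum_approx v_regvar w_regvar a0 g0 c0 u_asymp eta0 eps0.
apply: filterS => n approx X J eX Xe; have := approx X J eX Xe; rewrite sum_riemann_term -mulr_suml.
set S := \sum_(_ <= _ < _) _; set mass := block_mass _ _ _ _ _ _.
have kappaE : kappa = (a%:R `^ sg * a%:R)^-1.
  rewrite powRN; congr (_^-1); rewrite -[X in _ = _ * X](powRr1 (ltW aR)) -powRD//.
  by rewrite (gt_eqF aR) implybT.
have P0 : 0 < a%:R `^ sg :> R by exact: powR_gt0.
have qR : 0 < q%:R :> R by rewrite ltr0n.
have [v0 w0] := (expR_gt0 (v n), expR_gt0 (w n)).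
move: P0 qR v0 w0; rewrite kappaE /conv_scale.
move: (_ `^ _) (expR (v n)) (expR (w n)) q%:R => P ev ew r P0 r0 ev0 ew0 {}approx.
have -> : S / (n.+1%:R * ev * ew) - chi n * c / r / (P * a%:R) * mass =
    (P / (ev * ew) * S - chi n * c / r * (n.+1%:R / a%:R * mass)) / (n.+1%:R * P).
  by field; rewrite !lt0r_neq0.
have nP0 : 0 < n.+1%:R * P by rewrite mulr_gt0.
rewrite normrM normfV (gtr0_norm nP0) ler_pdivrMr// (le_trans approx)//.
by rewrite le_eqVlt; apply/orP; left; apply/eqP; field; rewrite !lt0r_neq0.
Qed.

End convolution_pieces.

Lemma pieces_dist_le (R : realFieldType) (H S T M B s kappa c r chi e : R) :
  0 < s -> 0 < kappa -> 0 < B -> 0 <= c -> 1 <= r -> 0 <= chi <= 1 -> 0 <= e ->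
  M <= B -> B - e / (kappa * (c + 1)) <= M ->
  `|H| <= e * s -> `|T| <= e * s ->
  `|S / s - chi * c / r * kappa * M| <= e / (kappa * B) * kappa * M ->
  `|(H + S + T) / s - c / r * kappa * B * chi| <= 4 * e.
Proof.
move=> s0 kappa0 B0 c0 r1 /andP[chi0 chi1] e0 MB BM head_le tail_le middle_le.
have r0 : 0 < r by exact: lt_le_trans ltr01 r1.
have k0 : 0 <= chi * c / r * kappa.
  by apply: mulr_ge0 (ltW kappa0); apply: divr_ge0 (ltW r0); exact: mulr_ge0.
have k_le : chi * c / r * kappa <= kappa * c.
  by rewrite mulrC ler_pM2l// ler_pdivrMr// [leLHS]mulrC ler_wpM2l// (le_trans chi1).
have c1 : 0 < c + 1 by rewrite ltr_wpDl.
have middle_e : `|S / s - chi * c / r * kappa * M| <= e.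
  apply: (le_trans middle_le); rewrite (_ : _ * M = e * (M / B)).
    by rewrite ler_piMr// ler_pdivrMr ?mul1r.
  by field; rewrite !lt0r_neq0.
have defect : `|chi * c / r * kappa * (M - B)| <= e.
  apply: (@le_trans _ _ (kappa * c * (e / (kappa * (c + 1))))).
    by rewrite normrM (ger0_norm k0) ler_pM// ler_norml; apply/andP; split; lra.
  rewrite (_ : _ * _ = e * (c / (c + 1))); last by field; rewrite !lt0r_neq0.
  by rewrite ler_piMr// ler_pdivrMr// mul1r lerDl.
have scaled X : `|X| <= e * s -> `|X / s| <= e.
  by rewrite normrM normfV (gtr0_norm s0) ler_pdivrMr.
have -> : (H + S + T) / s - c / r * kappa * B * chi = H / s + T / s +
    (S / s - chi * c / r * kappa * M) + chi * c / r * kappa * (M - B).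
  by field; rewrite !lt0r_neq0.
move: middle_e defect (scaled _ head_le) (scaled _ tail_le).
set x := S / s - _; set y := _ * (M - B); move: x y (H / s) (T / s) => x y z t.
have := ler_normD z t; have := ler_normD (z + t) x; have := ler_normD (z + t + x) y; lra.
Qed.

Section convolution_limit.
Variables (R : realType) (sg bt : R).
Hypotheses (sg1 : -1 < sg) (bt1 : -1 < bt).
Implicit Types s e eta : R.
Local Open Scope classical_set_scope.
Local Open Scope ring_scope.

(* The Riemann sums of the kernel are bounded by the convolution of its model sequences. *)
Lemma beta_mass_bounded : exists K : R, forall s e, 0 < s -> s <= e -> e < 1 ->
  beta_mass sg bt s e <= K.
Proof.
pose v n := sg * lnS n; pose w n := bt * lnS n.
have v_regvar : ln_regvar sg v by have := ln_regvarZ sg (@ln_regvar_lnS R); rewrite mulr1.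
have w_regvar : ln_regvar bt w by have := ln_regvarZ bt (@ln_regvar_lnS R); rewrite mulr1.
have w_self : expR (w m) / expR (w m) - 1 * (1 %| m)%N%:R @[m --> \oo] --> (0 : R).
  apply: cvg_near_cst; near=> m.
  by rewrite dvd1n mulr1 divff ?subrr// lt0r_neq0// expR_gt0.
have [K K0 conv_le] := dilated_conv_bound v_regvar w_regvar sg1 bt1 (ltn0Sn 0).
exists (2 * K) => s e s0 se e1.
have [eta [eta0 eta4 etas etae]] :
    exists eta, [/\ 0 < eta, eta <= 4^-1, 2 * eta <= s & 2 * eta <= 1 - e].
  exists (Num.min 4^-1 (Num.min (s / 2) ((1 - e) / 2))).
  rewrite !lt_min !divr_gt0 ?subr_gt0// invr_gt0 ltr0n ge_min lexx; split => //.
    by rewrite mulrC -ler_pdivlMr// !ge_min lexx !orbT.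
  by rewrite mulrC -ler_pdivlMr// !ge_min lexx !orbT.
have half0 : 0 < 2^-1 :> R by rewrite invr_gt0.
have etaI : 0 < eta <= 4^-1 by rewrite eta0.
have middle := conv_middle_approx v_regvar w_regvar (ltn0Sn 0) (ltn0Sn 0) ler01 w_self eta0 half0.
have [n _ /(_ n (leqnn n))[[X [J [/andP[Xlo Xhi] /andP[Ylo Yhi]]]]]] :=
  filterI (grid_cover (ltn0Sn 0) (ltn0Sn 0) etaI) middle.
rewrite /= gcdn1 divn1 => /(_ X J Xlo Yhi).
rewrite dvd1n powR1 divr1 !mulr1 mul1r.
set Y := (X + 1 * J)%N in Ylo Yhi *.
set S := \sum_(X <= x < Y) _; set mass := block_mass _ _ _ _ _ _ => approx.
have se_mass : beta_mass sg bt s e <= mass.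
  by apply: beta_mass_le; rewrite ?grid_gt0//; lra.
have [aY _] := grid_window (ltn0Sn 0) eta0 Yhi.
have S_le : S <= K.
  rewrite /S -mulr_suml ler_pdivrMr ?conv_scale_gt0// (le_trans _ (conv_le n))//.
  rewrite (dilated_conv_split (ltn0Sn 0) _ _ (leq_addr (1 * J) X) aY) addrAC lerDr.
  by rewrite addr_ge0// sumr_ge0// => x _; rewrite mulr_ge0 ?expR_ge0.
move: approx; rewrite ler_norml => /andP[approx _]; lra.
Unshelve. all: by end_near. Qed.

Variables (v w : nat -> R) (a : nat).
Hypotheses (v_regvar : ln_regvar sg v) (w_regvar : ln_regvar bt w) (a0 : (0 < a)%N).
Variables (u : nat -> R) (Ku : R) (g : nat) (c : R).
Hypothesis u_bound : forall m, `|u m| <= Ku * expR (w m).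
Hypotheses (g0 : (0 < g)%N) (c0 : 0 <= c).
Hypothesis u_asymp : u m / expR (w m) - c * (g %| m)%N%:R @[m --> \oo] --> 0.

Lemma conv_cutoff (e d : R) : 0 < e -> 0 < d -> exists eta, [/\ 0 < eta <= 4^-1,
  forall n X, grid R a n X <= 2 * eta ->
    `|\sum_(0 <= x < X) expR (v x) * u (n - a * x)%N| <= e * conv_scale v w n,
  \forall n \near \oo, forall Y, 1 - 2 * eta <= grid R a n Y -> (a * Y <= n)%N ->
    `|\sum_(Y <= x < n.+1 | (a * x <= n)%N) expR (v x) * u (n - a * x)%N| <=
      e * conv_scale v w n &
  forall s t, 0 < s <= 2 * eta -> 1 - 2 * eta <= t < 1 ->
    beta_integral sg bt - d <= beta_mass sg bt s t].
Proof.
move=> e0 d0; have [K mass_le] := beta_mass_bounded.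
have [eta1 eta10 head_small] := conv_head_small v_regvar w_regvar a0 sg1 u_bound e0.
have [eta2 eta20 tail_small] := conv_tail_small v_regvar w_regvar a0 bt1 u_bound e0.
have [eta3 eta30 mass_ge] := beta_mass_ge_integral mass_le d0.
have [eta [etaI le_eta1 le_eta2 le_eta3]] :
    exists eta, [/\ 0 < eta <= 4^-1, 2 * eta <= eta1, 2 * eta <= eta2 & 2 * eta <= eta3].
  exists (Num.min 4^-1 (Num.min (eta1 / 2) (Num.min (eta2 / 2) (eta3 / 2)))).
  rewrite !lt_min !divr_gt0// invr_gt0 ltr0n ge_min lexx.
  by split => //; rewrite mulrC -ler_pdivlMr// !ge_min lexx ?orbT.
exists eta; split => //.
- by move=> n X X_eta; exact: head_small (le_trans X_eta le_eta1).
- by apply: filterS tail_small => n tail_n Y Y_eta; apply: tail_n; exact: le_trans (lerB _ _) Y_eta.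
- move=> s t /andP[s0 s_eta] /andP[t_eta t1]; apply: mass_ge.
    by rewrite s0 (le_trans s_eta).
  by rewrite t1 andbT (le_trans _ t_eta)// lerB.
Qed.

Theorem cvg_dilated_conv :
  dilated_conv a (expR \o v) u n / conv_scale v w n -
    c / (g %/ gcdn a g)%:R * a%:R `^ (- (sg + 1)) * beta_integral sg bt *
    (gcdn a g %| n)%N%:R @[n --> \oo] --> 0.
Proof.
have [K mass_le] := beta_mass_bounded.
set q := (g %/ gcdn a g)%N; set kappa := a%:R `^ (- (sg + 1)); set B := beta_integral sg bt.
have q0 : (0 < q)%N by rewrite divn_gt0 ?gcdn_gt0 ?a0// dvdn_leq// dvdn_gcdr.
have kappa0 : 0 < kappa by rewrite powR_gt0// ltr0n.
have B0 : 0 < B := beta_integral_gt0 mass_le.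
apply/cvgr0Pnorm_le => e e0; have {}e0 : 0 < e :> R by [].
have e40 : 0 < e / 4 by rewrite divr_gt0.
have d0 : 0 < e / 4 / (kappa * (c + 1)) by rewrite divr_gt0// mulr_gt0// ltr_wpDl.
have eps0 : 0 < e / 4 / (kappa * B) by rewrite divr_gt0// mulr_gt0.
have [eta [etaI head_small tail_small mass_ge]] := conv_cutoff e40 d0.
have /andP[eta0 _] := etaI.
have middle := conv_middle_approx v_regvar w_regvar a0 g0 c0 u_asymp eta0 eps0.
near=> n.
have [X [J [/andP[Xlo Xhi] /andP[Ylo Yhi]]]] :
    exists X J, eta <= grid R a n X <= 2 * eta /\
      1 - 2 * eta <= grid R a n (X + q * J) <= 1 - eta.
  by near: n; exact: grid_cover.
have [aY _] := grid_window a0 eta0 Yhi.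
rewrite (dilated_conv_split a0 _ _ (leq_addr (q * J) X) aY).
have S0 := conv_scale_gt0 v w n.
have head_le := head_small n X Xhi.
have tail_n : forall Y, 1 - 2 * eta <= grid R a n Y -> (a * Y <= n)%N ->
    `|\sum_(Y <= x < n.+1 | (a * x <= n)%N) expR (v x) * u (n - a * x)%N| <=
      e / 4 * conv_scale v w n by near: n.
have tail_le := tail_n _ Ylo aY.
have middle_n : forall X J, eta <= grid R a n X -> grid R a n (X + q * J) <= 1 - eta ->
    `|\sum_(X <= x < X + q * J) expR (v x) * u (n - a * x)%N / conv_scale v w n -
      (gcdn a g %| n)%N%:R * c / q%:R * kappa * block_mass sg bt a n X (X + q * J)| <=
    e / 4 / (kappa * B) * kappa * block_mass sg bt a n X (X + q * J) by near: n.
have := middle_n X J Xlo Yhi; rewrite -mulr_suml; set chi := (_ %| n)%N%:R.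
have Xgt0 : 0 < grid R a n X := grid_gt0 R a0 n X.
have Ylt1 : grid R a n (X + q * J) < 1 by rewrite (le_lt_trans Yhi)// ltrBlDr ltrDl.
have XY : grid R a n X <= grid R a n (X + q * J) := le_grid R a n (leq_addr _ _).
have : B - e / 4 / (kappa * (c + 1)) <= block_mass sg bt a n X (X + q * J).
  by apply: mass_ge; rewrite ?Xgt0// Ylo.
have : block_mass sg bt a n X (X + q * J) <= B := beta_mass_le_integral mass_le Xgt0 XY Ylt1.
move=> MB BM middle_le; rewrite (_ : e = 4 * (e / 4)); last by field.
apply: (pieces_dist_le S0 _ _ c0 _ _ _ MB BM head_le tail_le middle_le) => //; rewrite ?ler1n//.
  by rewrite /chi; case: (_ %| n)%N; rewrite ?lexx ?ler01.
exact: ltW.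
Unshelve. all: by end_near. Qed.

End convolution_limit.

(** * Iterated convolutions *)

Fixpoint iter_conv (R : realType) (p : nat -> R) (cs : seq nat) (m : nat) : R :=
  if cs is a :: cs' then dilated_conv a p (iter_conv p cs') m else (m == 0%N)%:R.

Lemma coef_prod_iter_conv (R : realType) (p : nat -> R) (N : nat) (cs : seq nat) (m : nat) :
  all (ltn 0) cs -> (m <= N)%N ->
  (\prod_(a <- cs) \sum_(x < N.+1) p x *: 'X^(a * x))`_m = iter_conv p cs m.
Proof.
elim: cs m => [|a cs IH] m; first by rewrite big_nil coef1.
move=> /= /andP[a0 cs0] mN; rewrite /dilated_conv big_cons mulr_suml coef_sum.
rewrite (big_ord_widen_cond N.+1 (fun x => a * x <= m)%N
  (fun x => p x * iter_conv p cs (m - a * x)))//.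
rewrite [RHS]big_mkcond/=; apply: eq_bigr => x _.
rewrite -scalerAl coefZ coefXnM ltnNge; case: (leqP (a * x)%N m) => ax /=; last by rewrite mulr0.
rewrite ltnS (leq_trans _ ax) ?leq_pmull// IH//.
by rewrite (leq_trans (leq_subr _ _)).
Qed.

Lemma rep_mass_iter_conv (R : realType) (p : nat -> R) (J : finType) (N : nat)
    (I : {set J}) (c : J -> nat) (m : nat) :
  {in I, forall i, (0 < c i)%N} -> (m <= N)%N ->
  rep_mass p N I c m = iter_conv p [seq c i | i <- enum I] m.
Proof.
move=> c_gt0 mN; rewrite -(@coef_prod_iter_conv _ _ N)//; last first.
  by apply/allP => _ /mapP[i iI ->]; apply: c_gt0; rewrite -mem_enum.
rewrite big_map big_enum/= (big_distr_big_dep ord0)/= coef_sum.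
rewrite /rep_mass [LHS]big_mkcond [RHS]big_mkcond/=; apply: eq_bigr => k _.
rewrite inE; have -> : (k \in pfamily ord0 (mem I) (fun=> xpredT)) =
    [forall i, (i \notin I) ==> (k i == ord0)].
  apply/pfamilyP/forallP => [[/fintype.subsetP supp_I _] i|off_I].
    by apply/implyP => iI; apply/negPn; apply: contra iI => k0; exact: (supp_I i).
  split => //; apply/fintype.subsetP => i; rewrite inE => k0.
  by apply/negPn/negP => iI; move: (off_I i); rewrite iI (negbTE k0).
rewrite scaler_prod prodrXr.
case: (boolP [forall i, _]) => //= _; case: eqVneq => [<-|km].
  by rewrite coefZ coefXn eqxx mulr1.
by rewrite coefZ coefXn eq_sym (negbTE km) mulr0.
Qed.

Section iterated_convolution.
Variable R : realType.
Implicit Types (sg : R) (v p : nat -> R) (cs : seq nat).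
Local Open Scope classical_set_scope.
Local Open Scope ring_scope.

(* Logarithm of (n+1)^(l-1) e^(l v n), the order of an l-fold convolution of e^v. *)
Definition conv_order l v n : R := (l%:R - 1) * lnS n + l%:R * v n.

Definition conv_index sg l : R := l%:R * (sg + 1) - 1.

Lemma conv_order1 v n : conv_order 1 v n = v n.
Proof. by rewrite /conv_order subrr mul0r add0r mul1r. Qed.

Lemma ln_regvar_conv_order sg l v : ln_regvar sg v -> ln_regvar (conv_index sg l) (conv_order l v).
Proof.
move=> v_regvar.
have := ln_regvarD (ln_regvarZ (l%:R - 1) (@ln_regvar_lnS R)) (ln_regvarZ l%:R v_regvar).
by rewrite (_ : _ + _ = conv_index sg l)//; rewrite /conv_index; ring.
Qed.

Lemma conv_index_gtN1 sg l : -1 < sg -> (0 < l)%N -> -1 < conv_index sg l.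
Proof.
by move=> sg1 l0; rewrite /conv_index ltrBrDr addNr mulr_gt0 ?ltr0n// -ltrBlDr sub0r.
Qed.

Lemma expR_conv_orderS l v n : expR (conv_order l.+1 v n) = conv_scale v (conv_order l v) n.
Proof.
by rewrite /conv_scale -(expR_lnS R n) -!expRD /conv_order -[l.+1%:R]natr1; congr expR; ring.
Qed.

Lemma iter_conv1 p a n : (0 < a)%N ->
  iter_conv p [:: a] n = if (a %| n)%N then p (n %/ a)%N else 0.
Proof.
move=> a0; rewrite /= /dilated_conv; case: ifPn => [an|an].
  have xn : (n %/ a < n.+1)%N by rewrite ltnS leq_div.
  rewrite (bigD1 (Ordinal xn))/=; last by rewrite mulnC divnK.
  rewrite mulnC divnK// subnn eqxx mulr1 big1 ?addr0// => x /andP[ax xN].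
  rewrite (_ : (n - a * x == 0)%N = false) ?mulr0//; apply: contraNF xN => E.
  rewrite -val_eqE /= -(eqn_pmul2l a0) [(a * (n %/ a))%N]mulnC divnK// eqn_leq ax /=.
  by rewrite -subn_eq0.
rewrite big1// => x ax; rewrite (_ : (n - a * x == 0)%N = false) ?mulr0//.
apply: contraNF an; rewrite subn_eq0 => nax.
by rewrite (_ : n = a * x)%N ?dvdn_mulr//; apply/eqP; rewrite eqn_leq nax ax.
Qed.

Lemma iter_conv_ge0 p cs n : (forall x, 0 <= p x) -> 0 <= iter_conv p cs n.
Proof.
move=> p0; elim: cs n => [|a cs IH] n /=; first by case: eqP.
by apply: sumr_ge0 => x _; rewrite mulr_ge0.
Qed.

Lemma iter_conv_bound sg v cs : ln_regvar sg v -> -1 < sg -> all (ltn 0) cs -> cs != [::] ->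
  exists2 K : R, 0 < K &
    forall n, iter_conv (expR \o v) cs n <= K * expR (conv_order (size cs) v n).
Proof.
move=> v_regvar sg1; case: cs => // a cs; elim: cs a => [|b cs IH] a /andP[a0 cs0] _.
  have aV : 0 < a%:R^-1 :> R by rewrite invr_gt0 ltr0n.
  have [K K0 v_le] := ln_regvar_proportion_bound v_regvar aV.
  exists K => // n; rewrite iter_conv1// conv_order1.
  case: ifPn => an; last by rewrite mulr_ge0 ?expR_ge0 ?(ltW K0).
  rewrite v_le ?leq_div// mulrC ler_pdivrMr ?ltr0n// -natrM ler_nat.
  by rewrite mulSn divnK// -add1n leq_add2r.
have [K K0 iter_le] := IH b cs0 isT.
have [K' K'0 conv_le] := dilated_conv_bound v_regvar
  (ln_regvar_conv_order (size (b :: cs)) v_regvar) sg1 (conv_index_gtN1 sg1 (ltn0Sn _)) a0.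
exists (K * K'); first exact: mulr_gt0.
move=> n; rewrite [size _]/= expR_conv_orderS -mulrA.
apply: le_trans (ler_wpM2l (ltW K0) (conv_le n)).
rewrite [iter_conv _ _ _]/= /dilated_conv mulr_sumr; apply: ler_sum => x _.
by rewrite mulrCA ler_wpM2l ?expR_ge0//; exact: iter_le.
Qed.

Lemma ln_regvar_divn sg v a : (0 < a)%N -> ln_regvar sg v ->
  (if (a %| n)%N then v (n %/ a)%N - v n + sg * ln a%:R else 0) @[n --> \oo] --> 0.
Proof.
move=> a0 v_regvar; have aR : 0 < a%:R :> R by rewrite ltr0n.
apply/cvgr0Pnorm_le => e e0; have {}e0 : 0 < e :> R by [].
have aV : 0 < a%:R^-1 :> R by rewrite invr_gt0.
have e20 : 0 < e / 2 by rewrite divr_gt0.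
have v_near := v_regvar _ _ aV e20; near=> n.
case: ifPn => an; last by rewrite normr0 ltW.
set m := (n %/ a)%N; have nE : n = (m * a)%N by rewrite divnK.
have ma : n.+1%:R <= m.+1%:R * a%:R :> R by rewrite -natrM ler_nat mulSn -nE -add1n leq_add2r.
have vmn : `|v m - v n - sg * (lnS m - lnS n)| <= e / 2.
  by apply: (near v_near n); rewrite ?leq_div// mulrC ler_pdivrMr.
have ln_near : `|lnS m - lnS n + ln a%:R| <= a%:R / n.+1%:R :> R.
  have -> : lnS m - lnS n + ln a%:R = ln (m.+1%:R * a%:R) - ln n.+1%:R :> R.
    by rewrite lnM ?posrE// /lnS; ring.
  apply: (le_trans (@ln_lipschitz _ _ _ n.+1%:R _ ma _)) => //.
  rewrite ler_wpM2r// ger0_norm ?subr_ge0// -natrM mulSn -nE natrD -[n.+1%:R]natr1.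
  by move: (n%:R : R) (a%:R : R) => x y; lra.
have sg_near : `|sg * (lnS m - lnS n + ln a%:R)| <= e / 2.
  rewrite normrM (le_trans (ler_wpM2l (normr_ge0 _) ln_near))// mulrA ler_pdivrMr//.
  rewrite [leRHS]mulrC -ler_pdivrMr// (@le_trans _ _ n%:R) ?ler_nat//.
  by near: n; exact: nbhs_infty_ger.
rewrite (_ : _ + _ = (v m - v n - sg * (lnS m - lnS n)) + sg * (lnS m - lnS n + ln a%:R)).
  by rewrite (le_trans (ler_normD _ _))// [leRHS]splitr lerD.
by ring.
Unshelve. all: by end_near. Qed.

Definition conv_const sg cs : R :=
  \prod_(c <- cs) c%:R `^ (- (sg + 1)) *
  \prod_(1 <= l < size cs) beta_integral sg (conv_index sg l).

Lemma conv_const_gt0 sg cs : -1 < sg -> all (ltn 0) cs -> 0 < conv_const sg cs.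
Proof.
move=> sg1 /allP cs0; rewrite /conv_const mulr_gt0//.
  by rewrite big_seq prodr_gt0// => c /cs0 c0; rewrite powR_gt0// ltr0n.
rewrite big_nat_cond prodr_gt0// => l /andP[/andP[l1 _] _].
have [K mass_le] := beta_mass_bounded sg1 (conv_index_gtN1 sg1 l1).
exact: beta_integral_gt0 mass_le.
Qed.

Lemma conv_const0 cs : conv_const 0 cs = ((size cs).-1`!%:R * (\prod_(c <- cs) c)%:R)^-1.
Proof.
rewrite /conv_const invfM mulrC; congr (_ * _).
  rewrite fact_prod natr_prod -prodfV/=.
  case: (size cs) => [|k]; first by rewrite !big_geq.
  rewrite big_nat [RHS]big_nat/=; apply: eq_bigr => l /andP[l1 _].
  rewrite /conv_index add0r mulr1 -[l in l%:R - 1]prednK// -natr1 addrK beta_integral_onem prednK//.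
by rewrite natr_prod -prodfV; apply: eq_bigr => c _; rewrite add0r powR_inv1.
Qed.

Lemma cvg_iter_conv1 sg v a : (0 < a)%N -> ln_regvar sg v ->
  iter_conv (expR \o v) [:: a] n / expR (v n) - a%:R `^ (- sg) * (a %| n)%N%:R @[n --> \oo] --> 0.
Proof.
move=> a0 v_regvar; have aR : 0 < a%:R :> R by rewrite ltr0n.
set y := fun n => if (a %| n)%N then v (n %/ a)%N - v n + sg * ln a%:R else 0.
have termE n : iter_conv (expR \o v) [:: a] n / expR (v n) - a%:R `^ (- sg) * (a %| n)%N%:R =
    a%:R `^ (- sg) * (expR (y n) - 1).
  rewrite iter_conv1// /y; case: (a %| n)%N; last by rewrite expR0 mul0r mulr0 !subrr mulr0.
  rewrite /= /powR (gt_eqF aR) mulrBr -expRN -!expRD; congr (expR _ - _).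
  by ring.
under eq_fun do rewrite termE.
have expR_y : expR (y n) @[n --> \oo] --> expR 0.
  by apply: continuous_cvg; [exact: continuous_expR|exact: ln_regvar_divn].
have := cvgM (cvg_cst (a%:R `^ (- sg) : R)) (cvgB expR_y (cvg_cst (1 : R))).
by rewrite expR0 subrr mulr0; apply.
Qed.

Theorem cvg_iter_conv sg v cs : ln_regvar sg v -> -1 < sg -> all (ltn 0) cs -> cs != [::] ->
  iter_conv (expR \o v) cs n / expR (conv_order (size cs) v n) -
    conv_const sg cs * (\big[gcdn/0]_(c <- cs) c)%N%:R * (\big[gcdn/0]_(c <- cs) c %| n)%N%:R
  @[n --> \oo] --> 0.
Proof.
move=> v_regvar sg1; case: cs => // a cs; elim: cs a => [|b cs IH] a /andP[a0 cs0] _.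
  have aR : 0 < a%:R :> R by rewrite ltr0n.
  rewrite /conv_const !big_seq1 [size _]/= big_geq// mulr1.
  under eq_fun do rewrite conv_order1.
  rewrite (_ : _ * a%:R = a%:R `^ (- sg)); first exact: cvg_iter_conv1.
  by rewrite -[X in _ * X](powRr1 (ltW aR)) -powRD ?(gt_eqF aR) ?implybT//; congr (_ `^ _); ring.
set cs' := b :: cs in IH cs0 *; have cs'0 : all (ltn 0) cs' by [].
set g := \big[gcdn/0%N]_(c <- cs') c in IH *.
have g0 : (0 < g)%N by rewrite /g big_cons gcdn_gt0; move: cs0 => /= /andP[->].
have C0 : 0 <= conv_const sg cs' * g%:R by rewrite mulr_ge0// ltW// conv_const_gt0.
have [K _ iter_le_K] := iter_conv_bound v_regvar sg1 cs'0 isT.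
have iter_le m : `|iter_conv (expR \o v) cs' m| <= K * expR (conv_order (size cs') v m).
  by rewrite ger0_norm// iter_conv_ge0// => x; exact: expR_ge0.
have := cvg_dilated_conv sg1 (conv_index_gtN1 sg1 (ltn0Sn (size cs))) v_regvar
  (ln_regvar_conv_order (size cs') v_regvar) a0 iter_le g0 C0 (IH b cs0 isT).
rewrite big_cons -/g; under [in X in _ -> X]eq_fun do rewrite [size _]/= expR_conv_orderS.
suff -> : conv_const sg cs' * g%:R / (g %/ gcdn a g)%:R * a%:R `^ (- (sg + 1)) *
    beta_integral sg (conv_index sg (size cs')) = conv_const sg (a :: cs') * (gcdn a g)%:R by [].
have q0 : (0 < g %/ gcdn a g)%N by rewrite divn_gt0 ?gcdn_gt0 ?a0// dvdn_leq// dvdn_gcdr.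
have {1}<- : ((g %/ gcdn a g) * gcdn a g = g)%N by rewrite divnK// dvdn_gcdr.
rewrite /conv_const [\prod_(c <- a :: _) _]big_cons [size (a :: _)]/= [in RHS]big_nat_recr//= natrM.
by field; rewrite pnatr_eq0 -lt0n.
Qed.

End iterated_convolution.

(** * Concentration *)

(* Compactness of {0,1}^nat, where each condition depends on finitely many coordinates. *)
Lemma local_conditions_compactness (Good : nat -> pred nat -> Prop) :
  (forall n (A B : pred nat), (forall i, (i <= n)%N -> A i = B i) -> Good n A -> Good n B) ->
  (forall N, exists A, forall n, (n <= N)%N -> Good n A) ->
  exists A, forall n, Good n A.
Proof.
move=> loc fin.
pose extendable (s : seq bool) := forall N, exists A : pred nat,
  (forall i, (i < size s)%N -> A i = nth false s i) /\ forall n, (n <= N)%N -> Good n A.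
pose step s := rcons s `[< extendable (rcons s true) >].
have extendable_step s : extendable s -> extendable (step s).
  move=> exts; rewrite /step; case: asboolP => // ntrue; apply: contrapT => nfalse.
  move/existsNP: ntrue => [N1 bad1]; move/existsNP: nfalse => [N2 bad2].
  have [A [As good]] := exts (maxn N1 N2).
  have good1 n : (n <= N1)%N -> Good n A by move=> nN; apply: good; rewrite leq_max nN.
  have good2 n : (n <= N2)%N -> Good n A by move=> nN; apply: good; rewrite leq_max nN orbT.
  case As1 : (A (size s)); [apply: bad1|apply: bad2]; exists A; split => // i;
    rewrite size_rcons nth_rcons ltnS leq_eqVlt;
    by move=> /predU1P[->|si]; rewrite ?ltnn ?eqxx ?As1// si As.
pose s i := iter i step [::].
have size_s i : size (s i) = i by elim: i => //= i IH; rewrite size_rcons IH.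
have extendable_s i : extendable (s i).
  elim: i => [N|i]; last exact: extendable_step.
  by have [A good] := fin N; exists A.
have nth_s i j : (i < j)%N -> nth false (s j) i = nth false (s i.+1) i.
  elim: j => // j IH; rewrite ltnS leq_eqVlt => /predU1P[->//|ij].
  by rewrite -(IH ij) /= nth_rcons size_s ij.
exists (fun i => nth false (s i.+1) i) => n.
have [A [As good]] := extendable_s n.+1 n.
apply: loc (good n (leqnn n)) => i ile.
by rewrite As ?size_s ?ltnS// nth_s.
Qed.

Section vanishing_tolerance.
Variable R : realType.
Local Open Scope classical_set_scope.
Local Open Scope ring_scope.

Lemma diagonal_tolerance (Q : R -> nat -> Prop) (d : R) : 0 < d ->
  (forall e, 0 < e <= d -> \forall n \near \oo, Q e n) ->
  exists2 e : nat -> R, e n @[n --> \oo] --> 0 & \forall n \near \oo, Q (e n) n.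
Proof.
move=> d0 near_Q; pose tol j : R := d / j.+1%:R.
have tolQ j : \forall n \near \oo, Q (tol j) n.
  by apply: near_Q; rewrite divr_gt0//= ler_pdivrMr// ler_peMr ?(ltW d0)// ler1n.
have /choice[N N_Q] : forall j, exists N, forall n, (N <= n)%N -> Q (tol j) n.
  by move=> j; have [N _ N_Q] := tolQ j; exists N.
pose j n := \max_(i < n.+1 | (N i <= n)%N) i.
have N_j n : (N 0 <= n)%N -> (N (j n) <= n)%N.
  move=> Nn; rewrite /j.
  have [|i /= Ni ->//] := @eq_bigmax_cond _ (fun i : 'I_n.+1 => N i <= n)%N (fun i => i : nat).
  by apply/card_gt0P; exists ord0.
exists (tol \o j); last by exists (N 0) => // n; move=> /N_j; exact: N_Q.
apply/cvgr0Pnorm_le => e e0; have {}e0 : 0 < e :> R by [].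
pose k := Num.truncn (d / e); exists (maxn k (N k)) => // n /=; rewrite geq_max => /andP[kn Nkn].
have kj : (k <= j n)%N.
  have kn1 : (k < n.+1)%N by [].
  exact: (@leq_bigmax_cond _ (fun i : 'I_n.+1 => N i <= n)%N (fun i => i : nat) (Ordinal kn1)).
rewrite ger0_norm ?divr_ge0 ?(ltW d0)// ler_pdivrMr// mulrC -ler_pdivrMr//.
by apply: (le_trans (ltW (truncnS_gt _))); rewrite ler_nat.
Qed.

Lemma sum_inv_sqr_le (n N : nat) : (0 < n)%N -> \sum_(n <= m < N) (m.+1%:R ^+ 2)^-1 <= n%:R^-1 :> R.
Proof.
move=> n0; have [Nn|nN] := leqP N n; first by rewrite big_geq.
apply: (@le_trans _ _ (\sum_(n <= m < N) - ((m.+1)%:R^-1 - (m%:R)^-1 : R))).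
  rewrite big_nat_cond [leRHS]big_nat_cond; apply: ler_sum => m /andP[/andP[nm _] _].
  have m0 : 0 < m%:R :> R by rewrite ltr0n (leq_trans n0).
  rewrite -natr1; set x := m%:R in m0 *.
  have x1 : 0 < x + 1 by lra.
  have -> : - ((x + 1)^-1 - x^-1) = (x * (x + 1))^-1 by field; rewrite !lt0r_neq0.
  by rewrite lef_pV2 ?posrE ?exprn_gt0 ?mulr_gt0// expr2 ler_pM2r//; lra.
rewrite sumrN (telescope_sumr (fun m => m%:R^-1)) ?(ltnW nN)//.
by rewrite opprB lerBlDr lerDl invr_ge0 ler0n.
Qed.

End vanishing_tolerance.

Lemma lower_tail_exponent (R : realFieldType) (e d t l x S : R) :
  0 < e -> e <= 3^-1 -> 0 <= d -> 0 <= l -> 0 < x -> 0 < t -> t * (1 + d) = e / 2 ->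
  4 * (1 + d) * (l + 1) <= e ^+ 2 * x -> (1 - e / 4) * x - d <= S ->
  t / (1 - t) * ((1 - 3 * e) * x) - t * (1 - t * d) * S <= - (2 * l).
Proof.
move=> e0 e3 d0 l0 x0 t0 tE growth S_ge.
have td0 : 0 <= t * d by rewrite mulr_ge0// ltW.
have t1 : 0 < 1 - t by lra.
have ee0 : 0 <= e * e by rewrite mulr_ge0 ?(ltW e0).
have d_le : 4 * d <= e * x.
  have : e ^+ 2 * x <= e * x by rewrite ler_wpM2r ?(ltW x0)// expr2 ler_piMl ?(ltW e0)//; lra.
  apply: le_trans; apply: le_trans growth.
  have : 0 <= (1 + d) * l by rewrite mulr_ge0//; lra.
  lra.
have S_ge' : (1 - e / 2) * x <= S by lra.
have td_le : t * d <= e / 2 by lra.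
have main_term : t * ((1 - e) * x) <= t * (1 - t * d) * S.
  rewrite -mulrA ler_wpM2l ?(ltW t0)//.
  have td1 : 0 <= 1 - t * d by lra.
  apply: le_trans (ler_wpM2l td1 S_ge'); rewrite mulrA ler_wpM2r ?(ltW x0)//.
  have e1 : 0 <= 1 - e / 2 by lra.
  have : (1 - e / 2) * (1 - e / 2) <= (1 - t * d) * (1 - e / 2) by rewrite ler_wpM2r//; lra.
  lra.
have loss : t / (1 - t) * ((1 - 3 * e) * x) <= t * ((1 - 2 * e) * x).
  rewrite -mulrA ler_wpM2l ?(ltW t0)// mulrC ler_pdivrMr// mulrAC ler_wpM2r ?(ltW x0)//.
  have : (1 - 2 * e) * (1 - e / 2) <= (1 - 2 * e) * (1 - t) by rewrite ler_wpM2l//; lra.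
  lra.
have gap : 2 * l <= t * (e * x).
  have gapE : t * (e * x) * (2 * (1 + d)) = e ^+ 2 * x.
    have -> : t * (e * x) * (2 * (1 + d)) = t * (1 + d) * (2 * (e * x)) by ring.
    by rewrite tE; field.
  have d1 : 0 < 2 * (1 + d) by lra.
  rewrite -(ler_pM2r d1) gapE; apply: le_trans growth.
  lra.
lra.
Qed.

Section concentration.
Import boot.fintype boot.finset.
Variables (R : realType) (p : nat -> R).
Hypothesis p01 : forall x, 0 <= p x <= 1.
Variables (J : finType) (B L : nat) (W : nat -> R) (C z : R).
Hypothesis W_ge1 : forall m, 1 <= W m.
Hypothesis W_homo : {homo W : m n / (m <= n)%N >-> m <= n}.
Hypotheses (C0 : 0 <= C) (z0 : 0 < z).
Implicit Types (I : {set J}) (c : J -> nat) (A : pred nat) (e D F : R).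

(* The slack (m+1)^-z makes large powers of this bound summable over m. *)
Hypothesis rep_mass_low : forall N I c m, (0 < #|I| <= L)%N -> admissible B I c -> (m <= N)%N ->
  rep_mass p N I c m <= C * W m * expR (- z * lnS m).

Local Notation tuples N I c m M A := (@disjoint_tuples R J N I c m M set0 A).

Let W_gt0 m : 0 < W m. Proof. exact: lt_le_trans (W_ge1 m). Qed.

Definition count_in N A I c m : R := wcount (fun U : {set 'I_N.+1} => (contains A U)%:R) I c m.

Definition low_sparse D N A := forall I c m, (#|I| <= L)%N -> admissible B I c -> (m <= N)%N ->
  count_in N A I c m <= D * W m.

Lemma prob_many_disjoint_tuples N I c m M (y : R) : 0 < y ->
  prob p N.+1 (fun A => y ^+ M <= tuples N I c m M A) <=
    (rep_mass p N I c m / y) ^+ M.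
Proof.
move=> y0; have yM : 0 < y ^+ M by exact: exprn_gt0.
apply: (@le_trans _ _ (mean p N.+1 (fun A => (y ^+ M)^-1 * tuples N I c m M A))).
  apply: prob_le_mean => // A; first by rewrite mulr_ge0 ?disjoint_tuples_ge0// invr_ge0 ltW.
  by rewrite ler_pdivlMl ?mulr1.
by rewrite meanZ// mulrC expr_div_n ler_wpM2r ?invr_ge0 ?(ltW yM)// mean_disjoint_tuples_le.
Qed.

Lemma low_sparse_disjoint_tuples N A (K : R) M : 0 <= K ->
  (forall I (c : {ffun J -> 'I_B.+1}) (m : 'I_N.+1), (0 < #|I| <= L)%N ->
    admissible B I (fun i => c i) ->
    tuples N I (fun i => c i) m M A < (K * W m) ^+ M) ->
  low_sparse (wcount_factor K L (L * M)) N A.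
Proof.
move=> K0 few; apply: wcount_le => //.
- by move=> x U; exact: contains_antitone.
- by case: (contains A _).
move=> I c m IL adm mN; have /andP[_ I_le] := IL.
have [c' cc' adm'] := admissible_ffun adm; have mN1 : (m < N.+1)%N by [].
have := few I c' (Ordinal mN1) IL adm'; rewrite -(eq_disjoint_tuples _ _ _ _ _ cc') /=.
move=> /disjoint_tuples_lt_blocked[|S S_le S_lt]; first by rewrite mulr_ge0// ltW.
by exists S; [rewrite (leq_trans S_le)// leq_mul2r I_le orbT|exact: ltW].
Qed.

Lemma prob_many_disjoint_tuples_low N I c m (K : R) M : 0 < K -> C <= K -> 2 <= z * M.+1%:R ->
  (0 < #|I| <= L)%N -> admissible B I c -> (m <= N)%N ->
  prob p N.+1 (fun A => (K * W m) ^+ M.+1 <= tuples N I c m M.+1 A) <=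
    C / K * (m.+1%:R ^+ 2)^-1.
Proof.
move=> K0 CK zM IL adm mN; have KW0 : 0 < K * W m by rewrite mulr_gt0.
apply: (le_trans (prob_many_disjoint_tuples N I c m M.+1 KW0)).
have CK0 : 0 <= C / K by rewrite divr_ge0// ltW.
apply: (@le_trans _ _ ((C / K * expR (- z * lnS m)) ^+ M.+1)).
  apply: lerXn2r; rewrite ?nnegrE; first by rewrite divr_ge0 ?rep_mass_ge0 ?ltW.
    by rewrite mulr_ge0 ?expR_ge0.
  rewrite ler_pdivrMr// (le_trans (rep_mass_low IL adm mN))//.
  by rewrite le_eqVlt; apply/orP; left; apply/eqP; field; exact: lt0r_neq0.
rewrite exprMn; apply: ler_pM; rewrite ?exprn_ge0 ?expR_ge0//.
  by rewrite exprS ler_piMr// exprn_ile1// ler_pdivrMr// mul1r.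
rewrite -expRM_natl -(expR_lnS R m) -expRM_natl -expRN ler_expR.
by have := ler_wpM2r (lnS_ge0 R m) zM; lra.
Qed.

Lemma prob_not_low_sparse :
  exists2 D, 0 <= D & forall N, prob p N.+1 (fun A => ~ low_sparse D N A) <= 4^-1.
Proof.
pose M := Num.truncn (2 / z).
have zM : 2 <= z * M.+1%:R by rewrite mulrC -ler_pdivrMr// ltW// truncnS_gt.
pose q := #|{: {set J} * {ffun J -> 'I_B.+1}}|.
have [K [K0 CK qCK]] : exists K : R, [/\ 0 < K, C <= K & 8 * q%:R * C <= K].
  exists (8 * q%:R * C + C + 1); have : 0 <= 8 * q%:R * C by rewrite !mulr_ge0.
  by move: (8 * _ * C) => x x0; split; have := C0; lra.
exists (wcount_factor K L (L * M.+1)) => [|N].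
  by rewrite mulr_ge0 ?exprn_ge0 ?addr_ge0 ?(ltW K0).
pose low (x : {set J} * {ffun J -> 'I_B.+1}) :=
  (0 < #|x.1| <= L)%N && admissible B x.1 (fun i => x.2 i).
pose many (x : {set J} * {ffun J -> 'I_B.+1}) m A :=
  (K * W m) ^+ M.+1 <= tuples N x.1 (fun i => x.2 i) m M.+1 A.
have crowded A : ~ low_sparse (wcount_factor K L (L * M.+1)) N A ->
    exists2 x, x \in [seq x <- enum predT | low x] & exists2 m, m \in iota 0 N.+1 & many x m A.
  apply: contra_notP => nmany; apply: low_sparse_disjoint_tuples => [|I c m IL adm].
    exact: ltW.
  rewrite ltNge; apply/negP => many_m; apply: nmany.
  exists (I, c); first by rewrite mem_filter mem_enum /low IL adm.
  by exists (val m); rewrite ?mem_iota ?ltn_ord.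
apply: (le_trans (prob_le p01 _ crowded)).
apply: (le_trans (prob_exists p01 _ _ _)).
apply: (@le_trans _ _ (\sum_(x <- [seq x <- enum predT | low x]) C / K * 2)).
  rewrite big_seq [leRHS]big_seq; apply: ler_sum => -[I c].
  rewrite mem_filter => /andP[/andP[IL adm] _]; apply: (le_trans (prob_exists p01 _ _ _)).
  apply: (@le_trans _ _ (\sum_(m <- iota 0 N.+1) C / K * (m.+1%:R ^+ 2)^-1)).
    rewrite big_seq [leRHS]big_seq; apply: ler_sum => m; rewrite mem_iota ltnS => mN.
    exact: prob_many_disjoint_tuples_low.
  rewrite -mulr_sumr ler_wpM2l ?divr_ge0 ?(ltW K0)// -[iota _ _]/(index_iota 0 N.+1).
  rewrite big_ltn// expr1n invr1.
  by have := @sum_inv_sqr_le R 1 N.+1 isT; rewrite invr1; lra.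
rewrite big_filter big_const_seq iter_addr_0 -[leLHS]mulr_natl.
apply: (@le_trans _ _ (q%:R * (C / K * 2))).
  rewrite ler_wpM2r//; first by rewrite mulr_ge0// divr_ge0// ltW.
  rewrite ler_nat.
  by rewrite (leq_trans (count_size _ _))// -cardE.
rewrite (_ : _ * _ = (8 * q%:R * C / K) / 4); last by field; exact: lt0r_neq0.
by rewrite ler_pdivrMr// mulVf ?pnatr_eq0// ler_pdivrMr ?mul1r.
Qed.

Section tails.
Variables (N n : nat) (I : {set J}) (c : J -> nat).
Hypotheses (I_le : (#|I| <= L.+1)%N) (adm : admissible B I c) (nN : (n <= N)%N).

Let card_rem i : i \in I -> (#|I :\ i| <= L)%N.
Proof. by move=> iI; have := I_le; rewrite (cardsD1 i I) iI. Qed.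

Lemma low_sparse_count_le D A M (y : R) : 0 <= D -> 0 <= y -> low_sparse D N A ->
  tuples N I c n M A < y ^+ M ->
  count_in N A I c n <= y + (#|I| ^ 2 * M.+1)%:R * (D * W n).
Proof.
move=> D0 y0 low /disjoint_tuples_lt_blocked[//|S S_le S_lt].
rewrite /count_in /wcount (bigID (fresh S I))/=; apply: lerD; first exact: ltW.
apply: (@le_trans _ _ ((#|I| * #|S| + #|I| ^ 2)%:R * (D * W n))).
  apply: (@wcount_nonfresh_le _ _ _ (fun U => (contains A U)%:R)) => //.
  - by move=> x U; exact: contains_antitone.
  - move=> i m iI mn; apply: (@le_trans _ _ (D * W m)); last by rewrite ler_wpM2l ?W_homo.
    by apply: low; [exact: card_rem|exact: admissible_rem|exact: leq_trans nN].
  - move=> i j iI jI; apply: low => //; last exact: admissible_merge.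
    by apply: card_rem; case/setD1P: jI.
rewrite ler_wpM2r ?mulr_ge0 ?(ltW (W_gt0 _))// ler_nat mulnS addnC leq_add2l expnS expn1 -mulnA.
by rewrite leq_mul2l S_le orbT.
Qed.

Lemma upper_tail e D F : 0 < e <= 3^-1 -> 0 <= D -> 0 < F ->
  rep_mass p N I c n <= (1 + e / 4) * F ->
  (#|I| ^ 2)%:R * D * (4 / e + 2) / e * W n * (lnS n + 1) <= F ->
  prob p N.+1 (fun A => low_sparse D N A /\ (1 + 2 * e) * F < count_in N A I c n) <=
    (n.+1%:R ^+ 2)^-1.
Proof.
move=> /andP[e0 e3] D0 F0 massF growth; have l0 := lnS_ge0 R n.
pose M := (Num.truncn (4 * lnS n / e)).+1.
have le0 : 0 <= 4 * lnS n / e by rewrite divr_ge0 ?mulr_ge0// ltW.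
have M_ge : 4 * lnS n / e <= M%:R by rewrite ltW// truncnS_gt.
have M_le : M%:R <= 4 * lnS n / e + 1.
  by rewrite /M -natr1 lerD2r; have /andP[] := truncn_itv le0.
pose y := (1 + e) * F; have y0 : 0 < y by rewrite mulr_gt0// addr_gt0.
have defect : (#|I| ^ 2 * M.+1)%:R * (D * W n) <= e * F.
  have q0 : 0 <= (#|I| ^ 2)%:R * D * W n by rewrite !mulr_ge0// ltW.
  apply: le_trans (ler_wpM2l (ltW e0) growth).
  rewrite natrM -natr1 [leLHS](_ : _ = (#|I| ^ 2)%:R * D * W n * (M%:R + 1)); last ring.
  rewrite [leRHS](_ : _ = (#|I| ^ 2)%:R * D * W n * ((4 / e + 2) * (lnS n + 1))); last first.
    by field; exact: lt0r_neq0.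
  rewrite ler_wpM2l//; have : 0 <= 4 / e by rewrite divr_ge0// ltW.
  move: M_le; rewrite [4 * lnS n / e]mulrAC; move: (4 / e) (lnS n) l0 => x l l0 M_le x0.
  by have := mulr_ge0 x0 l0; lra.
have many A : low_sparse D N A /\ (1 + 2 * e) * F < count_in N A I c n ->
    y ^+ M <= tuples N I c n M A.
  move=> [low]; apply: contraTT; rewrite -ltNge -leNgt => few.
  by have := low_sparse_count_le D0 (ltW y0) low few; rewrite /y; lra.
apply: (le_trans (prob_le p01 _ many)); apply: (le_trans (prob_many_disjoint_tuples N I c n M y0)).
have ratio : rep_mass p N I c n / y <= expR (- (e / 2)).
  rewrite ler_pdivrMr// (le_trans massF)// /y mulrA ler_wpM2r ?(ltW F0)//.
  have e1 : 0 <= 1 + e by lra.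
  apply: le_trans (ler_wpM2r e1 (expR_ge1Dx (- (e / 2)))).
  have : 0 <= e * (3^-1 - e) by rewrite mulr_ge0 ?subr_ge0// ltW.
  lra.
apply: (@le_trans _ _ (expR (- (e / 2)) ^+ M)).
  apply: lerXn2r => //; rewrite nnegrE ?expR_ge0//.
  by rewrite divr_ge0 ?rep_mass_ge0// ltW.
rewrite -expRM_natl -(expR_lnS R n) -expRM_natl -expRN ler_expR.
by have := ler_wpM2r (ltW e0) M_ge; rewrite divfK ?lt0r_neq0//; lra.
Qed.

Let d : R := (#|I| ^ 2)%:R * (wcount_factor C L #|I| * W n).

Let low_weight_le (S : {set 'I_N.+1}) I' c' m : (#|S| <= #|I|)%N -> (#|I'| <= L)%N ->
  admissible B I' c' -> (m <= n)%N ->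
  wcount (fun U => weight p (U :\: S)) I' c' m <= wcount_factor C L #|I| * W n.
Proof.
move=> SI I'L adm' mn; apply: (@le_trans _ _ (wcount_factor C L #|I| * W m)).
  apply: (wcount_weight_setD_le p01 C0 W_ge1 W_homo _ SI I'L adm' (leq_trans mn nN)).
  move=> I0 c0 m0 I0L adm0 m0N; apply: (le_trans (rep_mass_low I0L adm0 m0N)).
  rewrite ler_piMr ?mulr_ge0 ?(ltW (W_gt0 _))// expR_le1 mulNr oppr_le0.
  by rewrite mulr_ge0 ?lnS_ge0// ltW.
by rewrite ler_wpM2l ?W_homo// mulr_ge0 ?exprn_ge0// addr_ge0.
Qed.

Let rem_weight_le (S : {set 'I_N.+1}) i m : (#|S| <= #|I|)%N -> i \in I -> (m <= n)%N ->
  wcount (fun U => weight p (U :\: S)) (I :\ i) c m <= wcount_factor C L #|I| * W n.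
Proof.
by move=> SI iI mn; apply: low_weight_le => //; [exact: card_rem|exact: admissible_rem].
Qed.

Lemma hit_weight_le (S : {set 'I_N.+1}) : (#|S| <= #|I|)%N ->
  \sum_(k in reps N I c n | ~~ [disjoint k @: I & S]) weight p (k @: I :\: S) <= d.
Proof.
move=> SI.
apply: (@le_trans _ _ ((#|I| * #|S|)%:R * (wcount_factor C L #|I| * W n))).
  apply: (@wcount_hit_le _ _ _ (fun U => weight p (U :\: S))) => //.
  - by move=> U; exact: weight_ge0.
  - by move=> x U; exact: weight_setD_antitone.
  - by move=> i m; exact: rem_weight_le.
rewrite ler_wpM2r ?mulr_ge0 ?exprn_ge0 ?addr_ge0 ?(ltW (W_gt0 _))// ler_nat.
by rewrite -mulnn leq_mul2l SI orbT.
Qed.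

Lemma inj_weight_ge :
  rep_mass p N I c n - d <= \sum_(k in reps N I c n | inj_on I k) weight p (k @: I).
Proof.
have ninj : \sum_(k in reps N I c n | ~~ inj_on I k) weight p (k @: I) <= d.
  under eq_bigr => k _ do rewrite -[k @: _]setD0.
  apply: (@wcount_ninj_le _ _ _ (fun U => weight p (U :\: set0))) => //.
  - by move=> U; exact: weight_ge0.
  - by move=> x U; exact: weight_setD_antitone.
  - by move=> i m iI mn; apply: rem_weight_le; rewrite ?cards0.
  - move=> i j iI jI; apply: low_weight_le => //; [by rewrite cards0| |exact: admissible_merge].
    by apply: card_rem; case/setD1P: jI.
rewrite lerBlDr; apply: (@le_trans _ _ (\sum_(k in reps N I c n) weight p (k @: I))).
  by apply: ler_sum => k _; exact: prod_le_weight.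
by rewrite (bigID (inj_on I))/= lerD2l.
Qed.

Lemma has_elts (U V : {set 'I_N.+1}) : has (mem (elts U)) (elts V) = ~~ [disjoint V & U].
Proof.
apply/hasP/pred0Pn => [[_ /mapP[x xV ->]]|[x /andP[xV xU]]].
  by rewrite /= mem_elts => xU; exists x; rewrite /= xU -mem_enum xV.
by exists (val x); rewrite /= mem_elts.
Qed.

Lemma prob_count_in_le (t x : R) : 0 < t < 1 ->
  prob p N.+1 (fun A => count_in N A I c n <= x) <=
  expR (t / (1 - t) * x -
    t * (1 - t * d) * \sum_(k in reps N I c n | inj_on I k) weight p (k @: I)).
Proof.
move=> /andP[t0 t1]; pose E := [set k in reps N I c n | inj_on I k].
pose Us := [seq elts (k @: I) | k : {ffun J -> 'I_N.+1} in E].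
have t01 : 0 <= t <= 1 by rewrite !ltW.
have -> : \sum_(k in reps N I c n | inj_on I k) weight p (k @: I) =
    \sum_(U <- Us) \prod_(x <- U) p x.
  rewrite big_map big_enum/= [RHS](eq_bigl (fun k => (k \in reps N I c n) && inj_on I k)).
    by apply: eq_bigr => k _; rewrite prod_elts; apply: eq_bigl => y; rewrite andbT.
  by move=> k; rewrite inE.
apply: le_trans (prob_count_le p01 t01 x t1 (d := d) (Us := Us) _ _).
- apply: prob_le => // A; apply: le_trans.
  rewrite -sum1_count natr_sum big_map big_enum_cond/= [leLHS]big_mkcond [leRHS]big_mkcond/=.
  apply: ler_sum => k _; rewrite inE -/(contains A _).
  by case: (k \in reps N I c n) => //; case: (inj_on I k) => //=; case: (contains A _).
- by move=> _ /mapP[k _ ->]; exact: below_elts.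
move=> _ /mapP[k _ ->]; apply: le_trans (hit_weight_le (leq_imset_card k I)).
rewrite big_map big_enum_cond/= [leLHS]big_mkcond [leRHS]big_mkcond/=; apply: ler_sum => k' _.
rewrite inE has_elts prod_elts; case: (k' \in reps N I c n) => //=.
case: [disjoint _ & _]; rewrite ?andbF//= andbT.
rewrite (_ : \prod_(x in k' @: I | _) _ = weight p (k' @: I :\: k @: I)).
  by case: ifP => // _; exact: weight_ge0.
by apply: eq_bigl => y; rewrite in_setD mem_elts andbC.
Qed.

Lemma lower_tail e F : 0 < e <= 3^-1 -> 0 < F -> (1 - e / 4) * F <= rep_mass p N I c n ->
  4 * (1 + (#|I| ^ 2)%:R * wcount_factor C L #|I|) / e ^+ 2 * W n * (lnS n + 1) <= F ->
  prob p N.+1 (fun A => count_in N A I c n <= (1 - 3 * e) * F) <= (n.+1%:R ^+ 2)^-1.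
Proof.
move=> /andP[e0 e3] F0 massF growth; have l0 := lnS_ge0 R n.
have q0 : 0 <= (#|I| ^ 2)%:R * wcount_factor C L #|I|.
  by rewrite !mulr_ge0 ?exprn_ge0 ?addr_ge0.
have dE : d = (#|I| ^ 2)%:R * wcount_factor C L #|I| * W n by rewrite /d mulrA.
have d0 : 0 <= d by rewrite dE mulr_ge0// ltW.
have [t t0 tE] : exists2 t, 0 < t & t * (1 + d) = e / 2.
  exists (e / (2 * (1 + d))); first by rewrite divr_gt0// mulr_gt0// ltr_wpDr.
  by field; rewrite lt0r_neq0// ltr_wpDr.
have td0 : 0 <= t * d by rewrite mulr_ge0// ltW.
have t01 : 0 < t < 1 by rewrite t0/=; lra.
apply: (le_trans (prob_count_in_le _ t01)).
rewrite -(expR_lnS R n) -expRM_natl -expRN ler_expR.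
apply: (lower_tail_exponent e0 e3 d0 l0 F0 t0 tE); last by apply: le_trans inj_weight_ge; lra.
apply: (@le_trans _ _ (4 * (1 + (#|I| ^ 2)%:R * wcount_factor C L #|I|) * W n * (lnS n + 1))).
  rewrite dE ler_wpM2r ?addr_ge0//; move: q0 (W_ge1 n); move: (_ * wcount_factor _ _ _) (W n).
  by move=> q w q0 w1; have := mulr_ge0 q0 (le_trans ler01 w1); lra.
have e20 : 0 < e ^+ 2 by exact: exprn_gt0.
have := ler_wpM2l (ltW e20) growth; apply: le_trans.
by rewrite le_eqVlt; apply/orP; left; apply/eqP; field; exact: lt0r_neq0.
Qed.

Lemma deviation_tail e D F : 0 < e <= 3^-1 -> 0 <= D -> 0 < F ->
  `|rep_mass p N I c n - F| <= e / 4 * F ->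
  (#|I| ^ 2)%:R * D * (4 / e + 2) / e * W n * (lnS n + 1) <= F ->
  4 * (1 + (#|I| ^ 2)%:R * wcount_factor C L #|I|) / e ^+ 2 * W n * (lnS n + 1) <= F ->
  prob p N.+1 (fun A => low_sparse D N A /\ 3 * e * F < `|count_in N A I c n - F|) <=
    2 * (n.+1%:R ^+ 2)^-1.
Proof.
move=> eI D0 F0; rewrite ler_norml => /andP[mass_ge mass_le] growth_up growth_low.
have /andP[e0 _] := eI; have eF : 0 < e * F by rewrite mulr_gt0.
have mass_up : rep_mass p N I c n <= (1 + e / 4) * F by lra.
have mass_low : (1 - e / 4) * F <= rep_mass p N I c n by lra.
rewrite [leRHS]mulr_natl mulr2n.
apply: le_trans (lerD (upper_tail eI D0 F0 mass_up growth_up)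
  (lower_tail eI F0 mass_low growth_low)).
apply: le_trans (prob_or p01 _ _ _); apply: prob_le => // A [low].
by rewrite ltr_normr => /orP[far|far]; [left; split=> //|right]; lra.
Qed.

End tails.
End concentration.

Lemma exists_avoiding_all (R : realType) (p : nat -> R) (M N n1 : nat)
    (Typical : pred nat -> Prop) (Bad : nat -> pred nat -> Prop) :
  (forall x, 0 <= p x <= 1) -> (8 <= n1)%N -> prob p M (fun A => ~ Typical A) <= 4^-1 ->
  (forall n, (n1 <= n <= N)%N ->
    prob p M (fun A => Typical A /\ Bad n A) <= 2 * (n.+1%:R ^+ 2)^-1) ->
  exists A, forall n, (n1 <= n <= N)%N -> ~ Bad n A.
Proof.
move=> p01 n18 untypical bad.
have : prob p M (fun A => ~ Typical A \/
    exists2 n, n \in index_iota n1 N.+1 & Typical A /\ Bad n A) < 1.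
  apply: (le_lt_trans (prob_or p01 _ _ _)).
  apply: (@le_lt_trans _ _ (4^-1 + \sum_(n1 <= n < N.+1) 2 * (n.+1%:R ^+ 2)^-1)).
    apply: lerD => //; apply: (le_trans (prob_exists p01 _ _ _)).
    by rewrite big_nat_cond [leRHS]big_nat_cond; apply: ler_sum => n /andP[nI _]; exact: bad.
  have := @sum_inv_sqr_le R n1 N.+1 (leq_trans (ltn0Sn 7) n18).
  have : n1%:R^-1 <= 8^-1 :> R by rewrite lef_pV2 ?posrE ?ltr0n ?ler_nat// (leq_trans _ n18).
  rewrite -mulr_sumr; lra.
move=> /(prob_lt1_exists p01)[A avoid]; exists A => n nI badn; apply: avoid.
have [typ|] := pselect (Typical A); last by left.
by right; exists n => //; rewrite mem_index_iota.
Qed.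

Section random_set.
Import boot.fintype boot.finset.
Variables (R : realType) (h : nat) (b : 'I_h -> nat) (p : nat -> R) (W f : nat -> R) (C z : R).
Hypothesis p01 : forall x, 0 <= p x <= 1.
Hypothesis b0 : forall i, (0 < b i)%N.
Hypothesis W_ge1 : forall m, 1 <= W m.
Hypothesis W_homo : {homo W : m n / (m <= n)%N >-> m <= n}.
Hypotheses (C0 : 0 <= C) (z0 : 0 < z).
Hypothesis rep_mass_low : forall N (I : {set 'I_h}) c m, (0 < #|I| <= h.-1)%N ->
  admissible (\sum_(i < h) b i) I c -> (m <= N)%N ->
  rep_mass p N I c m <= C * W m * expR (- z * lnS m).
Local Open Scope classical_set_scope.
Local Open Scope ring_scope.

Local Notation full := (finset.setTfor 'I_h).

Let admissible_full : admissible (\sum_(i < h) b i) full b.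
Proof.
rewrite /admissible; apply/andP; split; first by apply/forall_inP => i _.
by rewrite (eq_bigl xpredT)// => i; rewrite inE.
Qed.

Let card_full : (#|full| <= h.-1.+1)%N.
Proof. by rewrite cardsT card_ord leqSpred. Qed.

Let rep_countE N A n : (n <= N)%N -> (rep_count b A n)%:R = count_in R N A full b n.
Proof. exact: rep_count_wcount. Qed.

Lemma rep_count_deviation (D : R) : 0 <= D ->
  iter_conv p [seq b i | i <- enum full] n / f n @[n --> \oo] --> (1 : R) ->
  (forall K, \forall n \near \oo, K * W n * (lnS n + 1) <= f n) ->
  forall e : R, 0 < e <= 3^-1 -> \forall n \near \oo, 0 < f n /\ forall N, (n <= N)%N ->
    prob p N.+1 (fun A => low_sparse 'I_h (\sum_(i < h) b i) h.-1 W D N A /\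
      3 * e * f n < `|(rep_count b A n)%:R - f n|) <= 2 * (n.+1%:R ^+ 2)^-1.
Proof.
move=> D0 mass_cvg growth e eI; have /andP[e0 _] := eI.
have e40 : 0 < e / 4 by rewrite divr_gt0.
have mass_near : \forall n \near \oo,
    `|iter_conv p [seq b i | i <- enum full] n / f n - 1| <= e / 4.
  by move/cvgrPdistC_le : mass_cvg; apply.
near=> n.
have f0 : 0 < f n.
  have : 1 * W n * (lnS n + 1) <= f n by near: n; exact: growth.
  apply: lt_le_trans; have W0 : 0 < W n := lt_le_trans ltr01 (W_ge1 n).
  by rewrite mul1r mulr_gt0// ltr_wpDl// lnS_ge0.
split => // N nN.
have massE : rep_mass p N full b n = iter_conv p [seq b i | i <- enum full] n.
  exact: rep_mass_iter_conv.
under [X in prob _ _ X]eq_fun do rewrite (rep_countE _ nN).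
apply: (deviation_tail p01 W_ge1 W_homo C0 z0 rep_mass_low card_full admissible_full) => //.
- rewrite massE (_ : _ - f n = (iter_conv p [seq b i | i <- enum full] n / f n - 1) * f n).
    by rewrite normrM (gtr0_norm f0) ler_wpM2r ?(ltW f0)//; exact: (near mass_near n).
  by field; exact: lt0r_neq0.
- by near: n; exact: growth.
- by near: n; exact: growth.
Unshelve. all: by end_near. Qed.

Theorem exists_concentrated :
  iter_conv p [seq b i | i <- enum full] n / f n @[n --> \oo] --> (1 : R) ->
  (forall K, \forall n \near \oo, K * W n * (lnS n + 1) <= f n) ->
  exists A : pred nat, (rep_count b A n)%:R / f n @[n --> \oo] --> (1 : R).
Proof.
move=> mass_cvg growth.
have [D D0 sparse] := prob_not_low_sparse p01 W_ge1 W_homo C0 z0 rep_mass_low.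
have third0 : 0 < 3^-1 :> R by rewrite invr_gt0.
have [e e_cvg [n0 _ deviation]] :=
  diagonal_tolerance third0 (rep_count_deviation D0 mass_cvg growth).
pose n1 := maxn n0 8.
pose Close n A := (n1 <= n)%N -> `|(rep_count b A n)%:R - f n| <= 3 * e n * f n.
have [A close] : exists A, forall n, Close n A.
  apply: local_conditions_compactness => [n A A' AA' close /close|N].
    rewrite !(rep_countE _ (leqnn n)).
    suff -> : count_in R n A full b n = count_in R n A' full b n by [].
    apply: eq_bigr => k _; congr (nat_of_bool _)%:R.
    by apply: eq_in_all => _ /mapP[x _ ->]; apply: AA'; rewrite -ltnS ltn_ord.
  have [||n /andP[n1n nN]|A avoid] := @exists_avoiding_all R p N.+1 N n1
    (low_sparse 'I_h (\sum_(i < h) b i) h.-1 W D N)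
    (fun n A => 3 * e n * f n < `|(rep_count b A n)%:R - f n|) p01.
  - exact: leq_maxr.
  - exact: sparse.
  - have [_] := deviation n (leq_trans (leq_maxl _ _) n1n); exact.
  by exists A => n nN n1n; rewrite leNgt; apply/negP; apply: avoid; rewrite n1n.
exists A; apply/cvgrPdistC_le => d d0; have {}d0 : 0 < d :> R by [].
have d30 : 0 < d / 3 by rewrite divr_gt0.
have e_small : \forall n \near \oo, `|e n| <= d / 3 by move/cvgr0Pnorm_le : e_cvg; apply.
near=> n; have n1n : (n1 <= n)%N by near: n; exists n1.
have [f0 _] := deviation n (leq_trans (leq_maxl _ _) n1n).
have -> : (rep_count b A n)%:R / f n - 1 = ((rep_count b A n)%:R - f n) / f n.
  by field; exact: lt0r_neq0.
rewrite normrM normfV (gtr0_norm f0) ler_pdivrMr// (le_trans (close n n1n))//.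
rewrite ler_wpM2r ?(ltW f0)//.
have : `|e n| <= d / 3 by exact: (near e_small n).
by have := ler_norm (e n); lra.
Unshelve. all: by end_near. Qed.

End random_set.

(** * Choice of the probabilities *)

Section regular_sequences.
Variable R : realType.
Implicit Types (v f s g d : nat -> R) (rho c e K C : R).
Local Open Scope classical_set_scope.
Local Open Scope ring_scope.

Lemma ln_regvar_index_le rho v c K : ln_regvar rho v ->
  (\forall n \near \oo, v n <= c * lnS n + K) -> rho <= c.
Proof.
move=> v_regvar v_le; rewrite leNgt; apply/negP => c_rho.
have mid_rho : (c + rho) / 2 < rho by lra.
have [K' v_ge] := ln_regvar_ge v_regvar mid_rho.
have c_mid : 0 < (c + rho) / 2 - c by lra.
near \oo => n.
have v_le_n : v n <= c * lnS n + K by near: n.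
have : (K - K' + 1) / ((c + rho) / 2 - c) <= lnS n :> R.
  by near: n; exact: (cvgry_ge (@cvg_lnS R)).
by rewrite ler_pdivrMr//; have := v_ge n; lra.
Unshelve. all: by end_near. Qed.

Lemma ln_regvar_index_ge rho v c K : ln_regvar rho v ->
  (\forall n \near \oo, c * lnS n + K <= v n) -> c <= rho.
Proof.
move=> v_regvar v_ge; rewrite -lerN2 -mulN1r.
apply: (ln_regvar_index_le (K := - K) (ln_regvarZ (-1) v_regvar)).
by apply: filterS v_ge => n; lra.
Qed.

Lemma cvg_ratio_expR s g d C : 0 < C -> s n / expR (g n) - C @[n --> \oo] --> 0 ->
  d n @[n --> \oo] --> 0 -> s n / expR (g n + ln C + d n) @[n --> \oo] --> (1 : R).
Proof.
move=> C0 s_cvg d_cvg.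
have ratio_cvg : s n / expR (g n) @[n --> \oo] --> C by apply/subr_cvg0.
have expR_cvg : expR (- d n) @[n --> \oo] --> (1 : R).
  rewrite -expR0 -oppr0; apply: continuous_cvg; [exact: continuous_expR|exact: cvgN].
have ratioE n : s n / expR (g n + ln C + d n) = s n / expR (g n) * (C^-1 * expR (- d n)).
  by rewrite expRN !expRD lnK ?posrE//; field; rewrite !lt0r_neq0 ?expR_gt0.
under eq_fun do rewrite ratioE.
have -> : 1 = C * (C^-1 * 1) by rewrite mulr1 mulfV// lt0r_neq0.
by apply: cvgM => //; apply: cvgM => //; exact: cvg_cst.
Qed.

Lemma cvg_min0B v : (forall e, 0 < e -> \forall n \near \oo, v n <= e) ->
  Num.min 0 (v n) - v n @[n --> \oo] --> 0.
Proof.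
move=> v_le; apply/cvgr0Pnorm_le => e e0; apply: filterS (v_le e e0) => n vn_le.
rewrite minEle; case: ifPn => [v_ge0|_]; last by rewrite subrr normr0 ltW.
by rewrite sub0r normrN ger0_norm.
Qed.

Lemma finite_uniform_bound (T : finType) (P : pred T) (Q : T -> R -> Prop) :
  (forall x C C', C <= C' -> Q x C -> Q x C') ->
  (forall x, P x -> exists2 C, 0 <= C & Q x C) ->
  exists2 C, 0 <= C & forall x, P x -> Q x C.
Proof.
move=> Q_mono Q_ex; have /choice[Cf Cf_spec] x : exists C, 0 <= C /\ (P x -> Q x C).
  case: (boolP (P x)) => [/Q_ex[C C0 QC]|_]; first by exists C.
  by exists 0.
exists (\sum_x Cf x) => [|x Px]; first by apply: sumr_ge0 => x _; case: (Cf_spec x).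
have [_ /(_ Px)] := Cf_spec x; apply: Q_mono; rewrite (bigD1 x)//= lerDl.
by apply: sumr_ge0 => y _; case: (Cf_spec y).
Qed.

End regular_sequences.

Section sequence_of_order.
Variables (R : realType) (h : nat) (b : 'I_h -> nat).
Hypothesis h2 : (2 <= h)%N.
Hypothesis b0 : forall i, (0 < b i)%N.
Hypothesis b_gcd : \big[gcdn/0%N]_(i < h) b i = 1%N.
Variables (rho : R) (f : nat -> R).
Hypothesis f_regvar : ln_regvar rho f.
Implicit Types (e K C : R) (v : nat -> R).
Local Open Scope classical_set_scope.
Local Open Scope ring_scope.
Hypothesis f_growth : forall K, \forall n \near \oo, K * (lnS n + 1) <= expR (f n).
Local Notation top_const := ((h.-1`!%:R * (\prod_(i < h) b i)%:R)^-1 : R).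
Hypothesis f_upper : forall e, 0 < e -> \forall n \near \oo,
  f n <= h.-1%:R * lnS n + ln top_const + e.

Let h0 : (0 < h)%N. Proof. exact: ltnW. Qed.
Let hR : 0 < h%:R :> R. Proof. by rewrite ltr0n. Qed.
Let hE : h.-1%:R = h%:R - 1 :> R. Proof. by rewrite -[in RHS](prednK h0) -natr1 addrK. Qed.

Lemma index_ge0 : 0 <= rho.
Proof.
apply: (ln_regvar_index_ge (K := 0) f_regvar); apply: filterS (f_growth 1) => n.
rewrite mul1r mul0r addr0 -[_ <= f n]ler_expR expR0; apply: le_trans.
by rewrite lerDr lnS_ge0.
Qed.

Lemma index_le : rho <= h%:R - 1.
Proof.
rewrite -hE; apply: (ln_regvar_index_le (K := ln top_const + 1) f_regvar).
by apply: filterS (f_upper ltr01) => n; rewrite addrA.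
Qed.

(* The probabilities have index sg = kappa - 1, so that l-fold convolutions have
   index l kappa - 1, and the h-fold one has the index rho of f. *)
Let kappa := (rho + 1) / h%:R.
Let sg := kappa - 1.

Let h_kappa : h%:R * kappa = rho + 1.
Proof. by rewrite /kappa mulrC divfK// lt0r_neq0. Qed.

Let kappa0 : 0 < kappa.
Proof. by rewrite divr_gt0//; have := index_ge0; lra. Qed.

Let sg1 : -1 < sg. Proof. by rewrite /sg ltrBrDr addNr. Qed.

Let sg_le0 : sg <= 0.
Proof. by rewrite subr_le0 ler_pdivrMr// mul1r -lerBrDr index_le. Qed.

Local Notation cs := [seq b i | i <- enum (finset.setTfor 'I_h)].

Let cs_gt0 : all (ltn 0) cs. Proof. by apply/allP => _ /mapP[i _ ->]; exact: b0. Qed.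

Let size_cs : size cs = h. Proof. by rewrite size_map -cardE cardsT card_ord. Qed.

Let cs_neq0 : cs != [::]. Proof. by rewrite -size_eq0 size_cs -lt0n. Qed.

Let gcd_cs : \big[gcdn/0%N]_(a <- cs) a = 1%N.
Proof. by rewrite -b_gcd big_map big_enum/=; apply: eq_bigl => i; rewrite inE. Qed.

Let C := conv_const sg cs.

Let C_gt0 : 0 < C. Proof. exact: conv_const_gt0. Qed.

Let CE : sg = 0 -> C = top_const.
Proof.
move=> sg0; rewrite /C sg0 conv_const0 size_cs big_map big_enum/=.
by congr (_ * _%:R)^-1; apply: eq_bigl => i; rewrite inE.
Qed.

(* Logarithm of the probability making the expected number of representations of order e^f;
   it exceeds 0 at most negligibly. *)
Let v0 n := h%:R^-1 * (f n + (- h.-1%:R * lnS n + - ln C)).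

Let v0_regvar : ln_regvar sg v0.
Proof.
have C_regvar : ln_regvar 0 (fun=> - ln C) by apply: ln_regvar_cvg; exact: cvg_cst.
have := ln_regvarZ h%:R^-1 (ln_regvarD f_regvar
  (ln_regvarD (ln_regvarZ (- h.-1%:R) (@ln_regvar_lnS R)) C_regvar)).
by rewrite (_ : _ * _ = sg)// /sg /kappa hE; field; exact: lt0r_neq0.
Qed.

Let v0_le e : 0 < e -> \forall n \near \oo, v0 n <= e.
Proof.
move=> e0; have [sg0|sg_neq0] := eqVneq sg 0.
  apply: filterS (f_upper (mulr_gt0 hR e0)) => n f_le.
  by rewrite /v0 (CE sg0) ler_pdivrMl//; lra.
have sg_lt : sg < sg / 2 by have := sg_le0; rewrite le_eqVlt (negbTE sg_neq0)/=; lra.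
have [K v0_leK] := ln_regvar_le v0_regvar sg_lt.
near=> n; apply: (le_trans (v0_leK n)).
have : (K - e) / - (sg / 2) <= lnS n :> R by near: n; exact: (cvgry_ge (@cvg_lnS R)).
by rewrite ler_pdivrMr; lra.
Unshelve. all: by end_near. Qed.

Lemma exists_ln_probability : exists v, [/\ ln_regvar sg v, forall n, v n <= 0 &
  iter_conv (expR \o v) cs n / expR (f n) @[n --> \oo] --> (1 : R)].
Proof.
pose v n : R := Num.min 0 (v0 n).
have v_v0 : v n - v0 n @[n --> \oo] --> 0 := cvg_min0B v0_le.
have v_regvar : ln_regvar sg v := eq_ln_regvar v_v0 v0_regvar.
exists v; split => //; first by move=> n; rewrite ge_min lexx.
have fE n : f n = conv_order h v n + ln C + - (h%:R * (v n - v0 n)).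
  by rewrite /conv_order /v0 hE; field; exact: lt0r_neq0.
under eq_fun do rewrite fE; apply: cvg_ratio_expR => //.
  have iter_cvg := cvg_iter_conv v_regvar sg1 cs_gt0 cs_neq0.
  by move: iter_cvg; rewrite size_cs gcd_cs; under eq_fun do rewrite dvd1n !mulr1.
rewrite -oppr0 -[X in - X](mulr0 h%:R); apply: cvgN; apply: cvgM v_v0; exact: cvg_cst.
Qed.

Lemma exists_low_exponent : exists theta : R, [/\ 0 <= theta, rho - kappa < theta &
  forall K, \forall n \near \oo, K * expR (theta * lnS n) * (lnS n + 1) <= expR (f n)].
Proof.
have rho0 := index_ge0; have [rho_eq0|rho_neq0] := eqVneq rho 0.
  exists 0; split => //; first by rewrite rho_eq0 sub0r oppr_lt0.
  by move=> K; apply: filterS (f_growth K) => n; rewrite mul0r expR0 mulr1.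
have {rho_neq0}rho_gt0 : 0 < rho by rewrite lt_def rho_neq0.
have [theta [theta0 theta_low theta_rho]] :
    exists theta, [/\ 0 <= theta, rho - kappa < theta & theta < rho].
  exists (Num.max 0 (rho - kappa / 2)); rewrite le_max lexx; split => //.
    by rewrite lt_max ltrD2l ltrN2 ltr_pdivrMr// ltr_pMr// ltr1n orbT.
  by rewrite gt_max rho_gt0 ltrBlDr ltrDl divr_gt0.
exists theta; split => // K.
have mid_rho : (theta + rho) / 2 < rho by lra.
have [K' f_ge] := ln_regvar_ge f_regvar mid_rho.
have mid_theta : 0 < (theta + rho) / 2 - theta by lra.
have affine_le : \forall n \near \oo,
    K * (lnS n + 1) <= expR K' * expR (((theta + rho) / 2 - theta) * lnS n).
  exact: (@cvg_lnS R _ (near_affine_le_expR K (expR_gt0 K') mid_theta)).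
apply: filterS affine_le => n K_le; have f_ge_n := f_ge n; rewrite -ler_expR in f_ge_n.
apply: le_trans f_ge_n.
rewrite mulrAC (le_trans (ler_wpM2r (expR_ge0 _) K_le))//.
by rewrite -!expRD ler_expR; lra.
Qed.

Lemma iter_conv_low v theta z (s : seq nat) : ln_regvar sg v -> rho - kappa < theta - z ->
  all (ltn 0) s -> (0 < size s <= h.-1)%N ->
  exists2 K, 0 <= K & forall m,
    iter_conv (expR \o v) s m <= K * expR (theta * lnS m) * expR (- z * lnS m).
Proof.
move=> v_regvar theta_z s0 /andP[size0 size_le].
have s_neq0 : s != [::] by rewrite -size_eq0 -lt0n.
have [K K0 conv_le] := iter_conv_bound v_regvar sg1 s0 s_neq0.
have index_lt : conv_index sg (size s) < theta - z.
  apply: le_lt_trans theta_z; rewrite /conv_index /sg subrK.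
  have : (size s)%:R * kappa <= (h%:R - 1) * kappa by rewrite ler_wpM2r ?(ltW kappa0)// -hE ler_nat.
  by rewrite mulrBl h_kappa mul1r; lra.
have [K' order_le] := ln_regvar_le (ln_regvar_conv_order (size s) v_regvar) index_lt.
exists (K * expR K') => [|m]; first by rewrite mulr_ge0 ?expR_ge0// ltW.
rewrite (le_trans (conv_le m))// -!mulrA ler_wpM2l ?(ltW K0)// -!expRD ler_expR.
by have := order_le m; lra.
Qed.

Lemma rep_mass_low v theta z : ln_regvar sg v -> rho - kappa < theta - z ->
  exists2 K, 0 <= K & forall N (I : {set 'I_h}) c m, (0 < #|I| <= h.-1)%N ->
    admissible (\sum_(i < h) b i) I c -> (m <= N)%N ->
    rep_mass (expR \o v) N I c m <= K * expR (theta * lnS m) * expR (- z * lnS m).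
Proof.
move=> v_regvar theta_z; set B := (\sum_(i < h) b i)%N.
pose low (x : {set 'I_h} * {ffun 'I_h -> 'I_B.+1}) :=
  (0 < #|x.1| <= h.-1)%N && admissible B x.1 (fun i => x.2 i).
have [|x /andP[x_size x_adm]|K K0 conv_le] := @finite_uniform_bound R _ low (fun x K => forall m,
  iter_conv (expR \o v) [seq (x.2 i : nat) | i <- enum x.1] m <=
  K * expR (theta * lnS m) * expR (- z * lnS m)).
- by move=> x K K' KK' le_K m; rewrite (le_trans (le_K m))// !ler_wpM2r ?expR_ge0.
- apply: iter_conv_low => //; last by rewrite size_map -cardE.
  have /andP[/forall_inP x_gt0 _] := x_adm.
  by apply/allP => _ /mapP[i ix ->]; apply: x_gt0; rewrite -mem_enum.
exists K => // N I c m I_size adm mN; have [c' cc' adm'] := admissible_ffun adm.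
have /andP[/forall_inP c_gt0 _] := adm.
rewrite rep_mass_iter_conv//.
have -> : [seq c i | i <- enum I] = [seq (c' i : nat) | i <- enum I].
  by apply/eq_in_map => i; rewrite mem_enum; exact: cc'.
by apply: (conv_le (I, c')); rewrite /low I_size adm'.
Qed.

Theorem exists_rep_count_asymptotics : exists A : pred nat,
  (rep_count b A n)%:R / expR (f n) @[n --> \oo] --> (1 : R).
Proof.
have [v [v_regvar v_le0 mass_cvg]] := exists_ln_probability.
have [theta [theta0 theta_low growth]] := exists_low_exponent.
have p01 x : 0 <= (expR \o v) x <= 1 by rewrite expR_ge0 expR_le1 v_le0.
pose W m := expR (theta * lnS m).
have W_ge1 m : 1 <= W m by rewrite -expR0 ler_expR mulr_ge0// lnS_ge0.
have W_homo : {homo W : m n / (m <= n)%N >-> m <= n}.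
  by move=> m n mn; rewrite ler_expR ler_wpM2l// le_lnS.
have z0 : 0 < (theta - (rho - kappa)) / 2 by lra.
have theta_z : rho - kappa < theta - (theta - (rho - kappa)) / 2 by lra.
have [K K0 mass_low] := rep_mass_low v_regvar theta_z.
exact: (exists_concentrated p01 b0 W_ge1 W_homo K0 z0 mass_low mass_cvg growth).
Qed.

End sequence_of_order.

Section growth_conditions.
Variables (R : realType) (F : R -> R).
Hypothesis F0 : forall x, 1 <= x -> 0 < F x.
Local Open Scope classical_set_scope.
Local Open Scope ring_scope.

Lemma near_natr (P : R -> Prop) : (\forall x \near +oo, P x) -> \forall n \near \oo, P n%:R.
Proof. exact: cvgr_idn. Qed.

Lemma lnS_growth (K : R) : F x / ln x @[x --> +oo] --> +oo ->
  \forall n \near \oo, K * (lnS n + 1) <= F n%:R.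
Proof.
move=> /cvgryPge/(_ (3 * `|K|))/near_natr F_ge; near=> n.
have n0 : (0 < n)%N by near: n; exact: nbhs_infty_gt.
have ln_ge1 : 1 <= ln n%:R :> R.
  rewrite -ler_expR lnK ?posrE ?ltr0n//; near: n; exact: nbhs_infty_ger.
have lnS_le : lnS n <= ln n%:R + 1 :> R.
  rewrite -lerBlDl (le_trans (ler_norm _))// (le_trans (lnS_dist_ln R n0))//.
  by rewrite invf_le1 ?ltr0n// ler1n.
have : 3 * `|K| <= F n%:R / ln n%:R by near: n.
rewrite ler_pdivlMr; last by lra.
apply: le_trans; rewrite (le_trans (ler_norm _))// normrM [3 * _]mulrC -mulrA ler_wpM2l//.
by rewrite ger0_norm ?addr_ge0 ?lnS_ge0//; lra.
Unshelve. all: by end_near. Qed.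

Lemma ln_upper (eps : R -> R) (l : nat) (D e : R) : 0 < D -> 0 < e ->
  eps x @[x --> +oo] --> 0 -> (\forall x \near +oo, F x <= (1 + eps x) * (x ^+ l / D)) ->
  \forall n \near \oo, ln (F n%:R) <= l%:R * lnS n + ln D^-1 + e.
Proof.
move=> D0 e0 /cvgr0Pnorm_le/(_ e e0)/near_natr eps_le /near_natr F_le; near=> n.
have n1 : 1 <= n%:R :> R by rewrite ler1n; near: n; exact: nbhs_infty_gt.
have e1 : 0 < 1 + e by rewrite addr_gt0.
have DV : 0 < D^-1 by rewrite invr_gt0.
have eps_n : eps n%:R <= e by rewrite (le_trans (ler_norm _))//; near: n.
have F_n : F n%:R <= (1 + eps n%:R) * (n%:R ^+ l / D) by near: n.
have : F n%:R <= (1 + e) * (n.+1%:R ^+ l / D).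
  apply: (le_trans F_n); apply: (@le_trans _ _ ((1 + e) * (n%:R ^+ l / D))).
    by rewrite ler_wpM2r ?lerD2l// divr_ge0 ?exprn_ge0// ltW.
  by rewrite ler_pM2l// ler_pM2r// lerXn2r ?nnegrE// ler_nat.
rewrite -ler_ln ?posrE ?F0 ?mulr_gt0 ?exprn_gt0//.
rewrite lnM ?posrE ?mulr_gt0 ?exprn_gt0// lnM ?posrE ?exprn_gt0// lnXn// -[ln _ *+ l]mulr_natl.
have e_gtN1 : -1 < e by rewrite (lt_trans _ e0)// ltrN10.
by have := le_ln1Dx e_gtN1; rewrite /lnS; lra.
Unshelve. all: by end_near. Qed.

End growth_conditions.

Local Open Scope classical_set_scope.
Local Open Scope ring_scope.

Theorem theorem1 (R : realType) (h : nat) (b : 'I_h -> nat)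
  (h2 : (2 <= h)%N)
  (bpos : forall i, (0 < b i)%N)
  (bgcd : \big[gcdn/0%N]_(i < h) b i = 1%N)
  (F : R -> R)
  (Freg : regularly_varying F)
  (Flog : (F x / ln x) @[x --> +oo%R] --> +oo)
  (Fup : exists eps : R -> R, eps x @[x --> +oo%R] --> 0 /\
     \forall x \near +oo,
        F x <= (1 + eps x) *
               (x ^+ h.-1 / ((h.-1)`!%:R * (\prod_(i < h) b i)%:R))) :
  exists A : pred nat,
    ((rep_count b A n)%:R / F n%:R) @[n --> \oo] --> (1 : R).
Proof.
have [F0 _] := Freg; have [eps [eps_cvg F_le]] := Fup.
have expR_lnF : \forall n \near \oo, expR (ln (F n%:R)) = F n%:R.
  by exists 1%N => // n n1; rewrite lnK// posrE F0// ler1n.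
have [rho f_regvar] := ln_regvar_regularly_varying Freg.
have f_growth (K : R) : \forall n \near \oo, K * (lnS n + 1) <= expR (ln (F n%:R)).
  by apply: filterS2 expR_lnF (lnS_growth K Flog) => n ->.
have D0 : 0 < (h.-1)`!%:R * (\prod_(i < h) b i)%:R :> R.
  by rewrite mulr_gt0// ltr0n ?fact_gt0// prodn_gt0.
have f_upper (e : R) (e0 : 0 < e) := ln_upper F0 D0 e0 eps_cvg F_le.
have [A A_cvg] := exists_rep_count_asymptotics h2 bpos bgcd f_regvar f_growth f_upper.
exists A; apply: cvg_trans (near_eq_cvg _) A_cvg.
by apply: filterS expR_lnF => n /= ->.
Qed.
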